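(* Let $C$ be an integral and complete curve over an algebraically closed field $k$ of arbitrary characteristic, with dualizing sheaf $\omega$. If $C$ is either nonhyperelliptic and Gorenstein, or else nearly Gorenstein, then the natural homomorphisms $$\mathrm{Sym}^{n}\,H^{0}(C,\omega)\longrightarrow H^{0}(C,\omega^{n})$$ are surjective for all $n\geq 1$.
   Context: A curve $C$ is hyperelliptic if there is a morphism $C\to\mathbb{P}^1$ of degree $2$ (and nonhyperelliptic otherwise). $C$ is Gorenstein if $\omega$ is invertible; a point $P\in C$ is Gorenstein if $\omega_P$ is a free $\mathcal{O}_P$-module, and non-Gorenstein otherwise. Let $\nu:\overline{C}\to C$ be the normalization, $\overline{\mathcal{O}}:=\nu_*(\mathcal{O}_{\overline{C}})$, and let $\mathcal{C}$ be the conductor of $\overline{\mathcal{O}}$ into $\mathcal{O}=\mathcal{O}_C$. $C$ is called nearly Gorenstein if it has only one non-Gorenstein point $P$ and the local ring $\mathcal{O}_P$ is almost Gorenstein (in the sense of Barucci and Fröberg), i.e. $$\dim(\overline{\mathcal{O}}_P/\mathcal{O}_P)=\dim(\mathcal{O}_P/\mathcal{C}_P)+\dim(\mathrm{Ext}^1(k,\mathcal{O}_P))-1,$$ where dimensions are over the ground field $k$, which is also the residue field of $\mathcal{O}_P$, and $\mathrm{Ext}^1$ is taken over $\mathcal{O}_P$. For a coherent sheaf $\mathcal{F}$ on $C$, $\mathcal{F}^n:=\mathrm{Sym}^n\mathcal{F}/\mathrm{Torsion}(\mathrm{Sym}^n\mathcal{F})$; in particular $\omega^n$ is the symmetric power of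 $\omega$ modulo torsion. The homomorphism in the claim is the natural one induced by multiplication of sections. *)

(* Defs.v *)
From HB Require Import structures.
From mathcomp Require Import all_boot all_order all_algebra.
From mathcomp Require Import fingroup perm.
From mathcomp Require Import boolp classical_sets functions cardinality.

Set Implicit Arguments.
Unset Strict Implicit.
Unset Printing Implicit Defensive.

Import GRing.Theory.
Local Open Scope classical_set_scope.
Local Open Scope ring_scope.

(* An integral separated scheme of finite type over k is described, following
   Chevalley and Zariski--Samuel (Commutative Algebra II, Ch. VI, 17), by its
   function field K and by the set of its local rings, which are subrings of K:
   a point IS its local ring.  Thus P : set K stands both for the point P and
   for O_P, and a variety is C : set (set K).  The inclusion of the constants is
   iota : k -> K, where iota is a ring morphism. *)

Definition subring (K : fieldType) (A : set K) : Prop :=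
  [/\ A 1, forall x y, A x -> A y -> A (x - y)
         & forall x y, A x -> A y -> A (x * y)].

Definition subalgebra (k K : fieldType) (iota : {rmorphism k -> K})
    (A : set K) : Prop :=
  subring A /\ forall c, A (iota c).

Definition generated_algebra (k K : fieldType) (iota : {rmorphism k -> K})
    (s : seq K) : set K :=
  [set f | forall B, subalgebra iota B -> (forall x, x \in s -> B x) -> B f].

Definition Rspan (K : fieldType) (W : lmodType K) (R : set K) (S : set W) :
    set W :=
  [set w | exists m (a : 'I_m -> K) (s : 'I_m -> W),
     [/\ forall i, R (a i), forall i, S (s i) & w = \sum_i a i *: s i]].

(* dim_k (B / A) = d, for k-subspaces A of B. *)
Definition dim_quot (k K : fieldType) (iota : {rmorphism k -> K})
    (W : lmodType K) (B A : set W) (d : nat) : Prop :=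
  exists e : 'I_d -> W, (forall i, B (e i)) /\
    forall b, B b ->
      exists! c : {ffun 'I_d -> k}, A (b - \sum_i iota (c i) *: e i).

Definition rational_subfield (k K : fieldType) (iota : {rmorphism k -> K})
    (x : K) : set K :=
  [set f | exists p q : {poly k},
     (map_poly iota q).[x] != 0 /\
     f = (map_poly iota p).[x] / (map_poly iota q).[x]].

(* [K : k(x)] = d *)
Definition degree_over (k K : fieldType) (iota : {rmorphism k -> K})
    (x : K) (d : nat) : Prop :=
  exists e : 'I_d -> K, forall f,
    exists! c : {ffun 'I_d -> K},
      (forall i, rational_subfield iota x (c i)) /\ f = \sum_i c i * e i.

Definition transcendental (k K : fieldType) (iota : {rmorphism k -> K})
    (x : K) : Prop :=
  forall p : {poly k}, (map_poly iota p).[x] = 0 -> p = 0.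

Definition function_field1 (k K : fieldType) (iota : {rmorphism k -> K}) :
    Prop :=
  exists x, transcendental iota x /\ exists d, degree_over iota x d.

Definition prime_ideal (K : fieldType) (A p : set K) : Prop :=
  [/\ p `<=` A, p 0 /\ (forall x y, p x -> p y -> p (x + y)),
      forall a x, A a -> p x -> p (a * x), ~ p 1
    & forall x y, A x -> A y -> p (x * y) -> p x \/ p y].

Definition localization (K : fieldType) (A p : set K) : set K :=
  [set f | exists a b, [/\ A a, A b, ~ p b & f = a / b]].

Definition affine_points (K : fieldType) (A : set K) : set (set K) :=
  [set O | exists2 p, prime_ideal A p & O = localization A p].

Definition max_ideal (K : fieldType) (O : set K) : set K :=
  [set x | O x /\ ~ exists2 y, O y & x * y = 1].

(* For local rings; then max_ideal R meets O exactly in max_ideal O. *)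
Definition dominates (K : fieldType) (R O : set K) : Prop :=
  O `<=` R /\ max_ideal O `<=` max_ideal R.

(* K itself is allowed. *)
Definition valuation_ring (k K : fieldType) (iota : {rmorphism k -> K})
    (R : set K) : Prop :=
  subalgebra iota R /\ forall x, x != 0 -> R x \/ R x^-1.

(* Uniqueness in the last clause is separatedness, existence is completeness. *)
Definition complete_model (k K : fieldType) (iota : {rmorphism k -> K})
    (C : set (set K)) : Prop :=
  (exists m (s : 'I_m -> seq K),
     (forall i f, exists a b,
        [/\ generated_algebra iota (s i) a, generated_algebra iota (s i) b,
            b != 0 & f = a / b]) /\
     C = [set O | exists i, affine_points (generated_algebra iota (s i)) O]) /\
  forall R, valuation_ring iota R -> exists! O, C O /\ dominates R O.

Definition complete_curve (k K : fieldType) (iota : {rmorphism k -> K})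
    (C : set (set K)) : Prop :=
  function_field1 iota /\ complete_model iota C.

(* C also contains K, the local ring of the generic point. *)
Definition closed_points (K : fieldType) (C : set (set K)) : set (set K) :=
  [set P | C P /\ P <> setT].

(* The nonempty open subsets of a curve, given by their closed points. *)
Definition open_subset (K : fieldType) (C U : set (set K)) : Prop :=
  U `<=` closed_points C /\ finite_set (closed_points C `\` U).

(* The projective line with coordinate x, as a set of local rings of k(x). *)
Definition projective_line (k K : fieldType) (iota : {rmorphism k -> K})
    (x : K) : set (set K) :=
  affine_points (generated_algebra iota [:: x]) `|`
  affine_points (generated_algebra iota [:: x^-1]).

(* A nonconstant morphism from C to the projective line is given by its
   comorphism k(x) -> K such that each local ring of C dominates a local ring
   of the line; its degree is [K : k(x)]. *)
Definition hyperelliptic (k K : fieldType) (iota : {rmorphism k -> K})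
    (C : set (set K)) : Prop :=
  exists x, degree_over iota x 2 /\
    forall P, C P -> exists2 Q, projective_line iota x Q & dominates P Q.

(* A torsion-free coherent sheaf is a subsheaf of its generic stalk V, seen as
   a constant sheaf; it is given by its stalks F P at the closed points.  It is
   of finite type, and V is its generic stalk. *)
Definition coherent_sheaf (K : fieldType) (C : set (set K)) (V : vectType K)
    (F : set K -> set V) : Prop :=
  forall P, closed_points C P ->
    (exists U, [/\ open_subset C U, U P &
       exists s : seq V, forall Q, U Q -> F Q = Rspan Q [set` s]]) /\
    (forall v, exists a, [/\ P a, a != 0 & F P (a *: v)]).

Definition sections (K : fieldType) (W : lmodType K) (F : set K -> set W)
    (U : set (set K)) : set W :=
  [set v | forall P, U P -> F P v].

Definition global_sections (K : fieldType) (C : set (set K)) (W : lmodType K)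
    (F : set K -> set W) : set W :=
  sections F (closed_points C).

Definition regular_functions (K : fieldType) (U : set (set K)) : set K :=
  [set f | forall P, U P -> P f].

Definition adeles (K : fieldType) (C : set (set K)) (V : vectType K)
    (F : set K -> set V) : set (set K -> V) :=
  [set al | finite_set [set P | closed_points C P /\ ~ F P (al P)]].

(* The flasque resolution 0 -> F -> V -> V / F -> 0 gives
   H^1(C, F) = adeles / (V + prod_P F_P); H1_form lam says that lam restricts
   to a k-linear form on the adeles that factors through H^1(C, F). *)
Definition H1_form (k K : fieldType) (iota : {rmorphism k -> K})
    (C : set (set K)) (V : vectType K) (F : set K -> set V)
    (lam : (set K -> V) -> k) : Prop :=
  [/\ forall c al be, adeles C F al -> adeles C F be ->
        lam (iota c *: al + be) = c * lam al + lam be,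
      forall v : V, lam (fun=> v) = 0
    & forall al, (forall P, closed_points C P -> F P (al P)) -> lam al = 0].

(* There is a trace tr : H^1(C, omega) -> k such that, for every F, the map
   Hom(F, omega) -> H^1(C, F)^*, h |-> tr o H^1(h), is bijective.  As
   H^1(C, F) and Hom(F, omega) only depend on F modulo torsion, it is enough to
   consider torsion-free sheaves F. *)
Definition dualizing_sheaf (k K : fieldType) (iota : {rmorphism k -> K})
    (C : set (set K)) (V : vectType K) (omega : set K -> set V) : Prop :=
  coherent_sheaf C omega /\
  exists tr, H1_form iota C omega tr /\
    forall (W : vectType K) (F : set K -> set W), coherent_sheaf C F ->
      forall lam, H1_form iota C F lam ->
        exists! h : 'Hom(W, V),
          (forall P, closed_points C P -> forall w, F P w -> omega P (h w)) /\
          (forall al, adeles C F al -> lam al = tr (fun P => h (al P))).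

Definition gorenstein (K : fieldType) (C : set (set K)) (V : vectType K)
    (omega : set K -> set V) : Prop :=
  forall P, closed_points C P ->
    exists U (e : V), [/\ open_subset C U, U P, e != 0 &
      forall Q, U Q -> omega Q = [set a *: e | a in Q]].

(* omega_P is a free O_P-module. *)
Definition gorenstein_point (K : fieldType) (V : vectType K)
    (omega : set K -> set V) (P : set K) : Prop :=
  exists m (e : 'I_m -> V), (forall i, omega P (e i)) /\
    forall v, omega P v ->
      exists! a : {ffun 'I_m -> K},
        (forall i, P (a i)) /\ v = \sum_i a i *: e i.

(* The stalk at P of the direct image of the normalization. *)
Definition integral_closure (K : fieldType) (P : set K) : set K :=
  [set x | exists p : {poly K}, [/\ p \is monic, forall i, P p`_i & root p x]].

Definition conductor (K : fieldType) (P : set K) : set K :=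
  [set x | forall y, integral_closure P y -> P (x * y)].

(* Hom(m_P, O_P) and the image of Hom(O_P, O_P) in it.  Maps defined on m_P are
   represented by arbitrary extensions to K; the second set contains all the
   functions vanishing on m_P, so the quotient does not see the extension. *)
Definition hom_max_ideal (K : fieldType) (P : set K) : set (K -> K^o) :=
  [set f | [/\ forall x, max_ideal P x -> P (f x),
               forall x y, max_ideal P x -> max_ideal P y ->
                 f (x + y) = f x + f y
             & forall a x, P a -> max_ideal P x -> f (a * x) = a * f x]].

Definition hom_mult (K : fieldType) (P : set K) : set (K -> K^o) :=
  [set f | exists2 a, P a & forall x, max_ideal P x -> f x = a * x].

(* Ext^1(k, O_P) = coker (Hom(O_P, O_P) -> Hom(m_P, O_P)), from the sequence
   0 -> m_P -> O_P -> k -> 0. *)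
Definition almost_gorenstein (k K : fieldType) (iota : {rmorphism k -> K})
    (P : set K) : Prop :=
  exists d c r : nat,
    [/\ dim_quot iota (integral_closure P : set K^o) (P : set K^o) d,
        dim_quot iota (P : set K^o) (conductor P : set K^o) c,
        dim_quot iota (hom_max_ideal P) (hom_mult P) r
      & (d%:Z = c%:Z + r%:Z - 1)%R].

Definition nearly_gorenstein (k K : fieldType) (iota : {rmorphism k -> K})
    (C : set (set K)) (V : vectType K) (omega : set K -> set V) : Prop :=
  exists P, [/\ closed_points C P, ~ gorenstein_point omega P,
    forall Q, closed_points C Q -> ~ gorenstein_point omega Q -> Q = P
    & almost_gorenstein iota P].

(* For a subring R of K and an R-submodule M of W, Sym^n_R M is the quotient of
   the free R-module sym_free R M n on M^n by its submodule sym_rel R M n; both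
   are sets of functions from W^n to K. *)

Definition sym_gen (K : fieldType) (W : lmodType K) (n : nat)
    (t : {ffun 'I_n -> W}) : {ffun 'I_n -> W} -> K^o :=
  fun u => (u == t)%:R.

Definition upd (K : fieldType) (W : lmodType K) (n : nat)
    (t : {ffun 'I_n -> W}) (i : 'I_n) (w : W) : {ffun 'I_n -> W} :=
  [ffun j => if j == i then w else t j].

Definition sym_free (K : fieldType) (W : lmodType K) (R : set K) (M : set W)
    (n : nat) : set ({ffun 'I_n -> W} -> K^o) :=
  Rspan R [set g | exists2 t : {ffun 'I_n -> W}, forall i, M (t i) & g = sym_gen t].

Definition sym_rel (K : fieldType) (W : lmodType K) (R : set K) (M : set W)
    (n : nat) : set ({ffun 'I_n -> W} -> K^o) :=
  Rspan R
    ([set g | exists (t : {ffun 'I_n -> W}) i a u v,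
        [/\ forall j, M (t j), R a, M u, M v &
            g = sym_gen (upd t i (a *: u + v))
                - (a *: sym_gen (upd t i u) + sym_gen (upd t i v))]] `|`
     [set g | exists (t : {ffun 'I_n -> W}) (s : 'S_n),
        (forall j, M (t j)) /\
        g = sym_gen [ffun j => t (s j)] - sym_gen t]).

(* The preimage in sym_free R M n of the torsion of Sym^n_R M. *)
Definition sym_torsion (K : fieldType) (W : lmodType K) (R : set K)
    (M : set W) (n : nat) : set ({ffun 'I_n -> W} -> K^o) :=
  [set g | sym_free R M g /\ exists a, [/\ R a, a != 0 & sym_rel R M (a *: g)]].

(* g represents a global section of Sym^n F / Torsion(Sym^n F): a family of
   germs g P which locally comes from elements of Sym^n_{O(U)} F(U).  Two such
   families define the same section when their germs are congruent modulo
   sym_torsion P (F P) at each P. *)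
Definition sympow_section (K : fieldType) (C : set (set K)) (V : vectType K)
    (F : set K -> set V) (n : nat)
    (g : set K -> ({ffun 'I_n -> V} -> K^o)) : Prop :=
  forall P, closed_points C P ->
    sym_free P (F P) (g P) /\
    exists U s, [/\ open_subset C U, U P,
      sym_free (regular_functions U) (sections F U) s
      & forall Q, U Q -> sym_torsion Q (F Q) (g Q - s)].

(* Sym^n H^0(C, F) -> H^0(C, Sym^n F / Torsion(Sym^n F)) is onto: every section
   is the constant family of germs of some s in the symmetric power over k. *)
Definition sympow_map_surjective (k K : fieldType)
    (iota : {rmorphism k -> K}) (C : set (set K)) (V : vectType K)
    (F : set K -> set V) (n : nat) : Prop :=
  forall g : set K -> ({ffun 'I_n -> V} -> K^o), sympow_section C F g ->
    exists2 s, sym_free (range iota) (global_sections C F) s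
      & forall P, closed_points C P -> sym_torsion P (F P) (g P - s).

(* Main.v *)
(* Duality shows that the generic stalk of omega is a line K v0, so omega becomes a family w P of
   fractional ideals, S = H^0(omega) and Om n = H^0(omega^n) are k-subspaces of K, and the claim is
   that Om n is spanned by products of n elements of S.  A curve which is hyperelliptic with all the
   w P principal is excluded, and this makes S generate every w P.

   If S Om(n-1) <> Om n, duality gives an adele al, nonzero in H^1(Hom(omega^n, omega)), with
   s al = x_s modulo Hom(omega^(n-1), omega) for each s in S.  It suffices to find phi in K with
   x_s = phi s for all s, since then al = phi in H^1.  The commutator x_s u - x_u s is a section of
   Hom(omega^(n-2), omega), hence zero for n > 3 and constant for n = 3, where the Pluecker relation
   forces it to vanish if dim S > 2.  For n = 2, al defines an extension of omega by O to which all
   sections lift; a section (x, a) of it that vanishes at a point Q gives phi = x / a and subspaces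
   A of S and B of K with A B inside S and dim A + dim B = dim S + 1.  Either A = S, and the
   extension splits, or the equality case of Hopf's inequality, proved with a place of K in the
   style of Vosper's theorem, shows that S is spanned by a geometric progression s, sz, ..., sz^N.

   In this last case omega^n is generated by s^n, ..., s^n z^(nN), and comparing the growth of
   dim(Om n) with deg omega <= 2N gives K = k(z); then Om n is spanned by the s^n z^i, i <= nN. *)
Require Import Defs.
From HB Require Import structures.
From mathcomp Require Import all_boot all_order all_algebra.
From mathcomp Require Import fingroup perm.
From mathcomp Require Import boolp classical_sets functions cardinality.
From mathcomp Require Import ring zify.

Set Implicit Arguments.
Unset Strict Implicit.
Unset Printing Implicit Defensive.

Import GRing.Theory.
Local Open Scope classical_set_scope.
Local Open Scope ring_scope.

(** * Relative dimension *)

(** The points may be arbitrarily singular, so a stalk is only a fractional ideal, and neither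
    uniformizers nor degrees of divisors are at hand. They are replaced by lengths modulo a nonzero
    element, which are finite because K has transcendence degree one, and by the equality of
    length(M/aM) with length(O_P/aO_P) for every fractional ideal M. Riemann-Roch is replaced by the
    inequalities that the trace gives directly, such as deg omega <= 2g - 2 with g = dim S.
    Valuation rings of K serve twice: by completeness each of them dominates a point of C, so that a
    function regular everywhere, or preserving a sheaf of fractional ideals, is constant; and they
    order the elements of a finite-dimensional subspace of K in the study of products A B. S
    generates omega for the following reason: if S lay in a hyperplane of w_Q, duality would give a
    nonconstant phi with at most a simple pole at Q and no other pole, so C would be the projective
    line, which is one of the excluded curves. For n = 2 the extension has rank two and determinant
    omega, and the products u b with u in A and b in B are determinants of pairs of its sections. *)

Lemma row_kernel (F : fieldType) (m n : nat) (M : 'M[F]_(m, n)) :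
  (n < m)%N -> exists2 c : 'rV[F]_m, c != 0 & c *m M = 0.
Proof.
move=> nm; have : kermx M != 0.
  rewrite -mxrank_eq0 mxrank_ker subn_eq0 -ltnNge.
  exact: leq_ltn_trans (rank_leq_col M) nm.
move=> /rowV0Pn[c /sub_kermxP cM c0]; by exists c.
Qed.

Section RelativeDimension.
Variables (k : closedFieldType) (K : fieldType) (iota : {rmorphism k -> K}).

Definition lincomb (E : lmodType K) n (c : 'I_n -> k) (e : 'I_n -> E) : E :=
  \sum_i iota (c i) *: e i.

Definition subspace (E : lmodType K) (A : set E) : Prop :=
  A 0 /\ forall c x y, A x -> A y -> A (iota c *: x + y).

(** Bounds the dimension of A modulo B; B need not lie in A. As no basis is chosen, such bounds pass
    along linear maps ([dim_le_image]) and can be stated before A is known to be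
    finite-dimensional. *)
Definition dim_le (E : lmodType K) (A B : set E) n : Prop :=
  forall e : 'I_n.+1 -> E, (forall i, A (e i)) ->
    exists c : 'I_n.+1 -> k, (exists i, c i != 0) /\ B (lincomb c e).

Definition free_mod (E : lmodType K) (B : set E) n (e : 'I_n -> E) : Prop :=
  forall c : 'I_n -> k, B (lincomb c e) -> forall i, c i = 0.

Definition spans_mod (E : lmodType K) (A B : set E) n (e : 'I_n -> E) : Prop :=
  forall a, A a -> exists c : 'I_n -> k, B (a - lincomb c e).

Definition dim_eq (E : lmodType K) (A B : set E) n : Prop :=
  exists e : 'I_n -> E,
    [/\ forall i, A (e i), free_mod B e & spans_mod A B e].

Section Subspace.
Variable E : lmodType K.
Implicit Types A B D : set E.

Lemma subspaceD A x y : subspace A -> A x -> A y -> A (x + y).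
Proof. by move=> [_ h] hx hy; have := h 1 x y hx hy; rewrite rmorph1 scale1r. Qed.

Lemma subspaceZ A c x : subspace A -> A x -> A (iota c *: x).
Proof. by move=> [h0 h] hx; have := h c x 0 hx h0; rewrite addr0. Qed.

Lemma subspaceN A x : subspace A -> A x -> A (- x).
Proof. by move=> h /(subspaceZ (-1) h); rewrite rmorphN1 scaleN1r. Qed.

Lemma subspaceB A x y : subspace A -> A x -> A y -> A (x - y).
Proof. by move=> h hx hy; apply: subspaceD => //; apply: subspaceN. Qed.

Lemma subspace_sum A I (r : seq I) (P : pred I) (F : I -> E) :
  subspace A -> (forall i, P i -> A (F i)) -> A (\sum_(i <- r | P i) F i).
Proof.
move=> h hF; elim/big_rec: _ => [|i x Pi hx]; first by case: h.
by apply: subspaceD => //; apply: hF.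
Qed.

Lemma subspace_lincomb A n (c : 'I_n -> k) (e : 'I_n -> E) :
  subspace A -> (forall i, A (e i)) -> A (lincomb c e).
Proof. by move=> h hF; apply: subspace_sum => // i _; apply: subspaceZ. Qed.

Lemma subspace0 : subspace [set (0 : E)].
Proof. by split=> // c x y -> ->; rewrite scaler0 addr0. Qed.

Lemma subspaceI A B : subspace A -> subspace B -> subspace (A `&` B).
Proof. by move=> [a0 a] [b0 b]; split=> // c x y [ax bx] [ay by_]; split; [apply: a|apply: b]. Qed.

Lemma lincombD n (c d : 'I_n -> k) (e : 'I_n -> E) :
  lincomb (fun i => c i + d i) e = lincomb c e + lincomb d e.
Proof. by rewrite /lincomb -big_split; apply: eq_bigr => i _; rewrite rmorphD scalerDl. Qed.

Lemma lincombZ n a (c : 'I_n -> k) (e : 'I_n -> E) :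
  lincomb (fun i => a * c i) e = iota a *: lincomb c e.
Proof. by rewrite /lincomb scaler_sumr; apply: eq_bigr => i _; rewrite rmorphM scalerA. Qed.

Lemma lincomb_mul m n (c : 'I_m -> k) (M : 'I_m -> 'I_n -> k) (e : 'I_n -> E) :
  lincomb c (fun i => lincomb (M i) e) =
  lincomb (fun j => \sum_i c i * M i j) e.
Proof.
rewrite /lincomb; under eq_bigr do rewrite scaler_sumr.
rewrite exchange_big; apply: eq_bigr => j _; rewrite rmorph_sum scaler_suml.
by apply: eq_bigr => i _; rewrite rmorphM scalerA.
Qed.

Lemma lincombBr m (c : 'I_m -> k) (e f : 'I_m -> E) :
  lincomb c (fun i => e i - f i) = lincomb c e - lincomb c f.
Proof. by rewrite /lincomb -sumrB; apply: eq_bigr => i _; rewrite scalerBr. Qed.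

Lemma lincomb_delta n (e : 'I_n -> E) i : lincomb (fun j => (j == i)%:R) e = e i.
Proof.
rewrite /lincomb (bigD1 i)//= eqxx rmorph1 scale1r big1 ?addr0//.
by move=> j /negbTE ->; rewrite rmorph0 scale0r.
Qed.

Definition cat_fun (T : Type) m n (e : 'I_m -> T) (f : 'I_n -> T) (i : 'I_(m + n)) : T :=
  match fintype.split i with inl j => e j | inr j => f j end.

Lemma cat_funl (T : Type) m n (e : 'I_m -> T) (f : 'I_n -> T) i :
  cat_fun e f (lshift n i) = e i.
Proof. by rewrite /cat_fun; case: split_ordP => j /eqP; rewrite ?eq_shift// => /eqP ->. Qed.

Lemma cat_funr (T : Type) m n (e : 'I_m -> T) (f : 'I_n -> T) i :
  cat_fun e f (rshift m i) = f i.
Proof. by rewrite /cat_fun; case: split_ordP => j /eqP; rewrite ?eq_shift// => /eqP ->. Qed.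

Lemma cat_fun_prop (T : Type) (P : T -> Prop) m n (e : 'I_m -> T) (f : 'I_n -> T) :
  (forall i, P (e i)) -> (forall i, P (f i)) -> forall i, P (cat_fun e f i).
Proof. by move=> he hf i; rewrite /cat_fun; case: fintype.split. Qed.

Lemma lincomb_cat m n (c : 'I_(m + n) -> k) (e : 'I_m -> E) (f : 'I_n -> E) :
  lincomb c (cat_fun e f) =
  lincomb (fun i => c (lshift n i)) e + lincomb (fun i => c (rshift m i)) f.
Proof.
by rewrite /lincomb big_split_ord; congr (_ + _); apply: eq_bigr => i _;
  rewrite ?cat_funl ?cat_funr.
Qed.

Lemma lincomb_cat2 m n (c : 'I_m -> k) (d : 'I_n -> k) (e : 'I_m -> E) (f : 'I_n -> E) :
  lincomb (cat_fun c d) (cat_fun e f) = lincomb c e + lincomb d f.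
Proof.
rewrite lincomb_cat; congr (_ + _); apply: eq_bigr => i _.
  by rewrite cat_funl.
by rewrite cat_funr.
Qed.

(** Modulo B, n+1 vectors have n+1 coefficient rows of length n, and a relation between the rows is
    a relation between the vectors. *)
Lemma dim_le_spans A B n (e : 'I_n -> E) : subspace B ->
  spans_mod A B e -> dim_le A B n.
Proof.
move=> sB he f /(fun H i => he _ (H i))/choice[M hM].
have [c c0 cM] := @row_kernel k n.+1 n (\matrix_(i, j) M i j) (ltnSn n).
exists (fun i => c 0 i); split.
  by have /rV0Pn[i ci] := c0; exists i.
suff -> : lincomb (fun i => c 0 i) f =
    lincomb (fun i => c 0 i) (fun i => f i - lincomb (M i) e).
  exact: subspace_lincomb.
rewrite lincombBr lincomb_mul [X in _ = _ - X]/lincomb big1 ?subr0// => j _.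
have /(congr1 (fun M : 'rV_n => M 0 j)) := cM; rewrite !mxE => cMj.
rewrite (_ : \sum_i _ = 0) ?rmorph0 ?scale0r// -[RHS]cMj.
by apply: eq_bigr => i _; rewrite mxE.
Qed.

Lemma dim_le_mono A A' B B' n : A' `<=` A -> B `<=` B' ->
  dim_le A B n -> dim_le A' B' n.
Proof.
move=> AA BB h e he; have [i|c [c0 hc]] := h e; first by apply/AA.
by exists c; split=> //; apply: BB.
Qed.

Lemma dim_le_image (E' : lmodType K) (L : E -> E') A B (A' B' : set E') n :
  (forall m (c : 'I_m -> k) e, (forall i, A (e i)) ->
     L (lincomb c e) = lincomb c (L \o e)) ->
  (forall x, A x -> A' (L x)) ->
  (forall m (c : 'I_m -> k) e, (forall i, A (e i)) ->
     B' (L (lincomb c e)) -> B (lincomb c e)) ->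
  dim_le A' B' n -> dim_le A B n.
Proof.
move=> hL hA hB h e he; have [i|c [c0 hc]] := h (L \o e); first exact: hA.
by exists c; split=> //; apply: hB => //; rewrite hL.
Qed.

Lemma free_le A B n (e : 'I_n -> E) m : (forall i, A (e i)) -> free_mod B e ->
  subspace B -> dim_le A B m -> (n <= m)%N.
Proof.
move=> Ae fe sB h; rewrite leqNgt; apply/negP => mn.
have [i|c [[i ci] hc]] := h (fun i : 'I_m.+1 => e (widen_ord mn i)); first exact: Ae.
pose d (j : 'I_n) := if insub (val j) is Some i then c i else 0.
have dE j : d (widen_ord mn j) = c j.
  rewrite /d; case: insubP => [l _ /= lj|]; last by rewrite /= ltn_ord.
  by congr c; apply: val_inj.
have : B (lincomb d e).
  suff -> : lincomb d e = lincomb c (fun i => e (widen_ord mn i)) by [].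
  rewrite /lincomb (bigID (fun j : 'I_n => (j < m.+1)%N))/= [X in _ + X]big1 ?addr0.
    rewrite big_ord_narrow; apply: eq_bigr => j _; by rewrite dE.
  move=> j jm; rewrite /d; case: insubP => [l lm|]; first by rewrite lm in jm.
  by rewrite rmorph0 scale0r.
by move=> /fe/(_ (widen_ord mn i)); rewrite dE => cz; rewrite cz eqxx in ci.
Qed.

(** A family free modulo B of maximal length spans, since a vector outside its span could be added
    to it. *)
Lemma dim_le_dim_eq A B n : subspace A -> subspace B -> dim_le A B n ->
  exists2 m, (m <= n)%N & dim_eq A B m.
Proof.
move=> sA sB h.
pose Q m := `[< exists e : 'I_m -> E, (forall i, A (e i)) /\ free_mod B e >].
have Q0 : exists m, Q m.
  by exists 0%N; apply/asboolP; exists (fun=> 0); split=> [[]|c _ []].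
have Qn m : Q m -> (m <= n)%N by move=> /asboolP[e [Ae fe]]; exact: free_le h.
case: (ex_maxnP Q0 Qn) => m Qm mx; exists m; first exact: Qn.
move: Qm => /asboolP[e [Ae fe]]; exists e; split=> // a Aa.
apply: contrapT => na.
suff : Q (m + 1)%N by move=> /mx; rewrite addn1 ltnn.
apply/asboolP; exists (cat_fun e (fun=> a)); split.
  exact: cat_fun_prop.
move=> c; rewrite lincomb_cat [X in _ + X]/lincomb big_ord1 => hc.
set c1 := c (rshift m ord0) in hc.
have c10 : c1 = 0.
  apply: contrapT => /eqP c1N; apply: na; exists (fun i => - c1^-1 * c (lshift 1 i)).
  rewrite lincombZ rmorphN scaleNr opprK.
  have := subspaceZ c1^-1 sB hc.
  by rewrite scalerDr scalerA -rmorphM mulVf// rmorph1 scale1r addrC.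
move=> i; case: (split_ordP i) => j ->; last by rewrite (ord1 j).
by move: hc; rewrite c10 rmorph0 scale0r addr0 => /fe.
Qed.

Lemma dim_eq_le A B n : subspace B -> dim_eq A B n -> dim_le A B n.
Proof. by move=> sB [e [_ _ he]]; exact: dim_le_spans he. Qed.

Lemma dim_eq_leq A B m n : subspace B -> dim_eq A B m -> dim_le A B n -> (m <= n)%N.
Proof. by move=> sB [e [Ae fe _]] h; exact: (free_le Ae fe sB h). Qed.

Lemma dim_eq_uniq A B m n : subspace B -> dim_eq A B m -> dim_eq A B n -> m = n.
Proof.
move=> sB h1 h2; apply/eqP; rewrite eqn_leq.
by rewrite (dim_eq_leq sB h1 (dim_eq_le sB h2)) (dim_eq_leq sB h2 (dim_eq_le sB h1)).
Qed.

Lemma dim_le_leq A B m n : (m <= n)%N -> dim_le A B m -> dim_le A B n.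
Proof.
move=> mn h e he.
have [i|c [[i ci] hc]] := h (fun i => e (widen_ord (mn : (m.+1 <= n.+1)%N) i)); first exact: he.
pose mn' : (m.+1 <= n.+1)%N := mn.
pose d (j : 'I_n.+1) := if insub (val j) is Some i then c i else 0.
have dE j : d (widen_ord mn' j) = c j.
  rewrite /d; case: insubP => [l _ /= lj|]; last by rewrite /= ltn_ord.
  by congr c; apply: val_inj.
exists d; split; first by exists (widen_ord mn' i); rewrite dE.
suff -> : lincomb d e = lincomb c (fun i => e (widen_ord mn' i)) by [].
rewrite /lincomb (bigID (fun j : 'I_n.+1 => (j < m.+1)%N))/= [X in _ + X]big1 ?addr0.
  rewrite big_ord_narrow; apply: eq_bigr => j _; by rewrite dE.
move=> j jm; rewrite /d; case: insubP => [l lm|]; first by rewrite lm in jm.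
by rewrite rmorph0 scale0r.
Qed.

Lemma dim_eq_add A B D m n : subspace B -> subspace D -> B `<=` A -> D `<=` B ->
  dim_eq A B m -> dim_eq B D n -> dim_eq A D (m + n).
Proof.
move=> sB sD BA DB [e [Ae fe se]] [f [Bf ff sf]].
exists (cat_fun e f); split.
- by apply: cat_fun_prop => // i; apply: BA.
- move=> c; rewrite lincomb_cat => hc.
  have c0 : forall i, c (lshift n i) = 0.
    apply: fe; rewrite -[X in B X](addrK (lincomb (fun i => c (rshift m i)) f)).
    by apply: subspaceB (DB _ hc) _ => //; apply: subspace_lincomb.
  move: hc; rewrite [X in X + _]/lincomb big1 => [|i _]; last first.
    by rewrite c0 rmorph0 scale0r.
  by rewrite add0r => /ff c1 i; case: (split_ordP i) => j ->.
- move=> a /se[c hc]; have [d hd] := sf _ hc.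
  by exists (cat_fun c d); rewrite lincomb_cat2 opprD addrA.
Qed.

Lemma dim_le_trans A B D m n : subspace A -> subspace B -> subspace D ->
  dim_le A B m -> dim_le B D n -> dim_le A D (m + n).
Proof.
move=> sA sB sD /(dim_le_dim_eq sA sB)[m' mm [e [Ae fe se]]].
move=> /(dim_le_dim_eq sB sD)[n' nn [f [Bf ff sf]]].
apply: (dim_le_leq (leq_add mm nn)).
apply: (@dim_le_spans _ _ _ (cat_fun e f)) => //.
move=> a /se[c hc]; have [d hd] := sf _ hc.
by exists (cat_fun c d); rewrite lincomb_cat2 opprD addrA.
Qed.

(* The Hamel-basis step: N is enlarged to a hyperplane avoiding a. *)
Lemma separating_form (N : set E) (a : E) : subspace N -> ~ N a ->
  exists lam : E -> k,
    [/\ forall c x y, lam (iota c *: x + y) = c * lam x + lam y,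
        forall x, N x -> lam x = 0 & lam a = 1].
Proof.
move=> sN Na.
(* Taking the union with N makes the empty chain harmless: its union is empty and N itself
   qualifies. *)
pose P (M : set E) := subspace (N `|` M) /\ ~ (N `|` M) a.
have [F FP Ftot|M [[sM aM] mx]] := @Zorn_bigcup E P.
  have FF X : F X -> N `|` X `<=` N `|` \bigcup_(X in F) X.
    by move=> FX x [Nx|Xx]; [left|right; exists X].
  split; last first.
    by move=> [//|[X FX Xa]]; have [_] := FP _ FX; apply; right.
  split; first by left; case: sN.
  have key X c x y : F X -> (N `|` X) x -> (N `|` X) y ->
      (N `|` \bigcup_(X in F) X) (iota c *: x + y).
    by move=> FX hx hy; apply: (FF _ FX); have [[_ h] _] := FP _ FX; apply: h.
  move=> c x y [Nx|[X FX Xx]] [Ny|[Y FY Yy]].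
  - by left; case: sN => _; apply.
  - by apply: (key Y) => //; [left|right].
  - by apply: (key X) => //; [right|left].
  - by case: (Ftot _ _ FX FY) => XY; [apply: (key Y)|apply: (key X)] => //; right=> //; apply: XY.
pose H := N `|` M.
have Hmx x : exists c, H (x - iota c *: a).
  have [Hx|Hx] := pselect (H x); first by exists 0; rewrite rmorph0 scale0r subr0.
  pose M' := [set y | exists c h, H h /\ y = h + iota c *: x].
  have HM' : H `<=` M' by move=> h Hh; exists 0, h; rewrite rmorph0 scale0r addr0.
  have M'x : M' x by exists 1, 0; rewrite rmorph1 scale1r add0r; split=> //; case: sM.
  have sM' : subspace M'.
    split; first by apply: HM'; case: sM.
    move=> c _ _ [c1 [h1 [H1 ->]]] [c2 [h2 [H2 ->]]].
    exists (c * c1 + c2), (iota c *: h1 + h2); split; first by case: sM => _; apply.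
    by rewrite rmorphD rmorphM scalerDr scalerDl scalerA addrACA.
  have NM' : N `|` M' = M' by apply/setUidPr => y Ny; apply: HM'; left.
  have : ~ P M'.
    apply: mx; split; first by move=> y My; apply: HM'; right.
    by move=> /(_ _ M'x) Mx; apply: Hx; right.
  rewrite /P NM' => nP.
  have [c [h [Hh ah]]] : M' a by apply: contrapT => h; apply: nP.
  have c0 : c != 0.
    apply/eqP => c0; apply: aM; move: ah.
    by rewrite c0 rmorph0 scale0r addr0 => ->.
  exists c^-1; rewrite ah scalerDr scalerA -rmorphM mulVf// rmorph1 scale1r.
  rewrite opprD addrCA subrr addr0; apply: subspaceN => //; exact: subspaceZ.
have [lam hlam] := choice Hmx.
have uniq x c d : H (x - iota c *: a) -> H (x - iota d *: a) -> c = d.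
  move=> hc hd; apply/eqP; rewrite -subr_eq0; apply/eqP; apply: contrapT => /eqP cd.
  apply: aM; have := subspaceZ (c - d)^-1 sM (subspaceB sM hd hc).
  have -> : x - iota d *: a - (x - iota c *: a) = iota (c - d) *: a.
    by rewrite opprB [LHS]addrC addrA subrK rmorphB scalerBl.
  by rewrite scalerA -rmorphM mulVf// rmorph1 scale1r.
exists lam; split.
- move=> c x y; apply: uniq (hlam _) _.
  rewrite rmorphD rmorphM scalerDl -scalerA opprD addrACA -scalerBr.
  by have [_ h] := sM; apply: h; exact: hlam.
- by move=> x Nx; apply: uniq (hlam _) _; rewrite rmorph0 scale0r subr0; left.
- by apply: uniq (hlam _) _; rewrite rmorph1 scale1r subrr; case: sM.
Qed.

End Subspace.
End RelativeDimension.

(** * Polynomials over k evaluated at elements of K *)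

Section Constants.
Variables (k : closedFieldType) (K : fieldType) (iota : {rmorphism k -> K}).

Definition peval (p : {poly k}) (x : K) : K := (map_poly iota p).[x].

Lemma pevalD p q x : peval (p + q) x = peval p x + peval q x.
Proof. by rewrite /peval rmorphD hornerD. Qed.

Lemma pevalB p q x : peval (p - q) x = peval p x - peval q x.
Proof. by rewrite /peval rmorphB hornerD hornerN. Qed.

Lemma pevalM p q x : peval (p * q) x = peval p x * peval q x.
Proof. by rewrite /peval rmorphM hornerM. Qed.

Lemma pevalC c x : peval c%:P x = iota c.
Proof. by rewrite /peval map_polyC hornerC. Qed.

Lemma pevalX x : peval 'X x = x.
Proof. by rewrite /peval map_polyX hornerX. Qed.

Lemma peval0 x : peval 0 x = 0.
Proof. by rewrite /peval rmorph0 horner0. Qed.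

Lemma peval1 x : peval 1 x = 1.
Proof. by rewrite /peval rmorph1 hornerC. Qed.

Lemma pevalXn n x : peval 'X^n x = x ^+ n.
Proof. by rewrite /peval map_polyXn hornerXn. Qed.

Lemma pevalE n (p : {poly k}) x : (size p <= n)%N -> peval p x = \sum_(i < n) iota p`_i * x ^+ i.
Proof.
move=> pn; rewrite /peval (@horner_coef_wide _ n).
  by apply: eq_bigr => i _; rewrite coef_map.
by rewrite size_map_poly.
Qed.

Lemma peval_root_prod (p : {poly k}) :
  exists rs, forall x, peval p x = iota (lead_coef p) * \prod_(c <- rs) (x - iota c).
Proof.
have [rs Ep] := closed_field_poly_normal p; exists rs => x.
rewrite {1}Ep -mul_polyC pevalM pevalC; congr (_ * _).
elim: rs {Ep} => [|c rs IH]; first by rewrite !big_nil peval1.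
by rewrite !big_cons pevalM IH pevalB pevalX pevalC.
Qed.

(** Over k the polynomial splits, and a prime J containing p(x) contains one of the factors x - c.
    The list of candidates c depends on p alone, which later gives finitely many residues for
    infinitely many points at once. *)
Lemma peval_prime (p : {poly k}) : p != 0 -> exists rs : seq k,
  forall (J A : set K) x, subalgebra iota A -> A x ->
    (forall c, J (iota c) -> c = 0) ->
    (forall a b, A a -> A b -> J (a * b) -> J a \/ J b) ->
    J (peval p x) -> exists2 c, c \in rs & J (x - iota c).
Proof.
move=> p0; have [rs hrs] := peval_root_prod p; exists rs => J A x.
rewrite hrs => -[[A1 AB AM] Ak] Ax Jk Jp.
have Axc c : A (x - iota c) by apply: AB.
have Apr r : A (\prod_(c <- r) (x - iota c)).
  by elim: r => [|c r IH]; rewrite ?big_nil// big_cons; apply: AM.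
move=> /Jp[||/Jk/eqP|]//; first by rewrite lead_coef_eq0 (negbTE p0).
elim: rs {hrs} => [|c rs IH].
  rewrite big_nil -[X in J X](rmorph1 iota) => /Jk/eqP; by rewrite oner_eq0.
rewrite big_cons => /Jp[||Jc|/IH[d dr Jd]]//; first by exists c; rewrite ?inE ?eqxx.
by exists d => //; rewrite inE dr orbT.
Qed.

Lemma algebraic_const p x : p != 0 -> peval p x = 0 -> range iota x.
Proof.
move=> /peval_prime[rs h] px; have [//|//|||//|c _] := h [set 0] setT x.
- by move=> c /= /eqP; rewrite fmorph_eq0 => /eqP.
- by move=> a b _ _ /= /eqP; rewrite mulf_eq0 => /orP[]/eqP ->; [left|right].
- by move=> /= /eqP; rewrite subr_eq0 => /eqP ->; exists c.
Qed.

Lemma nonconst_transcendental x : ~ range iota x -> transcendental iota x.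
Proof.
move=> hx p px; apply: contrapT => /eqP p0; apply: hx; exact: algebraic_const px.
Qed.

Lemma subalgebra_peval A p x : subalgebra iota A -> A x -> A (peval p x).
Proof.
move=> [[A1 AB AM] Ak] Ax; elim/poly_ind: p => [|p c IH].
  by rewrite peval0 -(rmorph0 iota).
rewrite pevalD pevalM pevalX pevalC -[iota c]opprK; apply: AB; first exact: AM.
by rewrite -rmorphN.
Qed.

End Constants.

Section Subalgebra.
Variables (k : closedFieldType) (K : fieldType) (iota : {rmorphism k -> K}).
Variables (A : set K) (hA : subalgebra iota A).

Lemma subalg_const c : A (iota c).
Proof. by case: hA. Qed.
Lemma subalg1 : A 1. Proof. by case: hA => -[]. Qed.
Lemma subalg0 : A 0. Proof. by rewrite -(rmorph0 iota); apply: subalg_const. Qed.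
Lemma subalgB x y : A x -> A y -> A (x - y).
Proof. by case: hA => -[_ h _] _; apply: h. Qed.
Lemma subalgM x y : A x -> A y -> A (x * y).
Proof. by case: hA => -[_ _ h] _; apply: h. Qed.
Lemma subalgN x : A x -> A (- x).
Proof. by rewrite -sub0r; apply: subalgB; apply: subalg0. Qed.
Lemma subalgD x y : A x -> A y -> A (x + y).
Proof. by move=> hx hy; rewrite -[y]opprK; apply: subalgB => //; apply: subalgN. Qed.
Lemma subalgX x n : A x -> A (x ^+ n).
Proof. by move=> hx; elim: n => [|n IH]; rewrite ?exprS; [apply: subalg1|apply: subalgM]. Qed.
Lemma subalg_sum I (r : seq I) (P : pred I) (F : I -> K) :
  (forall i, P i -> A (F i)) -> A (\sum_(i <- r | P i) F i).
Proof. by move=> h; elim/big_rec: _ => [|i x Pi]; [apply: subalg0|apply: subalgD; apply: h]. Qed.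

Lemma subalg_subspace : @subspace k K iota K^o A.
Proof. by split; [apply: subalg0|move=> c x y hx hy; apply: subalgD => //; apply: subalgM => //; apply: subalg_const]. Qed.

Lemma ideal_subspace a : @subspace k K iota K^o [set a * y | y in A].
Proof.
split; first by exists 0; [apply: subalg0|rewrite mulr0].
move=> c _ _ [x hx <-] [y hy <-]; exists (iota c * x + y).
  by apply: subalgD => //; apply: subalgM => //; apply: subalg_const.
by rewrite /GRing.scale/=; ring.
Qed.

End Subalgebra.

Lemma generated_subalgebra (k : closedFieldType) (K : fieldType)
  (iota : {rmorphism k -> K}) (s : seq K) : subalgebra iota (generated_algebra iota s).
Proof.
split; last by move=> c B [_ Bk].
split; first by move=> B [[B1 _ _]].
- by move=> x y hx hy B hB hs; have [[_ h _] _] := hB; apply: h; [apply: hx|apply: hy].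
- by move=> x y hx hy B hB hs; have [[_ _ h] _] := hB; apply: h; [apply: hx|apply: hy].
Qed.

Lemma mem_generated (k : closedFieldType) (K : fieldType)
  (iota : {rmorphism k -> K}) (s : seq K) x : x \in s -> generated_algebra iota s x.
Proof. by move=> xs B _; apply. Qed.

(** * Linear growth in transcendence degree one *)

Section Growth.
Variables (k : closedFieldType) (K : fieldType) (iota : {rmorphism k -> K}).
Hypothesis hK : function_field1 iota.

(** K has a finite basis e over k(x0). [B N] consists of the sums of p_i(x0) e_i with deg p_i < D
    (N+1), divided by q(x0)^(N+1), where q is a common denominator of 1 and of all x e_j with x in
    s. A factor x then costs one more power of q and D more coefficients, and the dimension is at
    most d D (N+1). *)
Lemma growth (s : seq K) : exists (B : nat -> set K^o) (c : nat),
  [/\ forall N, subspace iota (B N),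
      forall N f, B N f -> B N.+1 f,
      B 0%N 1,
      forall x N f, x \in s -> B N f -> B N.+1 (x * f)
    & forall N, dim_le iota (B N) [set 0] (c * N.+1)].
Proof.
have [x0 [tr [d [e he]]]] := hK.
pose Lat D := [set f : K^o | exists p : 'I_d -> {poly k},
  (forall i, (size (p i) <= D)%N) /\ f = \sum_i peval iota (p i) x0 * e i].
have LatS D : subspace iota (Lat D).
  split; first by exists (fun=> 0); split=> [i|]; rewrite ?size_poly0// big1// => i _; rewrite peval0 mul0r.
  move=> c _ _ [p [sp ->]] [q [sq ->]]; exists (fun i => c%:P * p i + q i); split.
    move=> i; rewrite (leq_trans (size_polyD _ _))// geq_max sq andbT.
    by rewrite mul_polyC (leq_trans (size_scale_leq _ _)).
  rewrite /GRing.scale/= mulr_sumr -big_split; apply: eq_bigr => i _.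
  by rewrite pevalD pevalM pevalC mulrDl mulrA.
have Latle D D' f : (D <= D')%N -> Lat D f -> Lat D' f.
  by move=> DD [p [sp ->]]; exists p; split=> // i; apply: leq_trans DD.
have LatM D (r : {poly k}) f : Lat D f -> Lat (D + size r)%N (peval iota r x0 * f).
  move=> [p [sp ->]]; exists (fun i => r * p i); split.
    move=> i; apply: leq_trans (size_polyMleq _ _) _.
    by rewrite addnC (leq_trans (leq_pred _))// leq_add2r.
  by rewrite mulr_sumr; apply: eq_bigr => i _; rewrite pevalM mulrA.
have den f : exists (q : {poly k}) D, q != 0 /\ Lat D (peval iota q x0 * f).
  have [c [[rc ->] _]] := he f.
  have /choice[pq hpq] : forall i, exists pq : {poly k} * {poly k},
      peval iota pq.2 x0 != 0 /\ c i = peval iota pq.1 x0 / peval iota pq.2 x0.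
    by move=> i; have [p [q [q0 ->]]] := rc i; exists (p, q).
  pose P i := (\prod_(j < d | j != i) (pq j).2) * (pq i).1.
  exists (\prod_j (pq j).2), (\max_i size (P i))%N; split.
    apply/prodf_neq0 => j _; have [q0 _] := hpq j.
    by apply: contraNneq q0 => ->; rewrite peval0.
  exists P; split; first by move=> i; apply: leq_bigmax.
  rewrite mulr_sumr; apply: eq_bigr => i _; rewrite mulrA; congr (_ * _).
  have [q0 ->] := hpq i; rewrite (bigD1 i)//= /P !pevalM; by field.
have dens (t : seq K) : exists (q : {poly k}) D, [/\ q != 0, (size q <= D)%N &
    forall f, f \in t -> Lat D (peval iota q x0 * f)].
  elim: t => [|f t [q [D [q0 sq hq]]]].
    by exists 1, 1%N; rewrite oner_neq0 size_poly1; split.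
  have [r [D' [r0 hr]]] := den f.
  exists (q * r), (D + D' + size q + size r)%N; split; first by rewrite mulf_neq0.
    by apply: leq_trans (size_polyMleq _ _) _; lia.
  move=> g; rewrite inE pevalM => /orP[/eqP -> |gt].
    rewrite -mulrA; apply: Latle (LatM _ q _ hr); lia.
  rewrite [_ * peval _ r _]mulrC -mulrA; apply: Latle (LatM _ r _ (hq _ gt)); lia.
pose t : seq K := 1 :: [seq x * e j | x <- s, j <- enum 'I_d].
have [q [D [q0 sq hq]]] := dens t.
have q0' : peval iota q x0 != 0 by apply: contraNneq q0 => /tr ->.
exists (fun N => [set f : K^o | Lat (D * N.+1)%N (peval iota q x0 ^+ N.+1 * f)]), (d * D)%N.
split.
- move=> N; split; rewrite /= ?mulr0; first by case: (LatS (D * N.+1)%N).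
  move=> c f g /= hf hg; have [_ h] := LatS (D * N.+1)%N.
  by have := h c _ _ hf hg; rewrite /GRing.scale/=; congr (Lat _ _); ring.
- move=> N f /= /(LatM _ q) h; rewrite exprS -mulrA; apply: Latle h.
  by rewrite [in leqRHS]mulnS addnC leq_add2r.
- by rewrite /= muln1 expr1; apply: hq; rewrite inE eqxx.
- move=> x N f xs /= [p [sp hf]].
  have -> : peval iota q x0 ^+ N.+2 * (x * f) =
      \sum_i peval iota (p i) x0 * (peval iota q x0 * (x * e i)).
    rewrite exprS -mulrA [X in _ * X]mulrCA hf !mulr_sumr.
    by apply: eq_bigr => i _; ring.
  apply: (@subspace_sum _ _ _ K^o _ _ _ _ _ (LatS _)) => i _.
  have /hq/(LatM _ (p i)) : x * e i \in t.
    by rewrite inE; apply/orP; right; apply/allpairsP; exists (x, i); rewrite mem_enum.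
  by apply: Latle; rewrite [in leqRHS]mulnS leq_add2l.
- move=> N; apply: (@dim_le_image _ _ _ K^o K^o (fun f => peval iota q x0 ^+ N.+1 * f)
    _ _ (Lat (D * N.+1)%N) [set 0]) => //.
  + move=> m c f _; rewrite /lincomb mulr_sumr; apply: eq_bigr => i _.
    by rewrite /GRing.scale/=; ring.
  + move=> m c f _ /= /eqP; rewrite mulf_eq0 expf_eq0/= (negbTE q0')/=; by move/eqP.
  + rewrite -mulnA; set D' := (D * N.+1)%N => f /choice[p hp].
    have [c c0 cM] := @row_kernel k _ (d * D')%N
      (\matrix_(l < (d * D').+1) mxvec (\matrix_(i < d, j < D') (p l i)`_j)) (ltnSn _).
    exists (fun i => c 0 i); split; first by have /rV0Pn[i ci] := c0; exists i.
    have cp i : \sum_l c 0 l *: p l i = 0.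
      apply/polyP => j; rewrite coef0 coef_sum.
      have [jD|jD] := ltnP j D'; last first.
        rewrite big1// => l _; rewrite coefZ nth_default ?mulr0//.
        by apply: leq_trans jD; have [h _] := hp l.
      have := congr1 (fun M : 'rV_(d * D') => M 0 (mxvec_index i (Ordinal jD))) cM.
      rewrite !mxE => h; rewrite -[RHS]h; apply: eq_bigr => l _.
      by rewrite coefZ !mxE mxvecE mxE.
    rewrite /= /lincomb.
    under eq_bigr => l _ do (have [_ ->] := hp l; rewrite /GRing.scale/= mulr_sumr).
    rewrite exchange_big big1// => i _.
    have := congr1 (fun q => peval iota q x0 * e i) (cp i).
    rewrite peval0 mul0r => h; rewrite -[RHS]h.
    have -> : forall (I : Type) (r : seq I) (F : I -> {poly k}),
        peval iota (\sum_(l <- r) F l) x0 = \sum_(l <- r) peval iota (F l) x0.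
      by move=> I r F; apply: (big_morph (fun p => peval iota p x0)); [move=> ? ?; rewrite pevalD|rewrite peval0].
    rewrite mulr_suml; apply: eq_bigr => l _.
    by rewrite -mul_polyC pevalM pevalC mulrA.
Qed.

(* If e_0, ..., e_M were independent modulo aA, so would be the elements a^j e_i over k, contradicting linear growth. *)
Lemma algebra_quot_dim (s : seq K) a : generated_algebra iota s a -> a != 0 ->
  exists M, dim_le iota (generated_algebra iota s : set K^o)
    [set a * y | y in generated_algebra iota s] M.
Proof.
set A := generated_algebra iota s => Aa a0.
have sA : subalgebra iota A := generated_subalgebra iota s.
have [B [c [sB mB B1 BM dB]]] := growth s.
have Ble N N' f : (N <= N')%N -> B N f -> B N' f.
  move=> /subnK <-; elim: (N' - N)%N => // n IH /IH; rewrite addSn; exact: mB.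
have ordA f : A f -> exists l, forall N g, B N g -> B (N + l)%N (f * g).
  move=> /(_ [set f | exists l, forall N g, B N g -> B (N + l)%N (f * g)]).
  apply; last by move=> x xs; exists 1%N => N g Bg; rewrite addn1; apply: BM.
  split; last first.
    move=> z; exists 0%N => N g Bg; rewrite addn0.
    by have := subspaceZ z (sB N) Bg.
  split.
  - by exists 0%N => N g; rewrite mul1r addn0.
  - move=> x y [l hl] [l' hl']; exists (l + l')%N => N g Bg; rewrite mulrBl.
    apply: (@subspaceB _ _ _ K^o _ _ _ (sB _)).
      by apply: Ble (hl _ _ Bg); lia.
    by apply: Ble (hl' _ _ Bg); lia.
  - move=> x y [l hl] [l' hl']; exists (l' + l)%N => N g Bg; rewrite -mulrA addnA.
    by apply: hl; apply: hl'.
have [l hl] := ordA _ Aa; exists (c * l)%N => e Ae; apply: contrapT => ne.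
have fe : @free_mod _ _ iota K^o [set a * y | y in A] _ e.
  move=> z hz i; apply: contrapT => /eqP zi; apply: ne; exists z; split=> //.
  by exists i.
have [N0 hN0] : exists N0, forall i, B N0 (e i).
  have /choice[m hm] : forall i, exists m, B m (e i).
    by move=> i; have [m hm] := ordA _ (Ae i); exists m; rewrite -[e i]mulr1; apply: (hm 0%N).
  exists (\max_i m i)%N => i; apply: Ble (hm i); exact: leq_bigmax.
have fam J : exists E : 'I_(J * (c * l).+1) -> K^o,
    [/\ forall i, A (E i), forall i, B (N0 + J * l)%N (E i) & free_mod iota [set 0] E].
  elim: J => [|J [E [AE BE fE]]].
    by exists (fun=> 0); split=> [[]|[]|z _ []].
  rewrite [(J.+1 * (c * l).+1)%N]mulSn.
  exists (cat_fun e (fun i => a * E i)); split.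
  - by apply: (cat_fun_prop (P := A)) => // i; apply: (subalgM sA).
  - apply: (cat_fun_prop (P := B (N0 + J.+1 * l)%N)) => i; first by apply: Ble (hN0 i); lia.
    by rewrite mulSn addnCA addnC; exact: hl.
  - move=> z; rewrite lincomb_cat => hz.
    have aE : lincomb iota (fun i => z (rshift _ i)) (fun i => a * E i : K^o) =
        a * lincomb iota (fun i => z (rshift _ i)) E.
      by rewrite /lincomb mulr_sumr; apply: eq_bigr => i _; rewrite /GRing.scale/=; ring.
    have z1 i : z (lshift _ i) = 0.
      move: i; apply: fe; rewrite /= in hz.
      rewrite -[X in [set _ | _ in _] X](addrK (a * lincomb iota (fun i => z (rshift _ i)) E)) -aE hz sub0r aE.
      exists (- lincomb iota (fun i => z (rshift _ i)) E); last by rewrite mulrN.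
      apply: (subalgN sA); apply: (@subspace_lincomb _ _ _ K^o) => //.
      exact: subalg_subspace.
    move: hz; rewrite [X in X + _]/lincomb big1 ?add0r => [|i _]; last first.
      by rewrite z1 rmorph0 scale0r.
    rewrite aE => /eqP; rewrite mulf_eq0 (negbTE a0)/= => /eqP/fE z2 i.
    by case: (split_ordP i) => j ->.
(* J (c l + 1) independent elements lie in [B (N0 + J * l)], whose dimension is at most c (N0 + J l
   + 1). This forces J <= c (N0 + 1). *)
have [E [_ BE fE]] := fam (c * N0.+1).+1.
have := free_le BE fE (@subspace0 _ _ iota K^o) (dB _).
by nia.
Qed.

End Growth.

(** * Local rings and places *)

Section LocalRings.
Variables (k : closedFieldType) (K : fieldType) (iota : {rmorphism k -> K}).
Implicit Types P R A : set K.

Definition local_ring P : Prop :=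
  subalgebra iota P /\
  forall x y, max_ideal P x -> max_ideal P y -> max_ideal P (x + y).

Lemma max_ideal_sub P x : max_ideal P x -> P x.
Proof. by case. Qed.

Lemma max_ideal_not_unit P x : x != 0 -> max_ideal P x -> ~ P x^-1.
Proof. by move=> x0 [_ nx] Px; apply: nx; exists x^-1; rewrite ?mulfV. Qed.

Lemma max_idealP P x : x != 0 -> P x -> ~ P x^-1 -> max_ideal P x.
Proof.
move=> x0 Px nx; split=> // -[y Py xy]; apply: nx.
by rewrite -[_^-1]mulr1 -xy mulKf.
Qed.

Lemma unitP P x : P x -> ~ max_ideal P x -> x != 0 /\ P x^-1.
Proof.
move=> Px nx; have : exists2 y, P y & x * y = 1 by apply: contrapT => h; apply: nx.
move=> [y Py xy]; have x0 : x != 0.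
  by apply/eqP => x0; move/eqP: xy; rewrite x0 mul0r eq_sym oner_eq0.
by split=> //; rewrite -[_^-1]mulr1 -xy mulKf.
Qed.

Lemma max_ideal_const P c : subalgebra iota P -> max_ideal P (iota c) -> c = 0.
Proof.
move=> sP [_ h]; apply: contrapT => /eqP c0; apply: h; exists (iota c^-1).
  exact: (subalg_const sP).
by rewrite -rmorphM mulfV// rmorph1.
Qed.

Lemma max_ideal1 P : subalgebra iota P -> ~ max_ideal P 1.
Proof.
by move=> sP; rewrite -(rmorph1 iota) => /(max_ideal_const sP)/eqP; rewrite oner_eq0.
Qed.

Lemma max_ideal0 P : subalgebra iota P -> max_ideal P 0.
Proof.
move=> sP; split; first exact: (subalg0 sP).
by move=> [y _ /eqP]; rewrite mul0r eq_sym oner_eq0.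
Qed.

Lemma max_idealM P a x : subalgebra iota P -> P a -> max_ideal P x -> max_ideal P (a * x).
Proof.
move=> sP Pa [Px nx]; split; first exact: (subalgM sP).
move=> [y Py e]; apply: nx; exists (a * y); first exact: (subalgM sP).
by rewrite mulrA [x * a]mulrC.
Qed.

Lemma max_ideal_prime P a b : subalgebra iota P -> P a -> P b ->
  max_ideal P (a * b) -> max_ideal P a \/ max_ideal P b.
Proof.
move=> sP Pa Pb [_ nab]; apply: contrapT => h.
have [a0 Pai] : a != 0 /\ P a^-1 by apply: unitP => // ?; apply: h; left.
have [b0 Pbi] : b != 0 /\ P b^-1 by apply: unitP => // ?; apply: h; right.
apply: nab; exists (a^-1 * b^-1); first exact: (subalgM sP).
by field; rewrite ?a0 ?b0.
Qed.

Lemma max_ideal_subspace P : local_ring P -> @subspace _ _ iota K^o (max_ideal P).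
Proof.
move=> [sP mD]; split; first exact: max_ideal0.
move=> c x y mx my; apply: mD => //; apply: max_idealM => //.
exact: (subalg_const sP).
Qed.

Lemma max_idealN P x : local_ring P -> max_ideal P x -> max_ideal P (- x).
Proof. by move=> /max_ideal_subspace/(@subspaceN _ _ iota K^o); apply. Qed.

Lemma max_idealB P x y : local_ring P -> max_ideal P x -> max_ideal P y ->
  max_ideal P (x - y).
Proof. by move=> /max_ideal_subspace/(@subspaceB _ _ iota K^o); apply. Qed.

Lemma valuation_local R : valuation_ring iota R -> local_ring R.
Proof.
move=> [sR hR]; split=> // x y mx my.
have [->|x0] := eqVneq x 0; first by rewrite add0r.
have [->|y0] := eqVneq y 0; first by rewrite addr0.
have [|h|h] := hR (x / y); first by rewrite mulf_neq0 ?invr_eq0.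
  have -> : x + y = (1 + x / y) * y by field.
  by apply: max_idealM => //; apply: (subalgD sR) => //; apply: (subalg1 sR).
rewrite invf_div in h; have -> : x + y = (1 + y / x) * x by field.
by apply: max_idealM => //; apply: (subalgD sR) => //; apply: (subalg1 sR).
Qed.

Lemma valuation_nonunit R x : valuation_ring iota R -> ~ R x ->
  x != 0 /\ max_ideal R x^-1.
Proof.
move=> [sR hR] nx; have x0 : x != 0.
  by apply/eqP => x0; apply: nx; rewrite x0; apply: (subalg0 sR).
split=> //; apply: max_idealP; rewrite ?invr_eq0 ?invrK//.
by case: (hR _ x0).
Qed.

Lemma dim_poly A (I : set K) M x : subalgebra iota A -> A x ->
  @dim_le _ _ iota K^o A I M -> exists2 p : {poly k}, p != 0 & I (peval iota p x).
Proof.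
move=> sA Ax h; have [|c [[i ci] hc]] := h (fun i => x ^+ i).
  by move=> i; apply: (subalgX sA).
exists (\poly_(j < M.+1) c (inord j)).
  apply/eqP => /(congr1 (fun p : {poly k} => p`_i)); rewrite coef_poly ltn_ord coef0 inord_val.
  by apply/eqP.
rewrite (@pevalE _ _ _ M.+1) ?size_poly//.
suff <- : lincomb iota c (fun i => x ^+ i : K^o) =
  \sum_(i < M.+1) iota (\poly_(j < M.+1) c (inord j))`_i * x ^+ i by [].
by apply: eq_bigr => j _; rewrite coef_poly ltn_ord inord_val.
Qed.

End LocalRings.

Section Localization.
Variables (k : closedFieldType) (K : fieldType) (iota : {rmorphism k -> K}).
Variables (A p : set K) (sA : subalgebra iota A) (pp : prime_ideal A p).

Let pA x : p x -> A x. Proof. by case: pp => h _ _ _ _; apply: h. Qed.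
Let p0 : p 0. Proof. by case: pp => _ []. Qed.
Let pD x y : p x -> p y -> p (x + y). Proof. by case: pp => _ [_ h] _ _ _; apply: h. Qed.
Let pM a x : A a -> p x -> p (a * x). Proof. by case: pp => _ _ h _ _; apply: h. Qed.
Let p1 : ~ p 1. Proof. by case: pp. Qed.
Let pP x y : A x -> A y -> p (x * y) -> p x \/ p y.
Proof. by case: pp => _ _ _ _; apply. Qed.
Let npM x y : A x -> A y -> ~ p x -> ~ p y -> ~ p (x * y).
Proof. by move=> hx hy nx ny /(pP hx hy)[]. Qed.
Let np_neq0 x : ~ p x -> x != 0.
Proof. by move=> h; apply/eqP => x0; apply: h; rewrite x0. Qed.

Lemma sub_localization : A `<=` localization A p.
Proof. by move=> x Ax; exists x, 1; rewrite divr1; split=> //; apply: (subalg1 sA). Qed.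

Lemma localization_subalgebra : subalgebra iota (localization A p).
Proof.
split; last by move=> c; apply: sub_localization; apply: (subalg_const sA).
split; first by apply: sub_localization; apply: (subalg1 sA).
- move=> _ _ [a [b [Aa Ab nb ->]]] [c [d [Ac Ad nd ->]]].
  exists (a * d - c * b), (b * d); split.
  + by apply: (subalgB sA); apply: (subalgM sA).
  + exact: (subalgM sA).
  + exact: npM.
  + by field; rewrite !np_neq0.
- move=> _ _ [a [b [Aa Ab nb ->]]] [c [d [Ac Ad nd ->]]].
  exists (a * c), (b * d); split; try exact: (subalgM sA).
  + exact: npM.
  + by field; rewrite !np_neq0.
Qed.

Lemma max_ideal_localization x : max_ideal (localization A p) x <->
  exists a b, [/\ p a, A b, ~ p b & x = a / b].
Proof.
split.
  move=> [[a [b [Aa Ab nb ->]]] h]; exists a, b; split=> //.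
  apply: contrapT => na; apply: h; exists (b / a); first by exists b, a.
  by field; rewrite !np_neq0.
move=> [a [b [pa Ab nb ->]]]; split; first by exists a, b; split=> //; apply: pA.
move=> [_ [c [d [Ac Ad nd ->]]] e].
have : a * c = b * d.
  by rewrite -[RHS]mulr1 -e; field; rewrite !np_neq0.
move=> e2; have : p (b * d) by rewrite -e2 mulrC; apply: pM.
by apply: npM.
Qed.

Lemma max_ideal_localizationA x : A x -> max_ideal (localization A p) x <-> p x.
Proof.
move=> Ax; rewrite max_ideal_localization; split=> [[a [b [pa Ab nb e]]]|px].
  have : p (x * b) by rewrite e divfK// np_neq0.
  by move=> /(pP Ax Ab)[].
by exists x, 1; rewrite divr1; split=> //; apply: (subalg1 sA).
Qed.

Lemma localization_local : local_ring iota (localization A p).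
Proof.
split; first exact: localization_subalgebra.
move=> x y /max_ideal_localization[a [b [pa Ab nb ->]]].
move=> /max_ideal_localization[c [d [pc Ad nd ->]]].
apply/max_ideal_localization; exists (a * d + c * b), (b * d); split.
- by apply: pD; rewrite mulrC; apply: pM.
- exact: (subalgM sA).
- exact: npM.
- by field; rewrite !np_neq0.
Qed.

(** A basis of A/aA still spans after localization: a denominator c outside p is invertible modulo a
    by an element of A, because it satisfies a polynomial equation modulo aA. Hence each fraction is
    congruent to an element of A. *)
Lemma localization_quot a M : A a -> a != 0 ->
  @dim_le _ _ iota K^o A [set a * y | y in A] M ->
  @dim_le _ _ iota K^o (localization A p) [set a * y | y in localization A p] M.
Proof.
move=> Aa a0 hM; set P := localization A p.
have sP : subalgebra iota P := localization_subalgebra.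
have AP := sub_localization.
have sI : @subspace _ _ iota K^o [set a * y | y in P] := ideal_subspace sP a.
have [m mM [e [Ae fe se]]] := dim_le_dim_eq (subalg_subspace sA) (ideal_subspace sA a) hM.
apply: (dim_le_leq mM); apply: (@dim_le_spans _ _ _ _ _ _ _ e) => // f Pf.
suff [h Ah hh] : exists2 h, A h & [set a * y | y in P] (f - h).
  have [c [y Ay hc]] := se h Ah; exists c.
  rewrite -[f](subrK h) -addrA; apply: (@subspaceD _ _ iota K^o) => //.
  by exists y => //; apply: AP.
move: Pf => [b [c [Ab Ac nc ->]]].
have Pc : P c^-1 by exists 1, c; rewrite div1r; split=> //; apply: (subalg1 sA).
have c0 := np_neq0 nc.
have [q q0 hq] := dim_poly sA Ac hM.
pose J := [set a * y | y in P].
have JM u v : P u -> J v -> J (u * v).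
  by move=> Pu [y Py <-]; exists (u * y); [apply: (subalgM sP)|ring].
(* Factors c of q(c) are cancelled, as c is a unit of P. Once the constant term z is nonzero, q = r
   X + z gives the inverse h = - r(c) / z of c modulo aP. *)
have {q0} : J (peval iota q c) -> exists2 h, A h & J (1 - c * h).
  elim/poly_ind: q q0 {hq} => [|r z IH]; first by rewrite eqxx.
  have [->|z0] := eqVneq z 0.
    rewrite addr0 mulf_eq0 negb_or => /andP[r0 _]; rewrite pevalM pevalX mulrC => h.
    by apply: IH => //; rewrite -[X in J X](mulKf c0); apply: JM.
  move=> _; rewrite pevalD pevalM pevalX pevalC => h.
  exists (- (iota z^-1) * peval iota r c).
    apply: (subalgM sA); last exact: subalgebra_peval.
    by apply: (subalgN sA); apply: (subalg_const sA).
  have -> : 1 - c * (- iota z^-1 * peval iota r c) = iota z^-1 * (peval iota r c * c + iota z).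
    by rewrite fmorphV; field; rewrite fmorph_eq0.
  by apply: JM => //; apply: (subalg_const sP).
case; first by case: hq => y Ay <-; exists y => //; apply: AP.
move=> h Ah Jh; exists (b * h); first exact: (subalgM sA).
have -> : b / c - b * h = (b * c^-1) * (1 - c * h) by field.
by apply: JM => //; apply: (subalgM sP) => //; apply: AP.
Qed.
End Localization.

Definition poly_in (K : fieldType) (P : set K) (p : {poly K}) : Prop := forall i, P p`_i.

(** * Existence and residues of valuation rings *)

Section Valuations.
Variables (k : closedFieldType) (K : fieldType) (iota : {rmorphism k -> K}).
Implicit Types P R A : set K.

Definition adjoin A (x : K) : set K :=
  [set f | exists p : {poly K}, (forall i, A p`_i) /\ f = p.[x]].

Lemma adjoin_subalgebra A x : subalgebra iota A -> subalgebra iota (adjoin A x).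
Proof.
move=> sA; have A0 := subalg0 sA; have AC c : A c -> adjoin A x c.
  by exists c%:P; rewrite hornerC; split=> // i; rewrite coefC; case: ifP.
split; last by move=> c; apply: AC; apply: (subalg_const sA).
split; first by apply: AC; apply: (subalg1 sA).
- move=> _ _ [p [hp ->]] [q [hq ->]]; exists (p - q); rewrite hornerD hornerN.
  by split=> // i; rewrite coefB; apply: (subalgB sA).
- move=> _ _ [p [hp ->]] [q [hq ->]]; exists (p * q); rewrite hornerM.
  by split=> // i; rewrite coefM; apply: (subalg_sum sA) => j _; apply: (subalgM sA).
Qed.

Lemma sub_adjoin A x : subalgebra iota A -> A `<=` adjoin A x.
Proof.
move=> sA c Ac; exists c%:P; rewrite hornerC; split=> // i.
by rewrite coefC; case: ifP => // _; apply: (subalg0 sA).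
Qed.

Lemma adjoin_self A x : subalgebra iota A -> adjoin A x x.
Proof.
move=> sA; exists 'X; rewrite hornerX; split=> // i; rewrite coefX.
by case: eqP => _; [apply: (subalg1 sA)|apply: (subalg0 sA)].
Qed.

(** If x and 1/x are both outside A, adjoining either of them produces 1/f, so 1 = f p(x) = f q(1/x)
    with coefficients in A. Taking both degrees minimal, each relation can be used to shorten the
    longer one. *)
Lemma maximal_valuation A f : subalgebra iota A -> A f -> f != 0 -> ~ A f^-1 ->
  (forall B, subalgebra iota B -> A `<=` B -> ~ B f^-1 -> B `<=` A) ->
  valuation_ring iota A.
Proof.
move=> sA Af f0 nf mx; split=> // x x0; apply: contrapT => nx.
have adj y : ~ A y -> adjoin A y f^-1.
  move=> ny; apply: contrapT => h; apply: ny.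
  apply: (mx (adjoin A y)) => //; [exact: adjoin_subalgebra|exact: sub_adjoin|exact: adjoin_self].
(* f lies in the Jacobson radical of A. If 1/u with u = 1 - f a were missing, then 1/f would lie in
   A[1/u], so u^n = f b; but u^n = 1 - f v as well, and 1/f = b + v would be in A. *)
have unit a : A a -> A (1 - f * a)^-1.
  move=> Aa; set u := 1 - f * a.
  have Au : A u by apply: (subalgB sA); [apply: (subalg1 sA)|apply: (subalgM sA)].
  have u0 : u != 0.
    rewrite subr_eq0; apply/eqP => h; apply: nf.
    by rewrite -[_^-1]mulr1 h mulKf.
  apply: contrapT => /adj[p [Ap hp]]; apply: nf.
  have {hp} : exists b n, A b /\ f^-1 = b / u ^+ n.
    rewrite {}hp; elim/poly_ind: p Ap => [_|p c IH Ap].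
      by exists 0, 0%N; rewrite horner0 mul0r; split=> //; apply: (subalg0 sA).
    have [i|b [n [Ab hb]]] := IH.
      by have := Ap i.+1; rewrite coefD coefMX coefC /= addr0.
    exists (b + c * u ^+ n.+1), n.+1; split.
      apply: (subalgD sA) => //; apply: (subalgM sA); last exact: (subalgX sA).
      by have := Ap 0%N; rewrite coefD coefMX coefC /= add0r.
    by rewrite hornerD hornerM hornerX hornerC hb exprS; field; rewrite ?expf_neq0 ?u0.
  move=> [b [n [Ab hb]]].
  have un : u ^+ n = f * b.
    by rewrite -[b](divfK (expf_neq0 n u0)) -hb mulrA mulfV// mul1r.
  have [v Av hv] : exists2 v, A v & u ^+ n = 1 - f * v.
    elim: n {un hb} => [|n [v Av hv]].
      by exists 0; rewrite ?mulr0 ?subr0//; apply: (subalg0 sA).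
    exists (v + a - f * a * v).
      apply: (subalgB sA); first exact: (subalgD sA).
      by apply: (subalgM sA) => //; apply: (subalgM sA).
    by rewrite exprS hv /u; ring.
  have -> : f^-1 = b + v.
    apply: (mulfI f0); rewrite mulfV// mulrDr -un hv; ring.
  exact: (subalgD sA).
have [nx1 nx2] : ~ A x /\ ~ A x^-1 by split=> h; apply: nx; [left|right].
(* minimal n such that 1 = f p(x) with deg p <= n *)
have rel y : ~ A y -> exists n, `[< exists p : {poly K}, [/\ poly_in A p,
    (size p <= n.+1)%N & 1 = f * p.[y]] >].
  move=> /adj[p [Ap hp]]; exists (size p); apply/asboolP; exists p; split=> //.
  by rewrite -hp mulfV.
case: (ex_minnP (rel _ nx1)) => n /asboolP[p [Ap sp hp]] minp.
case: (ex_minnP (rel _ nx2)) => m /asboolP[q [Aq sq hq]] minq.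
(* if deg q <= deg p, the relation for 1/x lowers the degree of the one for x *)
have key y r s d e : y != 0 -> poly_in A r -> poly_in A s ->
    (size r <= d.+1)%N -> (size s <= e.+1)%N -> (e <= d)%N -> (0 < d)%N ->
    1 = f * r.[y] -> 1 = f * s.[y^-1] ->
    exists p, [/\ poly_in A p, (size p <= d)%N & 1 = f * p.[y]].
  move=> y0 Ar As sr ss ed d0 hr hs.
  pose u := (1 - f * s`_0)^-1; have Au : A u by apply: unit.
  have u0 : 1 - f * s`_0 != 0.
    apply/eqP => h; apply: nf.
    by rewrite -[_^-1]mulr1 -(subrK (f * s`_0) 1) h add0r mulKf.
  (* Multiplying 1 = f s(1/y) by y^d and isolating the term of s_0 gives y^d as f u times a
     polynomial of lower degree. Substituting it in the top term of r yields t. *)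
  pose t := \poly_(i < d) (r`_i + r`_d * (f * u) * s`_(d - i)).
  have At : poly_in A t.
    move=> i; rewrite coef_poly; case: ifP => _; last exact: (subalg0 sA).
    apply: (subalgD sA) => //; apply: (subalgM sA) => //; apply: (subalgM sA) => //.
    exact: (subalgM sA).
  exists t; split=> //; first exact: size_poly.
  have rE : r.[y] = \sum_(i < d) r`_i * y ^+ i + r`_d * y ^+ d.
    by rewrite (horner_coef_wide _ sr) big_ord_recr.
  have sE : s.[y^-1] * y ^+ d = s`_0 * y ^+ d + \sum_(i < d) s`_(d - i) * y ^+ i.
    rewrite (@horner_coef_wide _ d.+1) ?(leq_trans ss)// mulr_suml big_ord_recl expr0 mulr1.
    congr (_ + _); rewrite (reindex_inj rev_ord_inj)/=; apply: eq_bigr => i _.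
    rewrite /bump/= add1n -subSn// subSS -mulrA; congr (_ * _).
    have yd : y ^+ d = y ^+ (d - i) * y ^+ i by rewrite -exprD subnK// ltnW.
    by rewrite yd exprVn mulKf// expf_neq0.
  have tE : t.[y] = \sum_(i < d) r`_i * y ^+ i + r`_d * (f * u) * \sum_(i < d) s`_(d - i) * y ^+ i.
    rewrite (@horner_coef_wide _ d) ?size_poly// mulr_sumr -big_split.
    by apply: eq_bigr => i _; rewrite coef_poly ltn_ord/=; ring.
  have yd : y ^+ d = f * u * \sum_(i < d) s`_(d - i) * y ^+ i.
    have h : (1 - f * s`_0) * y ^+ d = f * \sum_(i < d) s`_(d - i) * y ^+ i.
      have := congr1 (fun z => f * z) sE; rewrite mulrA -hs mul1r mulrDr => yE.
      by rewrite mulrBl mul1r {1}yE; ring.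
    by rewrite -[LHS](mulKf u0) h -/u; ring.
  by rewrite tE -mulrA -yd -rE.
have pos y r : poly_in A r -> (size r <= 1)%N -> 1 = f * r.[y] -> False.
  move=> Ar sr hr; apply: nf; rewrite -[_^-1]mulr1 hr mulKf//.
  by rewrite (size1_polyC sr) hornerC.
have n0 : (0 < n)%N by case: (n) sp => // s1; case: (pos x p).
have m0 : (0 < m)%N by case: (m) sq => // s1; case: (pos x^-1 q).
have [mn|/ltnW nm] := leqP m n.
  have [t [At st ht]] := key x p q n m x0 Ap Aq sp sq mn n0 hp hq.
  have : (n <= n.-1)%N by apply: minp; apply/asboolP; exists t; rewrite prednK.
  lia.
have [||t [At st ht]] := key x^-1 q p m n _ Aq Ap sq sp nm m0 hq; rewrite ?invr_eq0 ?invrK//.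
have : (m <= m.-1)%N by apply: minq; apply/asboolP; exists t; rewrite prednK.
lia.
Qed.

(** k[f] does not contain 1/f, for 1 = f p(f) would make f algebraic, hence constant. Zorn's lemma
    enlarges k[f] to a subalgebra maximal among those avoiding 1/f. *)
Lemma valuation_exists f : ~ range iota f ->
  exists R, [/\ valuation_ring iota R, R f & ~ R f^-1].
Proof.
move=> nf; have f0 : f != 0.
  by apply/eqP => f0; apply: nf; exists 0; rewrite ?rmorph0.
pose A0 := generated_algebra iota [:: f].
have A0p x : A0 x -> exists p, x = peval iota p f.
  move=> /(_ [set y | exists p, y = peval iota p f]).
  apply; last by move=> y; rewrite inE => /eqP ->; exists 'X; rewrite pevalX.
  split; last by move=> c; exists c%:P; rewrite pevalC.
  split; first by exists 1; rewrite peval1.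
  - by move=> _ _ [p ->] [q ->]; exists (p - q); rewrite pevalB.
  - by move=> _ _ [p ->] [q ->]; exists (p * q); rewrite pevalM.
pose Q (X : set K) := subalgebra iota (A0 `|` X) /\ ~ (A0 `|` X) f^-1.
have sA0 : subalgebra iota A0 := generated_subalgebra iota _.
have nA0 : ~ A0 f^-1.
  move=> /A0p[p hp]; apply: nf; apply: (@algebraic_const _ _ iota (1 - 'X * p)).
    apply/eqP => h; have := congr1 (fun q : {poly k} => q.[0]) h.
    by rewrite !hornerE ?mul0r ?subr0 => /eqP; rewrite oner_eq0.
  by rewrite pevalB peval1 pevalM pevalX -hp mulfV// subrr.
have [F FQ Ftot|X [[sX nX] mx]] := @Zorn_bigcup K Q.
  have FF X : F X -> A0 `|` X `<=` A0 `|` \bigcup_(X in F) X.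
    by move=> FX x [Nx|Xx]; [left|right; exists X].
  have two x y : (A0 `|` \bigcup_(X in F) X) x -> (A0 `|` \bigcup_(X in F) X) y ->
      (A0 x /\ A0 y) \/ exists2 X, F X & (A0 `|` X) x /\ (A0 `|` X) y.
    move=> [Ax|[X FX Xx]] [Ay|[Y FY Yy]].
    - by left.
    - by right; exists Y => //; split; [left|right].
    - by right; exists X => //; split; [right|left].
    - right; case: (Ftot _ _ FX FY) => XY; [exists Y => //|exists X => //]; split; right=> //; exact: XY.
  split; last by move=> [//|[X FX Xf]]; have [_] := FQ _ FX; apply; right.
  split; last by move=> c; left; apply: (subalg_const sA0).
  split; first by left; apply: (subalg1 sA0).
  - move=> x y hx hy; have [[Ax Ay]|[X FX [Xx Xy]]] := two _ _ hx hy.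
      by left; apply: (subalgB sA0).
    by apply: (FF X FX); have [sX _] := FQ _ FX; apply: (subalgB sX).
  - move=> x y hx hy; have [[Ax Ay]|[X FX [Xx Xy]]] := two _ _ hx hy.
      by left; apply: (subalgM sA0).
    by apply: (FF X FX); have [sX _] := FQ _ FX; apply: (subalgM sX).
have A0f : A0 f by apply: mem_generated; rewrite inE.
exists (A0 `|` X); split=> //; last by left.
apply: (@maximal_valuation _ f) => //; first by left.
move=> B sB AB nB x Bx; apply: contrapT => nx.
have AB' : A0 `|` B = B by apply/setUidPr => y Ay; apply: AB; left.
apply: (mx B); last by rewrite /Q AB'.
split; first by move=> y Xy; apply: AB; right.
by move=> h; apply: nx; right; apply: h.
Qed.

Hypothesis hK : function_field1 iota.

(** For y outside R the algebra k[x, 1/y] lies in R and is finite-dimensional modulo 1/y, which is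
    in the maximal ideal. So x satisfies a polynomial over k modulo that ideal, and the polynomial
    splits. *)
Lemma valuation_residue R x : valuation_ring iota R -> R <> setT -> R x ->
  exists c, max_ideal R (x - iota c).
Proof.
move=> vR RT Rx; have sR : subalgebra iota R by case: vR.
have [y ny] : exists y, ~ R y.
  apply: contrapT => h; apply: RT; apply/seteqP; split=> // y _.
  by apply: contrapT => ny; apply: h; exists y.
have [y0 my] := valuation_nonunit vR ny.
pose A := generated_algebra iota [:: x; y^-1].
have AR : A `<=` R.
  move=> z; apply=> // u; rewrite !inE => /orP[]/eqP -> //.
  exact: max_ideal_sub my.
have sA : subalgebra iota A := generated_subalgebra iota _.
have Ax : A x by apply: mem_generated; rewrite !inE eqxx.
have [||M hM] := @algebra_quot_dim _ _ iota hK [:: x; y^-1] y^-1.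
- by apply: mem_generated; rewrite !inE eqxx orbT.
- by rewrite invr_eq0.
have [p p0 [z Az hz]] := dim_poly sA Ax hM.
have [rs h] := peval_prime iota p0.
have [//|//||||c _ hc] := h (max_ideal R) R x.
- by move=> c; apply: (max_ideal_const sR).
- by move=> a b; apply: (max_ideal_prime sR).
- by rewrite -hz mulrC; apply: (max_idealM sR) => //; apply: AR.
by exists c.
Qed.

End Valuations.

(** * Points of an affine model *)

Section AffinePoints.
Variables (k : closedFieldType) (K : fieldType) (iota : {rmorphism k -> K}).
Hypothesis hK : function_field1 iota.
Variable s : seq K.
Notation A := (generated_algebra iota s).
Hypothesis fracA : forall f, exists a b, [/\ A a, A b, b != 0 & f = a / b].

Let sA : subalgebra iota A := generated_subalgebra iota s.

Lemma affine_local P : affine_points A P -> local_ring iota P.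
Proof. by move=> [p pp ->]; apply: localization_local. Qed.

Lemma affine_sub P : affine_points A P -> A `<=` P.
Proof. by move=> [p pp ->]; apply: (sub_localization sA pp). Qed.

Lemma affine_frac P f : affine_points A P -> exists a b, [/\ P a, P b, b != 0 & f = a / b].
Proof.
move=> /affine_sub AP; have [a [b [Aa Ab b0 ->]]] := fracA f.
by exists a, b; split=> //; apply: AP.
Qed.

Lemma affine_quot P a : affine_points A P -> P a -> a != 0 ->
  exists M, @dim_le _ _ iota K^o P [set a * y | y in P] M.
Proof.
move=> [p pp ->] [b [c [Ab Ac nc ->]]] bc0.
have b0 : b != 0 by apply: contraNneq bc0 => ->; rewrite mul0r.
have c0 : c != 0 by apply: contraNneq bc0 => ->; rewrite invr0 mulr0.
have [M hM] := algebra_quot_dim hK Ab b0.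
exists M; apply: dim_le_mono (localization_quot sA pp Ab b0 hM) => //.
move=> _ [y Py <-]; exists (c * y); last by field.
apply: (subalgM (localization_subalgebra sA pp)) => //.
exact: (sub_localization sA pp).
Qed.

Lemma affine_eq P Q : affine_points A P -> affine_points A Q ->
  (forall x, A x -> max_ideal P x <-> max_ideal Q x) -> P = Q.
Proof.
move=> [p pp ->] [q qq ->] h; suff -> : p = q by [].
have pA : p `<=` A by case: pp.
have qA : q `<=` A by case: qq.
apply/seteqP; split=> x hx.
  have Ax := pA _ hx.
  by apply/(max_ideal_localizationA sA qq Ax)/h/(max_ideal_localizationA sA pp).
have Ax := qA _ hx.
by apply/(max_ideal_localizationA sA pp Ax)/h/(max_ideal_localizationA sA qq).
Qed.

(** Induction on t: the finitely many residues of the head cut X into finitely many pieces, on each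
    of which the residues of the tail separate points. *)
Lemma finite_by_residues (X : set (set K)) (t : seq K) :
  (forall x, x \in t -> exists rs : seq k, forall P, X P ->
     exists2 c, c \in rs & max_ideal P (x - iota c)) ->
  (forall P Q, X P -> X Q -> (forall x, x \in t -> exists c,
     max_ideal P (x - iota c) /\ max_ideal Q (x - iota c)) -> P = Q) ->
  finite_set X.
Proof.
elim: t X => [|x t IH] X hres hinj.
  have [[P XP]|nX] := pselect (X !=set0).
    apply: (@sub_finite_set _ _ [set P]); last exact: finite_set1.
    by move=> Q XQ; apply: hinj.
  suff -> : X = set0 by [].
  by apply/seteqP; split=> // P XP; apply: nX; exists P.
have [rs hrs] := hres x (mem_head _ _).
apply: (@sub_finite_set _ _ (\bigcup_(c in [set c | c \in rs]) [set P | X P /\ max_ideal P (x - iota c)])).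
  by move=> P XP; have [c crs mc] := hrs _ XP; exists c.
apply: bigcup_finite; first exact: finite_seq.
move=> c /= crs; apply: IH.
  move=> y yt; have [|rs' h] := hres y; first by rewrite inE yt orbT.
  by exists rs' => P [XP _]; apply: h.
move=> P Q [XP Pc] [XQ Qc] h; apply: hinj => // y; rewrite inE => /orP[/eqP ->|/h//].
by exists c.
Qed.

(** With f = b/c, only zeros of c can fail to contain f. At these the generators of A have finitely
    many possible residues, because A/cA is finite-dimensional, and the residues of the generators
    determine the point. *)
Lemma affine_finite f :
  finite_set [set P | [/\ affine_points A P, P <> setT & ~ P f]].
Proof.
have [b [c [Ab Ac c0 ->]]] := fracA f.
have [M hM] := algebra_quot_dim hK Ac c0.
apply: (@sub_finite_set _ _ [set P | affine_points A P /\ max_ideal P c]).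
  move=> P [AP PT nf]; split=> //; apply: contrapT => /(unitP (affine_sub AP Ac))[_ h].
  by apply: nf; apply: (subalgM (affine_local AP).1) => //; apply: (affine_sub AP).
apply: (@finite_by_residues _ s) => [x xs|P Q [AP Pc] [AQ Qc] h].
  have Ax : A x by apply: mem_generated.
  have [p p0 [y Ay hy]] := dim_poly sA Ax hM.
  have [rs hrs] := peval_prime iota p0; exists rs => P [AP Pc].
  have sP := (affine_local AP).1.
  have [//|||||d drs hd] := hrs (max_ideal P) P x; last by exists d.
  - exact: affine_sub Ax.
  - by move=> d; apply: (max_ideal_const sP).
  - by move=> u v; apply: (max_ideal_prime sP).
  - by rewrite -hy mulrC; apply: (max_idealM sP) => //; apply: (affine_sub AP).
have lP := affine_local AP; have lQ := affine_local AQ.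
have sP := lP.1; have sQ := lQ.1.
(* The elements with a common constant residue at P and Q form a subalgebra; it contains the
   generators, hence A. *)
pose T := [set z : K | exists c, max_ideal P (z - iota c) /\ max_ideal Q (z - iota c)].
have TP z : T z -> P z /\ Q z.
  move=> [d [[Pd _] [Qd _]]]; rewrite -(subrK (iota d) z).
  by split; [apply: (subalgD sP)|apply: (subalgD sQ)] => //;
    [apply: (subalg_const sP)|apply: (subalg_const sQ)].
have AT z : A z -> T z.
  move=> /(_ T); apply=> //; split; last first.
    by move=> d; exists d; rewrite subrr; split; [apply: (max_ideal0 sP)|apply: (max_ideal0 sQ)].
  split.
  - by exists 1; rewrite rmorph1 subrr; split; [apply: (max_ideal0 sP)|apply: (max_ideal0 sQ)].
  - move=> u v [d [Pu Qu]] [e [Pv Qv]]; exists (d - e); rewrite rmorphB.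
    have -> : u - v - (iota d - iota e) = (u - iota d) - (v - iota e) by ring.
    by split; [apply: (max_idealB lP)|apply: (max_idealB lQ)].
  - move=> u v hu hv; have [Pv Qv] := TP _ hv; move: hu hv.
    move=> [d [Pu Qu]] [e [Pe Qe]]; exists (d * e); rewrite rmorphM.
    have -> : u * v - iota d * iota e = v * (u - iota d) + iota d * (v - iota e) by ring.
    split; [apply: lP.2|apply: lQ.2].
    + exact: (max_idealM sP).
    + by apply: (max_idealM sP) => //; apply: (subalg_const sP).
    + exact: (max_idealM sQ).
    + by apply: (max_idealM sQ) => //; apply: (subalg_const sQ).
apply: affine_eq => // z /AT[d [Pz Qz]].
have key R : local_ring iota R -> max_ideal R (z - iota d) -> max_ideal R z -> d = 0.
  move=> lR hz mz; apply: (max_ideal_const lR.1).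
  have -> : iota d = z - (z - iota d) by ring.
  exact: (max_idealB lR mz hz).
by split=> hz; [have d0 := key P lP Pz hz|have d0 := key Q lQ Qz hz];
  move: Pz Qz; rewrite d0 rmorph0 subr0.
Qed.

End AffinePoints.

(** * Local rings of the closed points of C *)

Section ClosedPoints.
Variables (k : closedFieldType) (K : fieldType) (iota : {rmorphism k -> K}).
Variable C : set (set K).
Hypothesis hC : complete_curve iota C.
Notation cp := (closed_points C).

Let hK : function_field1 iota := proj1 hC.

Lemma closed_affine P : cp P -> exists s,
  (forall f, exists a b, [/\ generated_algebra iota s a, generated_algebra iota s b,
     b != 0 & f = a / b]) /\ affine_points (generated_algebra iota s) P.
Proof.
by have [_ [[m [s [hs ->]]] _]] := hC; move=> [[i Pi] _]; exists (s i); split.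
Qed.

Lemma cp_local P : cp P -> local_ring iota P.
Proof. by move=> /closed_affine[s [_]]; apply: affine_local. Qed.

Lemma cp_subalg P : cp P -> subalgebra iota P.
Proof. by move=> /cp_local[]. Qed.

Lemma cp_frac P f : cp P -> exists a b, [/\ P a, P b, b != 0 & f = a / b].
Proof. by move=> /closed_affine[s [h]]; apply: affine_frac. Qed.

Lemma cp_quot P a : cp P -> P a -> a != 0 ->
  exists M, @dim_le _ _ iota K^o P [set a * y | y in P] M.
Proof. by move=> /closed_affine[s [h]]; apply: affine_quot. Qed.

Lemma cp_elt P : cp P -> exists2 a, max_ideal P a & a != 0.
Proof.
move=> cP; have [f nf] : exists f, ~ P f.
  apply: contrapT => h; case: cP => _; apply; apply/seteqP; split=> // y _.
  by apply: contrapT => ny; apply: h; exists y.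
have [a [b [Pa Pb b0 fE]]] := cp_frac f cP; exists b => //.
apply: contrapT => /(unitP Pb)[_ Pb']; apply: nf; rewrite fE.
exact: (subalgM (cp_subalg cP)).
Qed.

(** For a in m_P the quotient O_P/aO_P is finite-dimensional, so x satisfies a polynomial over k
    modulo m_P. *)
Lemma cp_residue P x : cp P -> P x -> exists c, max_ideal P (x - iota c).
Proof.
move=> cP Px; have [a ma a0] := cp_elt cP; have sP := cp_subalg cP.
have [M hM] := cp_quot cP (max_ideal_sub ma) a0.
have [p p0 [y Py hy]] := dim_poly sP Px hM.
have [rs hrs] := peval_prime iota p0.
have [//|//||||c _ hc] := hrs (max_ideal P) P x; last by exists c.
- by move=> c; apply: (max_ideal_const sP).
- by move=> u v; apply: (max_ideal_prime sP).
- by rewrite -hy mulrC; apply: (max_idealM sP).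
Qed.

Lemma cp_finite f : finite_set [set P | cp P /\ ~ P f].
Proof.
have [_ [[m [s [hs CE]]] _]] := hC.
apply: (@sub_finite_set _ _ (\bigcup_(i in [set: 'I_m])
   [set P | [/\ affine_points (generated_algebra iota (s i)) P, P <> setT & ~ P f]])).
  by rewrite /closed_points CE => P [[[i Pi] PT] nf]; exists i.
apply: bigcup_finite => [|i _]; first exact: finite_finset.
exact: affine_finite (hs i) f.
Qed.

Lemma cp_dominated R : valuation_ring iota R -> R <> setT ->
  exists2 P, cp P & dominates R P.
Proof.
move=> vR RT; have [_ [_ h]] := hC; have [P [[CP dP] _]] := h R vR.
exists P => //; split=> // PT; apply: RT; apply/seteqP; split=> // x _.
by apply: (dP.1); rewrite PT.
Qed.

End ClosedPoints.

(** * Fractional ideals *)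

Section Spans.
Variables (k : closedFieldType) (K : fieldType) (iota : {rmorphism k -> K}).

Lemma Rspan_sub (W : lmodType K) (R : set K) (S M : set W) : M 0 ->
  (forall x y, M x -> M y -> M (x + y)) -> (forall a x, R a -> M x -> M (a *: x)) ->
  S `<=` M -> Rspan R S `<=` M.
Proof.
move=> M0 MD MZ SM _ [m [a [s [Ra Ss ->]]]].
elim/big_rec: _ => // i x _ Mx; apply: MD => //; apply: MZ => //; exact: SM.
Qed.

Lemma mem_Rspan (W : lmodType K) (R : set K) (S : set W) x : subalgebra iota R ->
  S x -> Rspan R S x.
Proof.
move=> sR Sx; exists 1%N, (fun=> 1), (fun=> x); split=> // [_|]; first exact: (subalg1 sR).
by rewrite big_ord1 scale1r.
Qed.

Lemma RspanD (W : lmodType K) (R : set K) (S : set W) x y :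
  Rspan R S x -> Rspan R S y -> Rspan R S (x + y).
Proof.
move=> [m [a [s [Ra Ss ->]]]] [n [b [t [Rb St ->]]]].
exists (m + n)%N, (cat_fun a b), (cat_fun s t); split.
- exact: (cat_fun_prop (P := R)).
- exact: (cat_fun_prop (P := S)).
- by rewrite big_split_ord; congr (_ + _); apply: eq_bigr => i _; rewrite ?cat_funl ?cat_funr.
Qed.

Lemma RspanZ (W : lmodType K) (R : set K) (S : set W) a x : subalgebra iota R ->
  R a -> Rspan R S x -> Rspan R S (a *: x).
Proof.
move=> sR Ra [m [b [s [Rb Ss ->]]]]; exists m, (fun i => a * b i), s; split=> //.
  by move=> i; apply: (subalgM sR).
by rewrite scaler_sumr; apply: eq_bigr => i _; rewrite scalerA.
Qed.

Lemma Rspan0 (W : lmodType K) (R : set K) (S : set W) : Rspan R S 0.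
Proof. by exists 0%N, (fun=> 0), (fun=> 0); split=> [[]|[]|]//; rewrite big_ord0. Qed.

Lemma dim_le_capl (E : lmodType K) (A B : set E) n : subspace iota A ->
  dim_le iota A B n -> dim_le iota A (A `&` B) n.
Proof.
move=> sA h e Ae; have [c [c0 Bc]] := h e Ae; exists c; split=> //; split=> //.
exact: subspace_lincomb.
Qed.

Lemma dim_le_inter (E : lmodType K) (A : set E) (I : eqType) (T : seq I)
    (B : I -> set E) (n : I -> nat) : subspace iota A ->
  (forall i, i \in T -> subspace iota (B i)) ->
  (forall i, i \in T -> dim_le iota A (B i) (n i)) ->
  dim_le iota A (A `&` [set x | forall i, i \in T -> B i x]) (\sum_(i <- T) n i).
Proof.
move=> sA; elim: T => [|i T IH] sB h.
  rewrite big_nil => e Ae; exists (fun=> 1); split; first by exists ord0; rewrite oner_eq0.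
  by split; first exact: subspace_lincomb.
have sI (T' : seq I) : (forall i, i \in T' -> subspace iota (B i)) ->
    subspace iota (A `&` [set x | forall i, i \in T' -> B i x]).
  move=> sB'; apply: subspaceI => //; split=> [j jT|c x y hx hy j jT].
    by case: (sB' j jT).
  by have [_ hB] := sB' j jT; apply: hB; [apply: hx|apply: hy].
rewrite big_cons addnC.
have sBT j : j \in T -> subspace iota (B j) by move=> jT; apply: sB; rewrite inE jT orbT.
apply: (@dim_le_trans _ _ _ _ _ _ _ _ _ sA (sI _ sBT) (sI _ sB)).
  by apply: IH => // j jT; apply: h; rewrite inE jT orbT.
have hi : dim_le iota (A `&` [set x | forall i, i \in T -> B i x]) (B i) (n i).
  by apply: dim_le_mono (h i (mem_head _ _)) => // x [].
apply: dim_le_mono (dim_le_capl (sI _ sBT) hi) => // x [[Ax hx] Bx].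
by split=> // j; rewrite inE => /orP[/eqP ->|/hx].
Qed.

Definition scale (a : K) (A : set K) : set K := [set a * x | x in A].

Lemma scaleP a A x : a != 0 -> scale a A x <-> A (a^-1 * x).
Proof.
move=> a0; split; first by move=> [y Ay <-]; rewrite mulKf.
by move=> h; exists (a^-1 * x) => //; rewrite mulVKf.
Qed.

Lemma scaleA a b A : scale a (scale b A) = scale (a * b) A.
Proof.
apply/seteqP; split; first by move=> _ [_ [x Ax <-] <-]; exists x => //; rewrite mulrA.
by move=> _ [x Ax <-]; exists (b * x); [exists x|rewrite mulrA].
Qed.

Lemma scale1 A : scale 1 A = A.
Proof.
apply/seteqP; split; first by move=> _ [x Ax <-]; rewrite mul1r.
by move=> x Ax; exists x => //; rewrite mul1r.
Qed.

Lemma scale_subspace a A : @subspace _ _ iota K^o A -> @subspace _ _ iota K^o (scale a A).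
Proof.
move=> [A0 h]; split; first by exists 0 => //; rewrite mulr0.
move=> c _ _ [x Ax <-] [y Ay <-]; exists (iota c * x + y); first exact: h.
by rewrite /GRing.scale/=; ring.
Qed.

Lemma lincomb_mull a n (c : 'I_n -> k) (e : 'I_n -> K^o) :
  lincomb iota c (fun i => a * e i : K^o) = a * lincomb iota c e.
Proof. by rewrite /lincomb mulr_sumr; apply: eq_bigr => i _; rewrite /GRing.scale/=; ring. Qed.

Lemma dim_eq_scale a (A B : set K) n : a != 0 ->
  @dim_eq _ _ iota K^o A B n -> @dim_eq _ _ iota K^o (scale a A) (scale a B) n.
Proof.
move=> a0 [e [Ae fe se]]; exists (fun i => a * e i); split.
- by move=> i; exists (e i).
- move=> c; rewrite lincomb_mull => /(scaleP _ _ a0); rewrite mulKf//; exact: fe.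
- move=> _ [x Ax <-]; have [c hc] := se _ Ax; exists c.
  by rewrite lincomb_mull; exists (x - lincomb iota c e) => //; rewrite mulrBr.
Qed.

Lemma dim_le_scale a (A B : set K) n : a != 0 ->
  @dim_le _ _ iota K^o A B n -> @dim_le _ _ iota K^o (scale a A) (scale a B) n.
Proof.
move=> a0; apply: (@dim_le_image _ _ _ K^o K^o (fun x => a^-1 * x)).
- by move=> m c e _; rewrite -lincomb_mull.
- by move=> x /(scaleP _ _ a0).
- by move=> m c e _ /(scaleP _ _ a0).
Qed.

(** u is an entry of least valuation. *)
Lemma valuation_best R (r : seq K) : valuation_ring iota R ->
  (forall x, x \in r -> x = 0) \/
  exists u, [/\ u != 0, u \in r & forall x, x \in r -> R (x / u)].
Proof.
move=> [sR hR].
elim: r => [|x r IH]; first by left.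
have [->|x0] := eqVneq x 0.
  case: IH => [h|[u [u0 ur hu]]]; first by left=> y; rewrite inE => /orP[/eqP|/h].
  right; exists u; split=> //; first by rewrite inE ur orbT.
  by move=> y; rewrite inE => /orP[/eqP ->|/hu//]; rewrite mul0r; apply: (subalg0 sR).
right; case: IH => [h|[u [u0 ur hu]]].
  exists x; split=> //; first by rewrite inE eqxx.
  move=> y; rewrite inE => /orP[/eqP ->|/h ->].
    by rewrite mulfV//; apply: (subalg1 sR).
  by rewrite mul0r; apply: (subalg0 sR).
have [|h|h] := hR (x / u); first by rewrite mulf_neq0 ?invr_eq0.
  exists u; split=> //; first by rewrite inE ur orbT.
  by move=> y; rewrite inE => /orP[/eqP ->|/hu].
exists x; split=> //; first by rewrite inE eqxx.
move=> y; rewrite inE => /orP[/eqP ->|/hu hy]; first by rewrite mulfV//; apply: (subalg1 sR).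
have -> : y / x = (y / u) * (x / u)^-1 by field; rewrite u0.
exact: (subalgM sR).
Qed.

End Spans.

(** Lying between cP and b^-1 P stands for finite generation, which follows by [fracideal_fg]; this
    form is easier to check for products, colons and translates. *)
Definition fracideal (K : fieldType) (P M : set K) : Prop :=
  [/\ forall x y, M x -> M y -> M (x + y), forall a x, P a -> M x -> M (a * x)
    & exists c b, [/\ c != 0, b != 0, forall x, P x -> M (c * x)
                    & forall x, M x -> P (b * x)]].

Section FractionalIdeals.
Variables (k : closedFieldType) (K : fieldType) (iota : {rmorphism k -> K}).
Variable C : set (set K).
Hypothesis hC : complete_curve iota C.
Notation cp := (closed_points C).
Variables (P : set K) (cP : cp P).
Implicit Types M N : set K.

Let sP : subalgebra iota P := cp_subalg hC cP.

Lemma fracideal0 M : fracideal P M -> M 0.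
Proof.
move=> [_ _ [c [b [_ _ h _]]]]; rewrite -(mulr0 c); apply: h; exact: (subalg0 sP).
Qed.

Lemma fracideal_subspace M : fracideal P M -> @subspace _ _ iota K^o M.
Proof.
move=> fM; split; first exact: fracideal0.
move=> c x y Mx My; have [MD MZ _] := fM; apply: MD => //; apply: MZ => //.
exact: (subalg_const sP).
Qed.

Lemma fracideal_self : fracideal P P.
Proof.
split; [by move=> *; apply: (subalgD sP)|by move=> *; apply: (subalgM sP)|].
by exists 1, 1; rewrite oner_eq0; split=> // x; rewrite mul1r.
Qed.

Lemma fracideal_scale a M : a != 0 -> fracideal P M -> fracideal P (scale a M).
Proof.
move=> a0 [MD MZ [c [b [c0 b0 cM bM]]]]; split.
- by move=> _ _ [x Mx <-] [y My <-]; exists (x + y); [apply: MD|rewrite mulrDr].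
- by move=> u _ Pu [x Mx <-]; exists (u * x); [apply: MZ|rewrite mulrCA].
- exists (a * c), (b * a^-1); rewrite !mulf_neq0 ?invr_eq0//; split=> //.
    by move=> x Px; exists (c * x); [apply: cM|rewrite mulrA].
  by move=> _ [x Mx <-]; rewrite mulrA mulfVK//; apply: bM.
Qed.

Lemma fracideal_bounds M : fracideal P M -> exists c b,
  [/\ c != 0, b != 0, P c, P b & (forall x, P x -> M (c * x)) /\ (forall x, M x -> P (b * x))].
Proof.
move=> [MD MZ [c [b [c0 b0 cM bM]]]].
have [c1 [c2 [Pc1 Pc2 c20 cE]]] := cp_frac hC c cP.
have [b1 [b2 [Pb1 Pb2 b20 bE]]] := cp_frac hC b cP.
exists c1, b1; split=> //.
- by apply: contraNneq c0 => c10; rewrite cE c10 mul0r.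
- by apply: contraNneq b0 => b10; rewrite bE b10 mul0r.
- split=> x hx.
    have -> : c1 * x = c2 * (c * x) by rewrite cE; field.
    by apply: MZ => //; apply: cM.
  have -> : b1 * x = b2 * (b * x) by rewrite bE; field.
  by apply: (subalgM sP) => //; apply: bM.
Qed.

Lemma fracideal_dim M N : fracideal P M -> fracideal P N ->
  exists n, @dim_le _ _ iota K^o M N n.
Proof.
move=> /fracideal_bounds[_ [b [_ b0 _ Pb [_ bM]]]].
move=> /fracideal_bounds[c [_ [c0 _ Pc _ [cN _]]]].
have [n hn] := cp_quot hC cP (subalgM sP Pb Pc) (mulf_neq0 b0 c0); exists n.
apply: (@dim_le_image _ _ _ K^o K^o (fun x => b * x)) hn => //.
  by move=> m z e _; rewrite -lincomb_mull.
move=> m z e Me [y Py]; rewrite -mulrA => /(mulfI b0) <-; exact: cN.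
Qed.

Lemma fracideal_dim_eq M N : fracideal P M -> fracideal P N ->
  exists n, @dim_eq _ _ iota K^o M N n.
Proof.
move=> fM fN; have [n hn] := fracideal_dim fM fN.
have [m _ h] := dim_le_dim_eq (fracideal_subspace fM) (fracideal_subspace fN) hn.
by exists m.
Qed.

(* length(M/aM) does not depend on M: compare M, aM, dN, adN where dN is in M. *)
Lemma fracideal_mult M N a n : P a -> a != 0 -> fracideal P M -> fracideal P N ->
  @dim_eq _ _ iota K^o M (scale a M) n -> @dim_eq _ _ iota K^o N (scale a N) n.
Proof.
move=> Pa a0 fM fN hn.
have [c [_ [c0 _ Pc _ [cM _]]]] := fracideal_bounds fM.
have [_ [b [_ b0 _ Pb [_ bN]]]] := fracideal_bounds fN.
pose d := c * b; have d0 : d != 0 by rewrite mulf_neq0.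
have dNM : scale d N `<=` M by move=> _ [x Nx <-]; rewrite -mulrA; apply: cM; apply: bN.
have fdN := fracideal_scale d0 fN; have fadN := fracideal_scale a0 fdN.
have faM := fracideal_scale a0 fM.
have sub1 L : fracideal P L -> scale a L `<=` L.
  by move=> [_ h _] _ [x Lx <-]; apply: h.
have [p hp] := fracideal_dim_eq fM fdN.
have [q hq] := fracideal_dim_eq fdN fadN.
have e1 := dim_eq_add (fracideal_subspace fdN) (fracideal_subspace fadN) dNM (sub1 _ fdN) hp hq.
have sub2 : scale a (scale d N) `<=` scale a M.
  by move=> _ [x hx <-]; exists x => //; apply: dNM.
have e2 := dim_eq_add (fracideal_subspace faM) (fracideal_subspace fadN) (sub1 _ fM) sub2 hn (dim_eq_scale a0 hp).
have /eqP := dim_eq_uniq (fracideal_subspace fadN) e1 e2.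
rewrite addnC eqn_add2r => /eqP qn; rewrite -qn.
have dV0 : d^-1 != 0 by rewrite invr_eq0.
have := dim_eq_scale dV0 hq.
have -> : scale d^-1 (scale d N) = N by rewrite scaleA mulVf// scale1.
by have -> : scale d^-1 (scale a (scale d N)) = scale a N
  by rewrite !scaleA; congr scale; field.
Qed.

(** Generators are an element c with cP inside M and representatives of a basis of M/cP, which is
    finite-dimensional. *)
Lemma fracideal_fg M : fracideal P M -> exists t : seq K^o, M = Rspan P [set` t].
Proof.
move=> fM; have [MD MZ _] := fM; have [c [_ [c0 _ Pc _ [cM _]]]] := fracideal_bounds fM.
have [n [e [Me _ se]]] := fracideal_dim_eq fM (fracideal_scale c0 fracideal_self).
exists (c :: codom e); apply/seteqP; split.
  move=> x /se[z [y Py hy]]; rewrite -[x](subrK (lincomb iota z e)) -hy.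
  apply: (@RspanD _ K^o).
    rewrite mulrC; apply: (@RspanZ _ _ _ K^o _ _ _ _ sP) => //.
    by apply: (mem_Rspan sP); rewrite /= inE eqxx.
  rewrite /lincomb; elim/big_rec: _ => [|i u _ hu]; first exact: Rspan0.
  apply: RspanD => //; apply: (RspanZ sP); first exact: (subalg_const sP).
  by apply: (mem_Rspan sP); rewrite /= inE codom_f orbT.
apply: (@Rspan_sub _ K^o) => //; first exact: fracideal0.
move=> x /=; rewrite inE => /orP[/eqP ->|/codomP[i ->]] //.
by rewrite -[c]mulr1; apply: cM; apply: (subalg1 sP).
Qed.

(** Since P lies in R, a generator of least valuation has the least valuation on all of M. *)
Lemma fracideal_valuation R M : valuation_ring iota R -> P `<=` R -> fracideal P M ->
  exists u, [/\ u != 0, M u & forall x, M x -> R (x / u)].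
Proof.
move=> vR PR fM; have [sR hR] := vR; have [t Mt] := fracideal_fg fM.
have [c [_ [c0 _ Pc _ [cM _]]]] := fracideal_bounds fM.
have sub (Q : K -> Prop) : Q 0 -> (forall x y, Q x -> Q y -> Q (x + y)) ->
    (forall a x, P a -> Q x -> Q (a * x)) -> (forall x, x \in t -> Q x) -> M `<=` Q.
  by move=> Q0 QD QZ Qt; rewrite Mt; apply: (@Rspan_sub _ K^o).
case: (valuation_best t vR) => [t0|[u [u0 ut hu]]].
  have : M `<=` [set 0].
    apply: sub => //; first by move=> x y -> ->; rewrite addr0.
    by move=> a x _ ->; rewrite mulr0.
  have Mc : M c by rewrite -[c]mulr1; apply: cM; apply: (subalg1 sP).
  by move=> /(_ _ Mc)/eqP; rewrite (negbTE c0).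
exists u; split=> //; first by rewrite Mt; apply: (mem_Rspan sP).
apply: (sub (fun x => R (x / u))) => //.
- by rewrite mul0r; apply: (subalg0 sR).
- by move=> x y; rewrite mulrDl; apply: (subalgD sR).
- by move=> a x /PR Ra; rewrite -mulrA; apply: (subalgM sR).
Qed.

End FractionalIdeals.

Section PolyIn.
Variables (k : closedFieldType) (K : fieldType) (iota : {rmorphism k -> K}).
Variables (P : set K) (sP : subalgebra iota P).

Lemma poly_inD p q : poly_in P p -> poly_in P q -> poly_in P (p + q).
Proof. by move=> hp hq i; rewrite coefD; apply: (subalgD sP). Qed.

Lemma poly_inM p q : poly_in P p -> poly_in P q -> poly_in P (p * q).
Proof.
by move=> hp hq i; rewrite coefM; apply: (subalg_sum sP) => j _; apply: (subalgM sP).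
Qed.

Lemma poly_inC c : P c -> poly_in P c%:P.
Proof. by move=> Pc i; rewrite coefC; case: ifP => // _; apply: (subalg0 sP). Qed.

Lemma poly_inXn n : poly_in P 'X^n.
Proof.
by move=> i; rewrite coefXn; case: eqP => _; [apply: (subalg1 sP)|apply: (subalg0 sP)].
Qed.

Lemma poly_inX : poly_in P 'X. Proof. exact: (poly_inXn 1). Qed.

Lemma poly_in_comp p q : poly_in P p -> poly_in P q -> poly_in P (p \Po q).
Proof.
move=> hp hq; elim/poly_ind: p hp => [|p c IH] hp.
  by rewrite comp_poly0; apply: poly_inC; apply: (subalg0 sP).
rewrite comp_poly_MXaddC; apply: poly_inD; last first.
  apply: poly_inC; by have := hp 0%N; rewrite coefD coefMX coefC /= add0r.
apply: poly_inM => //; apply: IH => i.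
by have := hp i.+1; rewrite coefD coefMX coefC /= addr0.
Qed.

Lemma poly_in_horner p x : poly_in P p -> P x -> P p.[x].
Proof.
move=> hp Px; rewrite horner_coef; apply: (subalg_sum sP) => i _.
by apply: (subalgM sP) => //; apply: (subalgX sP).
Qed.

End PolyIn.

Definition powers (K : fieldType) (P : set K) (z : K) (n : nat) : set K :=
  [set x | exists p : {poly K}, [/\ poly_in P p, (size p <= n.+1)%N & x = p.[z]]].

(** * Integrality over local rings and constancy of regular functions *)

Section Integrality.
Variables (k : closedFieldType) (K : fieldType) (iota : {rmorphism k -> K}).
Variable C : set (set K).
Hypothesis hC : complete_curve iota C.
Notation cp := (closed_points C).

Lemma exists_transcendental : exists z, ~ range iota z.
Proof.
have [[x [tr _]] _] := hC; exists x => -[c _ xE].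
have /tr/eqP : (map_poly iota ('X - c%:P)).[x] = 0.
  by rewrite rmorphB/= map_polyX map_polyC/= hornerD hornerN hornerX hornerC xE subrr.
by rewrite polyXsubC_eq0.
Qed.

(** A nonconstant f has a pole at the place that [valuation_exists] attaches to 1/f. *)
Lemma valuation_const f :
  (forall R, valuation_ring iota R -> R <> setT -> R f) -> range iota f.
Proof.
move=> h; apply: contrapT => nf.
have [|R [vR _ nR]] := @valuation_exists _ _ iota f^-1.
  by move=> [c _ cf]; apply: nf; exists c^-1; rewrite // fmorphV cf invrK.
rewrite invrK in nR; apply: (nR); apply: h => // RT; apply: nR.
by rewrite RT.
Qed.

Lemma regular_const f : (forall P, cp P -> P f) -> range iota f.
Proof.
move=> h; apply: valuation_const => R vR RT.
by have [P cP [PR _]] := cp_dominated hC vR RT; exact: PR (h _ cP).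
Qed.

Lemma powers_fracideal P z n : cp P -> fracideal P (powers P z n).
Proof.
move=> cP; have sP := cp_subalg hC cP; split.
- move=> _ _ [p [hp sp ->]] [q [hq sq ->]]; exists (p + q); rewrite hornerD; split=> //.
    exact: (poly_inD sP).
  by rewrite (leq_trans (size_polyD _ _))// geq_max sp.
- move=> a _ Pa [p [hp sp ->]]; exists (a%:P * p); rewrite hornerM hornerC; split=> //.
    by apply: (poly_inM sP) => //; apply: (poly_inC sP).
  by rewrite mul_polyC (leq_trans (size_scale_leq _ _)).
- have [u [v [Pu Pv v0 zE]]] := cp_frac hC z cP.
  exists 1, (v ^+ n); rewrite oner_eq0 expf_neq0//; split=> //.
    move=> x Px; exists x%:P; rewrite hornerC mul1r; split=> //; first exact: (poly_inC sP).
    by rewrite size_polyC; case: eqP.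
  move=> _ [p [hp sp ->]]; rewrite (horner_coef_wide _ sp) mulr_sumr.
  apply: (subalg_sum sP) => i _.
  have -> : v ^+ n * (p`_i * z ^+ i) = p`_i * (v ^+ (n - i) * u ^+ i).
    have {1}-> : v ^+ n = v ^+ (n - i) * v ^+ i by rewrite -exprD subnK// -ltnS.
    by rewrite zE expr_div_n; field; rewrite expf_neq0.
  apply: (subalgM sP) => //; apply: (subalgM sP); exact: (subalgX sP).
Qed.

Lemma mem_powers P z n i : cp P -> (i <= n)%N -> powers P z n (z ^+ i).
Proof.
move=> cP iln; exists 'X^i; rewrite hornerXn size_polyXn; split=> //.
by apply: (poly_inXn (cp_subalg hC cP)).
Qed.

(* M = powers P z D satisfies length(M/aM) = length(P/aP) = D, so 1, z, ..., z^D satisfy a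
   polynomial relation over P with a unit coefficient; c must avoid its roots modulo m_P. *)
Lemma integral_shift P z : cp P -> ~ range iota z -> exists L : seq k, forall c, c \notin L ->
  exists D (b : nat -> K), (forall i, P (b i)) /\
    (z - iota c)^-1 ^+ D = \sum_(i < D) b i * (z - iota c)^-1 ^+ i.
Proof.
move=> cP nz; have lP := cp_local hC cP; have sP := lP.1.
have [a ma a0] := cp_elt hC cP; have Pa := max_ideal_sub ma.
have fP := fracideal_self hC cP.
have [D hD] := fracideal_dim_eq hC cP fP (fracideal_scale a0 fP).
pose M := powers P z D; have fM : fracideal P M := powers_fracideal _ _ cP.
have hM := fracideal_mult hC cP Pa a0 fP fM hD.
have hM' := dim_eq_le (fracideal_subspace hC cP (fracideal_scale a0 fM)) hM.
have [i|c [[j cj] [_ [p [hp sp ->]] hc]]] := hM' (fun i => z ^+ i).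
  by apply: mem_powers => //; rewrite -ltnS.
pose q := \poly_(i < D.+1) c (inord i).
have qi (i : 'I_D.+1) : q`_i = c i by rewrite coef_poly ltn_ord inord_val.
have q0 : q != 0.
  by apply: contraNneq cj => /(congr1 (fun r : {poly k} => r`_j)); rewrite qi coef0 => ->.
have [rs qE] := closed_field_poly_normal q.
exists rs => d nd; set w := z - iota d.
have qd : q.[d] != 0.
  by rewrite qE hornerZ mulf_neq0 ?lead_coef_eq0// -rootE root_prod_XsubC.
have w0 : w != 0.
  by rewrite subr_eq0; apply/eqP => zE; apply: nz; exists d.
pose F := map_poly iota q - a%:P * p.
have PF : poly_in P F.
  move=> i; rewrite /F coefB coefCM coef_map; apply: (subalgB sP).
    exact: (subalg_const sP).
  exact: (subalgM sP).
have sF : (size F <= D.+1)%N.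
  rewrite (leq_trans (size_polyD _ _))// size_polyN geq_max size_map_poly size_poly/=.
  by rewrite mul_polyC (leq_trans (size_scale_leq _ _)).
have Fz : F.[z] = 0.
  rewrite /F hornerD hornerN hornerM hornerC hc; apply/eqP; rewrite subr_eq0; apply/eqP.
  rewrite (@horner_coef_wide _ D.+1) ?size_map_poly ?size_poly//.
  by apply: eq_bigr => i _; rewrite coef_map qi.
have Fd : F.[iota d] = iota q.[d] - a * p.[iota d].
  by rewrite /F hornerD hornerN hornerM hornerC horner_map.
clearbody F.
(* In powers of w = z - d the relation has constant coefficient F(d), which is congruent to q(d)
   modulo a and hence a unit. Dividing by it and by w^D makes 1/w integral over P. *)
pose G := F \Po ('X + (iota d)%:P).
have PG : poly_in P G.
  apply: (poly_in_comp sP) => //; apply: (poly_inD sP); first exact: (poly_inX sP).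
  apply: (poly_inC sP); exact: (subalg_const sP).
have sG : (size G <= D.+1)%N.
  rewrite (leq_trans (size_comp_poly_leq _ _))// size_XaddC muln1.
  by case: (size F) sF.
have Gw : G.[w] = 0.
  by rewrite /G horner_comp hornerD hornerX hornerC subrK.
have G0 : G`_0 = iota q.[d] - a * p.[iota d].
  by rewrite -Fd -horner_coef0 /G horner_comp hornerD hornerX hornerC add0r.
have [G00 PGV] : G`_0 != 0 /\ P (G`_0)^-1.
  apply: unitP => // mG; have : max_ideal P (iota q.[d]).
    have -> : iota q.[d] = G`_0 + p.[iota d] * a by rewrite G0 mulrC subrK.
    apply: lP.2 => //; apply: (max_idealM sP) => //.
    by apply: (poly_in_horner sP) => //; apply: (subalg_const sP).
  by move=> /(max_ideal_const sP)/eqP; rewrite (negbTE qd).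
exists D, (fun i => - (G`_0)^-1 * G`_(D - i)); split.
  by move=> i; apply: (subalgM sP) => //; apply: (subalgN sP).
set y := w^-1; have y0 : y != 0 by rewrite invr_eq0.
have : G`_0 * y ^+ D + \sum_(i < D) G`_(D - i) * y ^+ i = 0.
  have := congr1 (fun x => x * y ^+ D) Gw.
  rewrite mul0r (horner_coef_wide _ sG) mulr_suml big_ord_recl expr0 mulr1 => h.
  rewrite -[RHS]h; congr (_ + _); rewrite [RHS](reindex_inj rev_ord_inj)/=.
  apply: eq_bigr => i _; rewrite /bump/= add1n subnSK// -mulrA; congr (_ * _).
  have -> : y ^+ D = y ^+ (D - i) * y ^+ i by rewrite -exprD subnK// ltnW.
  by rewrite mulrA -exprMn /y mulfV// expr1n mul1r.
move=> /eqP; rewrite addr_eq0 => /eqP h.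
rewrite -[LHS](mulKf G00) h mulrN -mulNr mulr_sumr.
by apply: eq_bigr => i _; rewrite mulrA.
Qed.

Lemma integral_valuation (R : set K) D (b : nat -> K) y : valuation_ring iota R ->
  (forall i, R (b i)) -> y ^+ D = \sum_(i < D) b i * y ^+ i -> R y.
Proof.
move=> vR Rb yE; have sR : subalgebra iota R by case: vR.
apply: contrapT => /(valuation_nonunit vR)[y0 my].
have Ry := max_ideal_sub my.
have : max_ideal R 1.
  have -> : 1 = (\sum_(i < D) b i * y^-1 ^+ (D - i.+1)) * y^-1.
    rewrite -(mulfV (expf_neq0 D y0)) {1}yE !mulr_suml; apply: eq_bigr => i _.
    rewrite -!mulrA -exprSr subnSK// -exprVn; congr (_ * _).
    have -> : y^-1 ^+ D = y^-1 ^+ (D - i) * y^-1 ^+ i by rewrite -exprD subnK// ltnW.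
    by rewrite mulrCA -exprMn mulfV// expr1n mulr1.
  apply: (max_idealM sR) => //; apply: (subalg_sum sR) => i _.
  by apply: (subalgM sR) => //; apply: (subalgX sR).
exact: (max_ideal1 sR).
Qed.

(** So P[y] is caught in a single fractional ideal, whatever n is. *)
Lemma integral_powers P D (b : nat -> K) y : cp P ->
  (forall i, P (b i)) -> y ^+ D = \sum_(i < D) b i * y ^+ i ->
  forall n, powers P y n `<=` powers P y D.
Proof.
move=> cP Pb yE; have sP := cp_subalg hC cP.
have [MD MZ _] := powers_fracideal y D cP.
have M0 := fracideal0 hC cP (powers_fracideal y D cP).
have Mn n : powers P y D (y ^+ n).
  elim/ltn_ind: n => n IH; have [nD|Dn] := ltnP n D.
    by apply: mem_powers => //; apply: ltnW.
  rewrite -(subnK Dn) exprD yE mulr_sumr.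
  elim/big_rec: _ => // i x _ Mx; apply: MD => //.
  rewrite mulrCA; apply: MZ => //; rewrite -exprD; apply: IH.
  by rewrite -[X in (_ < X)%N](subnK Dn) ltn_add2l.
move=> n _ [p [hp sp ->]]; rewrite horner_coef; elim/big_rec: _ => // i x _ Mx.
by apply: MD => //; apply: MZ.
Qed.

Lemma exists_notin (L : seq k) : exists c, c \notin L.
Proof.
have /closed_nonrootP[c] : \prod_(c <- L) ('X - c%:P) != 0.
  exact: monic_neq0 (monic_prod_XsubC _ _ _).
by rewrite root_prod_XsubC; exists c.
Qed.

End Integrality.

(** Torsion-free sheaves of rank one embedded in K. Equality with O_P at almost all points takes the
    place of coherence; [good_coherent] and [coherent_good] pass between the two forms. *)
Definition good_sheaf (K : fieldType) (C : set (set K)) (F : set K -> set K) : Prop :=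
  (forall P, closed_points C P -> fracideal P (F P)) /\
  finite_set [set P | closed_points C P /\ F P <> P].

Section GoodSheaves.
Variables (k : closedFieldType) (K : fieldType) (iota : {rmorphism k -> K}).
Variable C : set (set K).
Hypothesis hC : complete_curve iota C.
Notation cp := (closed_points C).
Implicit Types F : set K -> set K.

Lemma cp_finite_seq (t : seq K) :
  finite_set [set P | cp P /\ exists2 x, x \in t & ~ P x].
Proof.
apply: (@sub_finite_set _ _ (\bigcup_(x in [set` t]) [set P | cp P /\ ~ P x])).
  by move=> P [cP [x xt nx]]; exists x.
by apply: bigcup_finite => [|x _]; [exact: finite_seq|exact: cp_finite hC x].
Qed.

Lemma cp_dense P (t : seq K) : cp P ->
  exists2 b, b != 0 & P b /\ forall x, x \in t -> P (b * x).
Proof.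
move=> cP; have sP := cp_subalg hC cP; elim: t => [|x t [b b0 [Pb hb]]].
  by exists 1; rewrite ?oner_eq0//; split=> //; apply: (subalg1 sP).
have [u [v [Pu Pv v0 ->]]] := cp_frac hC x cP.
exists (b * v); first by rewrite mulf_neq0.
split; first exact: (subalgM sP).
move=> y; rewrite inE => /orP[/eqP ->|/hb hy].
  have -> : b * v * (u / v) = b * u by field.
  exact: (subalgM sP).
by rewrite mulrAC; apply: (subalgM sP).
Qed.

Lemma Rspan_full P (t : seq K) c : cp P -> c \in t -> c != 0 ->
  (forall x, x \in c^-1 :: t -> P x) -> @Rspan K K^o P [set` t] = P.
Proof.
move=> cP ct c0 h; have sP := cp_subalg hC cP; apply/seteqP; split.
  apply: (@Rspan_sub _ K^o); [exact: (subalg0 sP)|by move=> *; apply: (subalgD sP)|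
    by move=> *; apply: (subalgM sP)|].
  by move=> x xt; apply: h; rewrite inE xt orbT.
move=> x Px; have -> : x = x / c * c by field.
apply: (@RspanZ _ _ _ K^o _ _ _ _ sP); last exact: (@mem_Rspan _ _ _ K^o _ _ _ sP).
by apply: (subalgM sP) => //; apply: h; rewrite inE eqxx.
Qed.

Lemma good_coherent F : good_sheaf C F -> @coherent_sheaf K C K^o F.
Proof.
move=> [fF finF] P cP; split; last first.
  move=> v; have [_ MZ [c [_ [c0 _ cM _]]]] := fF P cP.
  have [u [w [Pu Pw w0 ->]]] := cp_frac hC v cP.
  have [c1 [c2 [Pc1 Pc2 c20 cE]]] := cp_frac hC c cP.
  exists (c1 * w); split; first exact: (subalgM (cp_subalg hC cP)).
    by rewrite mulf_neq0//; apply: contraNneq c0 => c10; rewrite cE c10 mul0r.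
  have -> : (c1 * w) *: (u / w : K^o) = c2 * (c * u).
    by rewrite /GRing.scale/= cE; field; rewrite ?w0 ?c20.
  by apply: MZ => //; apply: cM.
have [t Mt] := fracideal_fg hC cP (fF P cP).
have [_ MZ [c [_ [c0 _ cM _]]]] := fF P cP.
have sP := cp_subalg hC cP.
have Mc : F P c by rewrite -[c]mulr1; apply: cM; apply: (subalg1 sP).
have Mt' : F P = @Rspan K K^o P [set` c :: t].
  apply/seteqP; split.
    rewrite {1}Mt; apply: (@Rspan_sub _ K^o).
    - exact: Rspan0.
    - exact: (@RspanD _ K^o).
    - by move=> *; apply: (@RspanZ _ _ _ K^o _ _ _ _ sP).
    - by move=> x xt; apply: (@mem_Rspan _ _ _ K^o _ _ _ sP); rewrite /= inE xt orbT.
  apply: (@Rspan_sub _ K^o); first exact: (fracideal0 hC cP (fF P cP)).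
  - by case: (fF P cP).
  - by case: (fF P cP).
  - move=> x /=; rewrite inE => /orP[/eqP ->//|xt].
    by rewrite Mt; apply: (@mem_Rspan _ _ _ K^o _ _ _ sP).
(* Away from P the chosen generators of F P generate F Q as soon as F Q = Q contains them and c is a
   unit of Q. *)
pose U := [set Q | cp Q /\ (Q = P \/ F Q = Q /\ forall x, x \in c^-1 :: c :: t -> Q x)].
exists U; split.
- split; first by move=> Q [].
  apply: (@sub_finite_set _ _ ([set Q | cp Q /\ F Q <> Q] `|`
      [set Q | cp Q /\ exists2 x, x \in c^-1 :: c :: t & ~ Q x])).
    move=> Q [cQ nU]; have [FQ|nF] := pselect (F Q = Q); last by left.
    right; split=> //; apply: contrapT => h; apply: nU; split=> //; right; split=> //.
    by move=> x xt; apply: contrapT => nx; apply: h; exists x.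
  by rewrite finite_setU; split=> //; exact: cp_finite_seq.
- by split=> //; left.
- exists (c :: t) => Q [cQ [->//|[FQ h]]].
  by rewrite FQ (@Rspan_full Q _ c)// mem_head.
Qed.

(** Projection to a coordinate turns a coherent sheaf in V into fractional ideals, which is how
    statements about V are reduced to K. *)
Lemma coherent_good (V : vectType K) (F : set K -> set V) (l : V -> K) :
  (forall a v w, l (a *: v + w) = a * l v + l w) -> coherent_sheaf C F ->
  (exists v, l v != 0) -> good_sheaf C (fun P => [set l v | v in F P]).
Proof.
move=> hl cF [v0 lv0].
have l0 : l 0 = 0.
  by have := hl (-1) 0 0; rewrite scaler0 addr0 mulN1r addNr.
have lZ a v : l (a *: v) = a * l v by rewrite -[a *: v]addr0 hl l0 addr0.
have lD v w : l (v + w) = l v + l w by rewrite -[v]scale1r hl mul1r scale1r.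
have imE Q (s : seq V) : [set l v | v in Rspan Q [set` s]] = @Rspan K K^o Q [set` map l s].
  apply/seteqP; split.
    move=> _ [_ [m [a [u [Qa su ->]]]] <-]; exists m, a, (l \o u); split=> //.
      by move=> i /=; apply: map_f; apply: su.
    by rewrite (big_morph l lD l0); apply: eq_bigr => i _; rewrite lZ.
  move=> _ [m [a [u [Qa su ->]]]].
  have /choice[w hw] : forall i, exists w, w \in s /\ u i = l w.
    by move=> i; have /mapP[w ws ->] := su i; exists w.
  exists (\sum_i a i *: w i).
    by exists m, a, w; split=> // i; have [] := hw i.
  rewrite (big_morph l lD l0); apply: eq_bigr => i _; rewrite lZ.
  by have [_ <-] := hw i.
split.
  move=> P cP; have sP := cp_subalg hC cP.
  have [[U [_ UP [s hs]]] dF] := cF P cP.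
  rewrite (hs P UP) imE; split.
  - exact: (@RspanD _ K^o).
  - by move=> *; apply: (@RspanZ _ _ _ K^o _ _ _ _ sP).
  have [a [Pa a0 Fa]] := dF v0.
  have [b b0 [_ hb]] := cp_dense (map l s) cP.
  exists (a * l v0), b; rewrite b0 mulf_neq0//; split=> //.
    move=> x Px; rewrite mulrC; apply: (@RspanZ _ _ _ K^o _ _ _ _ sP) => //.
    by rewrite -imE -(hs P UP); exists (a *: v0) => //.
  move=> x [m [c [u [Pc su ->]]]]; rewrite mulr_sumr.
  apply: (subalg_sum sP) => i _; rewrite /GRing.scale/= mulrCA.
  by apply: (subalgM sP) => //; apply: hb; apply: su.
have [[P cP]|nP] := pselect (cp !=set0); last first.
  by apply: (@sub_finite_set _ _ set0) => // P [cP _]; apply: nP; exists P.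
have [[U [[Usub Ufin] UP [s hs]]] dF] := cF P cP.
have [c cs c0] : exists2 c, c \in map l s & c != 0.
  apply: contrapT => h; have [a [Pa a0 Fa]] := dF v0.
  have : @Rspan K K^o P [set` map l s] (a * l v0).
    by rewrite -imE -(hs P UP); exists (a *: v0).
  move=> [m [d [u [_ su]]]]; rewrite big1 => [|i _].
    by apply/eqP; rewrite mulf_neq0.
  have [->|ui0] := eqVneq (u i) 0; first by rewrite scaler0.
  by case: h; exists (u i) => //; apply: su.
apply: (@sub_finite_set _ _ ((cp `\` U) `|`
    [set Q | cp Q /\ exists2 x, x \in c^-1 :: map l s & ~ Q x])).
  move=> Q [cQ nF]; have [UQ|nU] := pselect (U Q); last by left.
  right; split=> //; apply: contrapT => h; apply: nF.
  rewrite (hs Q UQ) imE; apply: (@Rspan_full Q _ c) => // x xt.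
  by apply: contrapT => nx; apply: h; exists x.
by rewrite finite_setU; split=> //; exact: cp_finite_seq.
Qed.

Lemma good_structure : good_sheaf C (fun P => P).
Proof.
split; first by move=> P cP; apply: (fracideal_self hC cP).
by apply: (@sub_finite_set _ _ set0) => // P [].
Qed.

Lemma good_congr F G (T : set (set K)) : finite_set T -> good_sheaf C F ->
  (forall P, cp P -> ~ T P -> G P = F P) -> (forall P, cp P -> fracideal P (G P)) ->
  good_sheaf C G.
Proof.
move=> fT [fF finF] h fG; split=> //.
apply: (@sub_finite_set _ _ (T `|` [set P | cp P /\ F P <> P])).
  move=> P [cP nG]; have [TP|nT] := pselect (T P); first by left.
  by right; split=> // FP; apply: nG; rewrite h.
by rewrite finite_setU.
Qed.

Lemma H0_subspace (V : vectType K) (F : set K -> set V) :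
  (forall P, cp P -> subspace iota (F P)) -> subspace iota (global_sections C F).
Proof.
move=> sF; split=> [P cP|c x y hx hy P cP]; first by case: (sF P cP).
by have [_ h] := sF P cP; apply: h; [apply: hx|apply: hy].
Qed.

Lemma good_subspace F P : good_sheaf C F -> cp P -> @subspace _ _ iota K^o (F P).
Proof. by move=> [fF _] cP; apply: (fracideal_subspace hC cP); apply: fF. Qed.

Lemma const_dim : @dim_le _ _ iota K^o (range iota) [set 0] 1.
Proof.
apply: (@dim_le_spans _ _ _ K^o _ _ _ (fun=> 1)); first exact: subspace0.
move=> _ [c _ <-]; exists (fun=> c).
by rewrite /lincomb big_ord1 /GRing.scale/= mulr1 subrr.
Qed.

(** Each of the finitely many points where F P differs from P imposes finitely many conditions for a
    section to lie in P. The sections meeting them all are regular everywhere, hence constant. *)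
Lemma H0_finite F : good_sheaf C F ->
  exists n, @dim_le _ _ iota K^o (global_sections C (F : set K -> set K^o)) [set 0] n.
Proof.
move=> gF; have [fF /finite_seqP[T TE]] := gF.
have TP P : P \in T -> cp P /\ F P <> P.
  by move=> PT; have : [set` T] P by []; rewrite -TE.
set H := global_sections C _.
have sH : @subspace _ _ iota K^o H by apply: H0_subspace => P cP; apply: good_subspace.
have /choice[n hn] : forall P, exists n, P \in T -> @dim_le _ _ iota K^o H P n.
  move=> P; have [PT|nPT] := boolP (P \in T); last by exists 0%N.
  have [cP _] := TP P PT.
  have [n hn] := fracideal_dim hC cP (fF P cP) (fracideal_self hC cP).
  by exists n => _; apply: dim_le_mono hn => // x; apply.
have sI : forall P, P \in T -> @subspace _ _ iota K^o P.
  by move=> P /TP[cP _]; apply: subalg_subspace; apply: (cp_subalg hC cP).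
have h := dim_le_inter sH sI hn.
exists ((\sum_(i <- T) n i) + 1)%N.
apply: (dim_le_trans sH _ (@subspace0 _ _ iota K^o) h).
  apply: subspaceI => //; split=> [P PT|c x y hx hy P PT].
    by case: (sI P PT).
  by have [_ hP] := sI P PT; apply: hP; [apply: hx|apply: hy].
apply: dim_le_mono const_dim => // x [Hx hx]; apply: (regular_const hC) => P cP.
have [FP|nFP] := pselect (F P = P); first by rewrite -FP; apply: Hx.
apply: hx; suff : [set` T] P by []. by rewrite -TE.
Qed.

(** At a place R dominating P, let u have the least valuation in F P. As f u is again in F P, f = f
    u / u lies in R; so f has no pole at any place. *)
Lemma End_const F f : good_sheaf C F ->
  (forall P x, cp P -> F P x -> F P (f * x)) -> range iota f.
Proof.
move=> [fF _] h; apply: valuation_const => R vR RT.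
have [P cP [PR _]] := cp_dominated hC vR RT.
have [u [u0 Fu hu]] := fracideal_valuation hC cP vR PR (fF P cP).
by have := hu _ (h P u cP Fu); rewrite mulfK.
Qed.

(** For finitely many points, [integral_shift] supplies one c such that 1/(z - c) is integral over
    all of their local rings. A place where z - c vanishes dominates one of these points, so it
    would contain 1/(z - c). *)
Lemma cp_infinite : ~ finite_set cp.
Proof.
move=> /finite_seqP[T TE]; have [z nz] := exists_transcendental hC.
have Tcp P : P \in T -> cp P by move=> PT; have : [set` T] P by []; rewrite -TE.
have [L hL] : exists L : seq k, forall P c, P \in T -> c \notin L ->
    exists D (b : nat -> K), (forall i, P (b i)) /\
    (z - iota c)^-1 ^+ D = \sum_(i < D) b i * (z - iota c)^-1 ^+ i.
  elim: T Tcp {TE} => [|P T IH] Tcp; first by exists [::].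
  have [L hL] : exists L : seq k, forall P c, P \in T -> c \notin L ->
    exists D (b : nat -> K), (forall i, P (b i)) /\
    (z - iota c)^-1 ^+ D = \sum_(i < D) b i * (z - iota c)^-1 ^+ i.
    by apply: IH => Q QT; apply: Tcp; rewrite inE QT orbT.
  have [L' hL'] := integral_shift hC (Tcp P (mem_head _ _)) nz.
  exists (L' ++ L) => Q c; rewrite inE mem_cat negb_or => /orP[/eqP -> /andP[/hL'//]|QT /andP[_]].
  exact: hL.
have [c cL] := exists_notin L.
have [|R [vR Rz nRz]] := @valuation_exists _ _ iota (z - iota c).
  move=> [d _ dE]; apply: nz; exists (d + c) => //.
  by rewrite rmorphD dE subrK.
have [|P cP [PR _]] := cp_dominated hC vR; first by move=> RT; apply: nRz; rewrite RT.
have PT : P \in T by have : [set` T] P by rewrite -TE.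
have [D [b [Pb hb]]] := hL P c PT cL.
by apply: nRz; apply: (integral_valuation vR (fun i => PR _ (Pb i)) hb).
Qed.

Lemma exists_cp : exists P, cp P.
Proof.
apply: contrapT => h; apply: cp_infinite.
by apply: (@sub_finite_set _ _ set0) => // P cP; apply: h; exists P.
Qed.

End GoodSheaves.

(** * Duality *)

Section Forms.
Variables (k : closedFieldType) (K : fieldType) (iota : {rmorphism k -> K}).
Variable E : lmodType K.

Lemma form_lincomb (A : set E) (phi : E -> k) n (c : 'I_n -> k) (e : 'I_n -> E) :
  subspace iota A ->
  (forall a x y, A x -> A y -> phi (iota a *: x + y) = a * phi x + phi y) ->
  (forall i, A (e i)) -> phi (lincomb iota c e) = \sum_i c i * phi (e i).
Proof.
move=> sA h Ae; have phi0 : phi 0 = 0.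
  have [A0 _] := sA; have := h (-1) 0 0 A0 A0; by rewrite scaler0 addr0 mulN1r addNr.
suff [_ //] : A (lincomb iota c e) /\ phi (lincomb iota c e) = \sum_i c i * phi (e i).
rewrite /lincomb; elim/big_rec2: _ => [|i y x _ [Ax <-]]; first by case: sA.
by split; [case: sA => _; apply|rewrite h].
Qed.

Lemma dim_le_forms (A B : set E) n (phi : 'I_n -> E -> k) : subspace iota A ->
  (forall i a x y, A x -> A y -> phi i (iota a *: x + y) = a * phi i x + phi i y) ->
  (forall x, A x -> (forall i, phi i x = 0) -> B x) -> dim_le iota A B n.
Proof.
move=> sA h hB e Ae.
have [c c0 cM] := @row_kernel k n.+1 n (\matrix_(i, j) phi j (e i)) (ltnSn n).
exists (fun i => c 0 i); split; first by have /rV0Pn[i ci] := c0; exists i.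
apply: hB => [|j]; first exact: subspace_lincomb.
rewrite (form_lincomb _ sA (h j) Ae).
have := congr1 (fun M : 'rV_n => M 0 j) cM; rewrite !mxE => h0; rewrite -[RHS]h0.
by apply: eq_bigr => i _; rewrite mxE.
Qed.

End Forms.

Section LineMap.
Variables (K : fieldType) (V : vectType K) (v : V).
Definition line_map (x : K^o) : V := x *: v.
Lemma line_map_linear : linear line_map.
Proof. by move=> a x y; rewrite /line_map scalerDl scalerA. Qed.
HB.instance Definition _ :=
  GRing.isLinear.Build K K^o V *:%R line_map line_map_linear.
Definition line_hom : 'Hom(K^o, V) := linfun line_map.
Lemma line_homE (x : K^o) : line_hom x = x *: v.
Proof. by rewrite lfunE. Qed.
End LineMap.

Definition adele (K : fieldType) (C : set (set K)) (al : set K -> K^o) : Prop :=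
  finite_set [set P | closed_points C P /\ ~ P (al P)].

(** The sheaf Hom(G, F), a homomorphism between subsheaves of K being a multiplication. *)
Definition colon (K : fieldType) (F G : set K -> set K) : set K -> set K :=
  fun P => [set x | forall f, G P f -> F P (x * f)].

Definition at_point (K : fieldType) (P : set K) (x : K) : set K -> K^o :=
  fun Q => if Q == P then x else 0.

(** * Adeles and homomorphisms into omega *)

Section Adeles.
Variables (k : closedFieldType) (K : fieldType) (iota : {rmorphism k -> K}).
Variable C : set (set K).
Hypothesis hC : complete_curve iota C.
Notation cp := (closed_points C).
Implicit Types F G : set K -> set K.

(** Good sheaves agree with O at almost all points, so all of them have the same adeles. *)
Lemma adeleE F al : good_sheaf C F -> adeles C (F : set K -> set K^o) al <-> adele C al.
Proof.
move=> [_ fF]; split => h.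
  apply: (@sub_finite_set _ _ ([set P | cp P /\ F P <> P] `|` [set P | cp P /\ ~ F P (al P)])).
    move=> P [cP nP]; have [FP|nF] := pselect (F P = P); last by left.
    by right; split=> //; rewrite FP.
  by rewrite finite_setU.
apply: (@sub_finite_set _ _ ([set P | cp P /\ F P <> P] `|` [set P | cp P /\ ~ P (al P)])).
  move=> P [cP nP]; have [FP|nF] := pselect (F P = P); last by left.
  by right; split=> //; rewrite -[X in X (al P)]FP.
by rewrite finite_setU.
Qed.

Lemma adele_const x : adele C (fun=> x).
Proof. exact: cp_finite hC x. Qed.

Lemma adele_lin c al be : adele C al -> adele C be -> adele C (iota c *: al + be).
Proof.
move=> ha hb; apply: (@sub_finite_set _ _
  ([set P | cp P /\ ~ P (al P)] `|` [set P | cp P /\ ~ P (be P)])).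
  move=> P [cP nP]; have [Pa|nPa] := pselect (P (al P)); last by left.
  right; split=> // Pb; apply: nP; have sP := cp_subalg hC cP.
  by apply: (subalgD sP) => //; apply: (subalgM sP) => //; apply: (subalg_const sP).
by rewrite finite_setU.
Qed.

Lemma adele_mul x al : adele C al -> adele C (fun P => x * al P).
Proof.
move=> ha; apply: (@sub_finite_set _ _
  ([set P | cp P /\ ~ P (al P)] `|` [set P | cp P /\ ~ P x])).
  move=> P [cP nP]; have [Pa|nPa] := pselect (P (al P)); last by left.
  by right; split=> // Px; apply: nP; apply: (subalgM (cp_subalg hC cP)).
by rewrite finite_setU; split=> //; exact: cp_finite hC x.
Qed.

Lemma adele_good F al : good_sheaf C F -> (forall P, cp P -> F P (al P)) -> adele C al.
Proof.
move=> gF h; apply/(adeleE _ gF); apply: (@sub_finite_set _ _ set0) => // P [cP nP].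
by apply: nP; apply: h.
Qed.

Lemma adele_at P x : adele C (at_point P x).
Proof.
apply: (@sub_finite_set _ _ [set P]) => // Q [cQ]; rewrite /at_point.
case: eqP => // _ []; exact: (subalg0 (cp_subalg hC cQ)).
Qed.

Lemma good_colon F G : good_sheaf C F -> good_sheaf C G -> good_sheaf C (colon F G).
Proof.
move=> [fF finF] [fG finG]; split.
  move=> P cP; have [FD FZ _] := fF P cP; have [GD GZ _] := fG P cP.
  have [c [b [c0 b0 Pc Pb [cM bM]]]] := fracideal_bounds hC cP (fF P cP).
  have [c' [b' [c'0 b'0 Pc' Pb' [cM' bM']]]] := fracideal_bounds hC cP (fG P cP).
  split; first by move=> x y hx hy f Gf; rewrite mulrDl; apply: FD; [apply: hx|apply: hy].
    by move=> a x Pa hx f Gf; rewrite -mulrA; apply: FZ => //; apply: hx.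
  exists (c * b'), (b * c'); rewrite !mulf_neq0//; split=> //.
    move=> x Px f Gf; have -> : c * b' * x * f = c * (x * (b' * f)) by ring.
    by apply: cM; apply: (subalgM (cp_subalg hC cP)) => //; apply: bM'.
  move=> x hx; rewrite -mulrA [c' * x]mulrC; apply: bM; apply: hx.
  by rewrite -[c']mulr1; apply: cM'; apply: (subalg1 (cp_subalg hC cP)).
apply: (@sub_finite_set _ _ ([set P | cp P /\ F P <> P] `|` [set P | cp P /\ G P <> P])).
  move=> P [cP nP]; have [FP|nF] := pselect (F P = P); last by left.
  right; split=> // GP; apply: nP; rewrite /colon FP GP; apply/seteqP; split.
    by move=> x /(_ 1); rewrite mulr1; apply; apply: (subalg1 (cp_subalg hC cP)).
  by move=> x Px f Pf; apply: (subalgM (cp_subalg hC cP)).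
by rewrite finite_setU.
Qed.

Section InV.
Variables (V : vectType K) (omega : set K -> set V).
Hypothesis cohw : coherent_sheaf C omega.

Lemma coherent_module P : cp P -> [/\ omega P 0,
  forall v w, omega P v -> omega P w -> omega P (v + w) &
  forall a v, P a -> omega P v -> omega P (a *: v)].
Proof.
move=> cP; have [[U [_ UP [s hs]]] _] := cohw cP; rewrite (hs P UP); split.
- exact: Rspan0.
- by move=> v w; apply: RspanD.
- by move=> a v; apply: (RspanZ (cp_subalg hC cP)).
Qed.

(** Some nonzero multiple a v is a combination of local generators of omega. The same expression
    puts v in the stalk wherever 1/a and the coefficients are regular and the generators still
    generate. *)
Lemma coherent_mem v : finite_set [set P | cp P /\ ~ omega P v].
Proof.
have [P0 cP0] := exists_cp hC.
have [[U [[Usub Ufin] UP [s hs]]] /(_ v)[a [Pa a0]]] := cohw cP0.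
rewrite (hs P0 UP) => -[m [c [u [_ su vE]]]].
apply: (@sub_finite_set _ _ ((cp `\` U) `|`
    [set Q | cp Q /\ exists2 x, x \in a^-1 :: codom c & ~ Q x])).
  move=> Q [cQ nF]; have [UQ|nU] := pselect (U Q); last by left.
  right; split=> //; apply: contrapT => h; apply: nF.
  have sQ := cp_subalg hC cQ.
  have Qx x : x \in a^-1 :: codom c -> Q x.
    by move=> hx; apply: contrapT => nx; apply: h; exists x.
  rewrite (hs Q UQ); have -> : v = a^-1 *: (a *: v) by rewrite scalerA mulVf// scale1r.
  apply: (RspanZ sQ); first by apply: Qx; rewrite inE eqxx.
  rewrite vE; exists m, c, u; split=> // i.
  by apply: Qx; rewrite inE codom_f orbT.
by rewrite finite_setU; split=> //; apply: cp_finite_seq hC _.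
Qed.

(** A rank one sheaf whose multiples of the vectors vs lie in omega: it lets duality be applied to
    an arbitrary vector of V. *)
Lemma good_multipliers (vs : seq V) :
  good_sheaf C (fun P => [set f | P f /\ forall v, v \in vs -> omega P (f *: v)]).
Proof.
split.
  move=> P cP; have [w0 wD wZ] := coherent_module cP; have sP := cp_subalg hC cP.
  split.
  - move=> x y [Px hx] [Py hy]; split; first exact: (subalgD sP).
    by move=> v vv; rewrite scalerDl; apply: wD; [apply: hx|apply: hy].
  - move=> a x Pa [Px hx]; split; first exact: (subalgM sP).
    by move=> v vv; rewrite -scalerA; apply: wZ => //; apply: hx.
  have [c [Pc c0 hc]] : exists c, [/\ P c, c != 0 & forall v, v \in vs -> omega P (c *: v)].
    elim: vs => [|v vs' [c [Pc c0 hc]]].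
      by exists 1; rewrite oner_eq0; split=> //; apply: (subalg1 sP).
    have [_ /(_ v)[a [Pa a0 hv]]] := cohw cP.
    exists (c * a); rewrite mulf_neq0//; split=> //; first exact: (subalgM sP).
    move=> w; rewrite inE => /orP[/eqP ->|/hc hw]; first by rewrite -scalerA; apply: wZ.
    by rewrite mulrC -scalerA; apply: wZ.
  exists c, 1; rewrite oner_eq0; split=> // x; last by move=> [Px _]; rewrite mul1r.
  move=> Px; split; first exact: (subalgM sP).
  by move=> v vv; rewrite mulrC -scalerA; apply: wZ => //; apply: hc.
apply: (@sub_finite_set _ _ (\bigcup_(v in [set` vs]) [set P | cp P /\ ~ omega P v])).
  move=> P [cP nP]; apply: contrapT => h; apply: nP; apply/seteqP; split; first by move=> x [].
  move=> x Px; split=> // v vv; have [w0 wD wZ] := coherent_module cP.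
  apply: wZ => //; apply: contrapT => nv; apply: h; exists v => //.
by apply: bigcup_finite => [|v _]; [exact: finite_seq|exact: coherent_mem].
Qed.

(** Hom(F, omega): a homomorphism from a subsheaf of K is determined by the vector to which 1 is
    sent generically. *)
Definition hom_sections F : set V :=
  [set v | forall P f, cp P -> F P f -> omega P (f *: v)].

Lemma hom_sections_subspace F : subspace iota (hom_sections F).
Proof.
split=> [P f cP _|c v w hv hw P f cP Ff].
  by rewrite scaler0; case: (coherent_module cP).
have [w0 wD wZ] := coherent_module cP.
rewrite scalerDr; apply: wD; last exact: hw.
rewrite scalerA mulrC -scalerA; apply: wZ; last exact: hv.
exact: (subalg_const (cp_subalg hC cP)).
Qed.

(** Each coordinate of such a vector is a global section of Hom(F, G), where G is the corresponding
    coordinate image of omega, and H^0 of a good sheaf is finite-dimensional. *)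
Lemma hom_sections_finite F : good_sheaf C F ->
  exists n, dim_le iota (hom_sections F) [set 0] n.
Proof.
move=> gF; pose b := vbasis {: V}; have cb := coord_vbasis (memvf (_ : V)).
have cl i a v w : coord b i (a *: v + w) = a * coord b i v + coord b i w.
  by rewrite linearP.
have gw i : good_sheaf C (fun P => [set coord b i v | v in omega P]).
  apply: (coherent_good hC (cl i) cohw); exists (b`_i).
  by rewrite coord_free ?eqxx ?oner_eq0//; apply: (basis_free (vbasisP _)).
have /choice[n hn] : forall i, exists n,
    dim_le iota (hom_sections F) [set v | coord b i v = 0] n.
  move=> i; have [n hn] := H0_finite hC (good_colon (gw i) gF); exists n.
  apply: (@dim_le_image _ _ _ V K^o (coord b i)) hn => //.
  - by move=> m c e _; rewrite /lincomb linear_sum; apply: eq_bigr => j _; rewrite linearZ.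
  - move=> v hv P cP f Ff /=; exists (f *: v); first exact: hv.
    by rewrite linearZ/= mulrC.
have sI (i : 'I_(\dim {: V})) : subspace iota [set v | coord b i v = 0].
  split; first by rewrite /= linear0.
  by move=> c v w /= hv hw; rewrite cl hv hw mulr0 addr0.
have := dim_le_inter (T := enum 'I_(\dim {: V})) (hom_sections_subspace F)
  (fun i _ => sI i) (fun i _ => hn i).
move=> h; exists (\sum_(i <- enum 'I_(\dim {: V})) n i)%N; apply: dim_le_mono h => //.
move=> v [_ hv]; rewrite /= (cb v) big1// => i _.
by rewrite hv ?scale0r// mem_enum.
Qed.

End InV.
End Adeles.

(** * Reduction of the dualizing sheaf to rank one *)

Section Duality.
Variables (k : closedFieldType) (K : fieldType) (iota : {rmorphism k -> K}).
Variable C : set (set K).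
Hypothesis hC : complete_curve iota C.
Notation cp := (closed_points C).
Implicit Types F G : set K -> set K.

(** The form in which duality is used from here on. The second clause makes t a form on H^1(w); the
    third says that a class of H^1(F) killed by all of Hom(F, w) is zero; the fourth is the
    nondegeneracy of t in the multiplier. *)
Definition canonical_sheaf (w : set K -> set K) (t : (set K -> K^o) -> k) : Prop :=
  [/\ good_sheaf C w,
      [/\ forall c al be, adele C al -> adele C be -> t (iota c *: al + be) = c * t al + t be,
          forall x, t (fun=> x) = 0
        & forall al, (forall P, cp P -> w P (al P)) -> t al = 0],
      forall F al, good_sheaf C F -> adele C al ->
        (forall h, (forall P f, cp P -> F P f -> w P (h * f)) -> t (fun P => h * al P) = 0) ->
        exists x, forall P, cp P -> F P (al P - x)
    & forall h, (forall al, adele C al -> t (fun P => h * al P) = 0) -> h = 0].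

Variables (V : vectType K) (omega : set K -> set V).
Hypothesis cohw : coherent_sheaf C omega.
Variable tr : (set K -> V) -> k.
Hypothesis trH : H1_form iota C omega tr.
Hypothesis dual : forall (W : vectType K) (F : set K -> set W), coherent_sheaf C F ->
  forall lam, H1_form iota C F lam ->
    exists! h : 'Hom(W, V),
      (forall P, cp P -> forall w, F P w -> omega P (h w)) /\
      (forall al, adeles C F al -> lam al = tr (fun P => h (al P))).

Lemma adele_coherent al v : adele C al -> adeles C omega (fun P => al P *: v).
Proof.
move=> ha; apply: (@sub_finite_set _ _
    ([set P | cp P /\ ~ P (al P)] `|` [set P | cp P /\ ~ omega P v])).
  move=> P [cP nP]; have [Pa|nPa] := pselect (P (al P)); last by left.
  right; split=> // Pv; apply: nP.
  by have [_ _ wZ] := coherent_module hC cohw cP; apply: wZ.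
by rewrite finite_setU; split=> //; exact: (coherent_mem hC cohw).
Qed.

Lemma tr_lin c al be v : adele C al -> adele C be ->
  tr (fun P => (iota c *: al + be) P *: v) =
  c * tr (fun P => al P *: v) + tr (fun P => be P *: v).
Proof.
move=> ha hb; have [trD _ _] := trH.
rewrite -trD; try exact: adele_coherent.
congr tr; apply/funext => P; rewrite /= !fctE.
by rewrite scalerDl scalerA.
Qed.

Lemma tr_linv c al v w : adele C al ->
  tr (fun P => al P *: (iota c *: v + w)) =
  c * tr (fun P => al P *: v) + tr (fun P => al P *: w).
Proof.
move=> ha; have [trD _ _] := trH.
rewrite -trD; try exact: adele_coherent.
by congr tr; apply/funext => P; rewrite /= !fctE scalerDr !scalerA mulrC.
Qed.

Lemma form_hom F (lam : (set K -> K^o) -> k) : good_sheaf C F ->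
  H1_form iota C (F : set K -> set K^o) lam ->
  exists2 v, hom_sections C omega F v &
    forall al, adele C al -> lam al = tr (fun P => al P *: v).
Proof.
move=> gF /(dual (good_coherent hC gF))[h [[hF hlam] _]].
exists (h 1) => [P f cP Ff|al ha].
  by rewrite -linearZ /= /GRing.scale/= mulr1; apply: hF.
rewrite hlam; last by apply/adeleE.
by congr tr; apply/funext => P; rewrite -linearZ /= /GRing.scale/= mulr1.
Qed.

(** On the sheaf of multipliers of v, both v and 0 represent the zero form, and representatives are
    unique. *)
Lemma hom_uniq v : (forall al, adele C al -> tr (fun P => al P *: v) = 0) -> v = 0.
Proof.
move=> h; have gF := good_multipliers hC cohw [:: v].
set F := (F in good_sheaf C F) in gF.
have lam0 : H1_form iota C (F : set K -> set K^o) (fun=> 0).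
  by split=> // c al be _ _; rewrite mulr0 addr0.
have [h0 [_ uniq]] := dual (good_coherent hC gF) lam0.
have e1 : h0 = line_hom v.
  apply: uniq; split=> [P cP f [_ Ff]|al ha].
    by rewrite line_homE; apply: Ff; rewrite inE.
  rewrite -(h al); last by apply/(adeleE _ gF).
  by congr tr; apply/funext => P; rewrite line_homE.
have e2 : h0 = 0.
  apply: uniq; split=> [P cP f _|al ha].
    by rewrite zero_lfunE; case: (coherent_module hC cohw cP).
  have [_ tr0 _] := trH; rewrite -(tr0 0); congr tr.
  by apply/funext => P; rewrite zero_lfunE.
by have := congr1 (fun h : 'Hom(K^o, V) => h 1) e2; rewrite e1 line_homE zero_lfunE scale1r.
Qed.

(** If al were nonzero in H^1(F), some linear form would vanish on K and on the product of the
    stalks of F and be 1 at al. By duality this form comes from a vector of Hom(F, omega). *)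
Lemma form_separates F al : good_sheaf C F -> adele C al ->
  (forall v, hom_sections C omega F v -> tr (fun P => al P *: v) = 0) ->
  exists x, forall P, cp P -> F P (al P - x).
Proof.
move=> gF ha h; pose N := [set be : set K -> K^o | exists x, forall P, cp P -> F P (be P - x)].
apply: contrapT => na.
have sN : subspace iota N.
  split; first by exists 0 => P cP; rewrite subr0; case: (good_subspace hC gF cP).
  move=> c be ga [x hx] [y hy]; exists (iota c * x + y) => P cP.
  have [_ sF] := good_subspace hC gF cP.
  suff -> : (iota c *: be + ga) P - (iota c * x + y) =
      iota c *: (be P - x : K^o) + (ga P - y) by apply: sF; [apply: hx|apply: hy].
  by rewrite !fctE scalerBr opprD addrACA.
have [lam [lamD lamN lama]] := separating_form sN na.
have [|v hv hlam] := @form_hom F lam gF.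
  split=> [c be ga _ _|x|be hb]; first exact: lamD.
    by apply: lamN; exists x => P cP; rewrite subrr; case: (good_subspace hC gF cP).
  by apply: lamN; exists 0 => P cP; rewrite subr0; apply: hb.
by move: lama; rewrite hlam// h// => /eqP; rewrite eq_sym oner_eq0.
Qed.

(** For a in m_Q this is the twist F(-D), where D is the divisor of a at Q; powers of a, also
    negative ones, give the multiples of D. *)
Definition shrink (Q : set K) (a : K) (F : set K -> set K) : set K -> set K :=
  fun P => if P == Q then scale a (F P) else F P.

Lemma good_shrink Q a F : a != 0 -> good_sheaf C F -> good_sheaf C (shrink Q a F).
Proof.
move=> a0 gF; apply: (@good_congr _ _ F _ [set Q]) => //.
- by move=> P _ nQ; rewrite /shrink; case: eqP.
- move=> P cP; have [fF _] := gF; rewrite /shrink; case: eqP => _; last exact: fF.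
  by apply: fracideal_scale => //; apply: fF.
Qed.

(** If V were 0, every H^1 would vanish, including that of O(-2D) with D the divisor of a at Q. Then
    a - x would lie in a^2 O_Q for some x regular elsewhere; such an x is a constant vanishing at Q,
    and a would be in a^2 O_Q. *)
Lemma omega_neq0 : exists v : V, v != 0.
Proof.
apply: contrapT => h; have v0 (v : V) : v = 0.
  by apply: contrapT => /eqP v0; apply: h; exists v.
have [Q cQ] := exists_cp hC; have [a ma a0] := cp_elt hC cQ.
have sQ := cp_subalg hC cQ.
pose F := shrink Q (a ^+ 2) (fun P => P).
have gF : good_sheaf C F by apply: good_shrink; rewrite ?expf_neq0//; exact: (good_structure hC).
have [|x hx] := form_separates gF (adele_at hC Q a).
  move=> v _; have [_ tr0 _] := trH; rewrite -(tr0 0); congr tr.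
  by apply/funext => P; rewrite [v]v0 scaler0.
have hQ : scale (a ^+ 2) Q (a - x).
  by have := hx Q cQ; rewrite /F /shrink /at_point eqxx.
have ma2 y : scale (a ^+ 2) Q y -> max_ideal Q y.
  move=> [z Qz <-]; rewrite expr2 -mulrA mulrC; apply: (max_idealM sQ) => //.
  by apply: (subalgM sQ) => //; apply: max_ideal_sub ma.
have lQ := cp_local hC cQ.
have mx : max_ideal Q x.
  have -> : x = a - (a - x) by ring.
  by apply: (max_idealB lQ) => //; apply: ma2.
have [c _ xc] : range iota x.
  apply: (regular_const hC) => P cP; have [->|/negbTE PQ] := eqVneq P Q.
    exact: max_ideal_sub mx.
  have := hx P cP; rewrite /F /shrink /at_point PQ sub0r => /(subalgN (cp_subalg hC cP)).
  by rewrite opprK.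
move: mx hQ; rewrite -xc => /(max_ideal_const sQ) ->; rewrite rmorph0 subr0.
move=> [y Qy]; rewrite expr2 -mulrA -[RHS]mulr1 => /(mulfI a0) ay.
by apply: (max_ideal1 sQ); rewrite -ay mulrC; apply: (max_idealM sQ).
Qed.

Lemma hom_sections_tr F : good_sheaf C F -> forall al v, hom_sections C omega F v ->
  (forall P, cp P -> F P (al P)) -> tr (fun P => al P *: v) = 0.
Proof.
by move=> gF al v hv ha; have [_ _ tr0] := trH; apply: tr0 => P cP; apply: hv; [|apply: ha].
Qed.

Lemma dim_eq_pow Q a (F : set K) e : cp Q -> Q a -> a != 0 -> fracideal Q F ->
  @dim_eq _ _ iota K^o Q (scale a Q) e ->
  forall m, @dim_eq _ _ iota K^o F (scale (a ^+ m) F) (m * e).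
Proof.
move=> cQ Qa a0 fF he; have sQ := cp_subalg hC cQ.
elim=> [|m IH].
  rewrite expr0 scale1 mul0n; exists (fun=> 0); split=> [[]|c _ []|x Fx] //.
  by exists (fun=> 0); rewrite /lincomb big_ord0 subr0.
rewrite mulSn addnC.
have am0 : a ^+ m != 0 by rewrite expf_neq0.
have fs n := fracideal_scale (expf_neq0 n a0) fF.
apply: (dim_eq_add (fracideal_subspace hC cQ (fs m)) (fracideal_subspace hC cQ (fs m.+1))) => //.
- by move=> _ [x Fx <-]; have [_ FZ _] := fF; apply: FZ => //; apply: (subalgX sQ).
- move=> _ [x Fx <-]; exists (a * x); last by rewrite mulrA exprSr.
  by have [_ FZ _] := fF; apply: FZ.
- rewrite exprSr -scaleA; apply: dim_eq_scale => //.
  exact: (fracideal_mult hC cQ Qa a0 (fracideal_self hC cQ) fF he).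
Qed.


Lemma dim_quot_pos Q a e : cp Q -> max_ideal Q a ->
  @dim_eq _ _ iota K^o Q (scale a Q) e -> (0 < e)%N.
Proof.
move=> cQ ma; case: e => // -[e [_ _ /(_ 1)[|c]]].
  exact: (subalg1 (cp_subalg hC cQ)).
rewrite /lincomb big_ord0 subr0 => -[y Qy ay1].
case: (max_ideal1 (cp_subalg hC cQ)); rewrite -ay1 mulrC.
exact: (max_idealM (cp_subalg hC cQ)).
Qed.

Lemma at_point_lin Q c x y :
  at_point Q (iota c *: (x : K^o) + y) = iota c *: at_point Q x + at_point Q y.
Proof.
apply/funext => P; rewrite !fctE /at_point; case: eqP => _ //.
by rewrite scaler0 addr0.
Qed.

Lemma tr_at_lin Q v c x y :
  tr (fun P => at_point Q (iota c *: (x : K^o) + y) P *: v) =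
  c * tr (fun P => at_point Q x P *: v) + tr (fun P => at_point Q y P *: v).
Proof. by rewrite at_point_lin tr_lin //; apply: (adele_at hC). Qed.

(* h^0(O(mD)) grows at least like deg(mD), where D is the divisor of a at Q. *)
Lemma pole_sections Q a e : cp Q -> max_ideal Q a -> a != 0 ->
  @dim_eq _ _ iota K^o Q (scale a Q) e ->
  exists g, forall m l,
    @dim_eq _ _ iota K^o (global_sections C (shrink Q (a ^- m) (fun P => P) : set K -> set K^o))
      [set 0] l -> (m * e <= g + l)%N.
Proof.
move=> cQ ma a0 he; have sQ := cp_subalg hC cQ.
have gO := good_structure hC; have [n hn] := hom_sections_finite hC cohw gO.
have [g _ [w [Ow _ spw]]] := dim_le_dim_eq (hom_sections_subspace hC cohw _) (@subspace0 _ _ iota V) hn.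
exists g => m l hl; set L := global_sections C _ in hl.
have am0 : a ^- m != 0 by rewrite invr_eq0 expf_neq0.
have gL := good_shrink Q am0 gO.
have sL : @subspace _ _ iota K^o L by apply: H0_subspace => P cP; apply: (good_subspace hC gL).
pose A := scale (a ^- m) Q.
have sA : @subspace _ _ iota K^o A by apply: scale_subspace; apply: subalg_subspace.
have QA : Q `<=` A.
  move=> x Qx; apply/(scaleP _ _ am0); rewrite invrK; apply: (subalgM sQ) => //.
  by apply: (subalgX sQ); apply: max_ideal_sub ma.
have hA : @dim_eq _ _ iota K^o A Q (m * e).
  have := dim_eq_scale am0 (dim_eq_pow cQ (max_ideal_sub ma) a0 (fracideal_self hC cQ) he m).
  by rewrite scaleA mulVf ?scale1 ?expf_neq0.
apply: (dim_eq_leq (subalg_subspace sQ) hA).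
(* B holds the polar parts at Q realized by global sections. A/B embeds in H^1(O), which is dual to
   the span of the g vectors w_i, and B/Q is the image of the l-dimensional L. *)
pose B := [set f : K^o | A f /\ exists2 x, L x & Q (f - x)].
have sB : subspace iota B.
  split.
    split; first by case: sA.
    by exists 0; [case: sL|rewrite subr0; apply: (subalg0 sQ)].
  move=> c f h [Af [x Lx Qx]] [Ah [y Ly Qy]]; split; first by have [_] := sA; apply.
  exists (iota c * x + y); first by have [_] := sL; apply.
  have -> : iota c *: f + h - (iota c * x + y) = iota c * (f - x) + (h - y).
    by rewrite /GRing.scale/=; ring.
  by apply: (subalgD sQ) => //; apply: (subalgM sQ) => //; apply: (subalg_const sQ).
apply: (dim_le_trans sA sB (subalg_subspace sQ)).
  apply: (@dim_le_forms _ _ iota K^o A B g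
     (fun i f => tr (fun P => at_point Q f P *: w i))) => // [i c x y _ _|f Af hf].
    exact: tr_at_lin.
  split=> //; have [|x hx] := form_separates gO (adele_at hC Q f).
    move=> v hv; have [c /= /eqP] := spw v hv; rewrite subr_eq0 => /eqP ->.
    rewrite (@form_lincomb _ _ iota V setT (fun v => tr (fun P => at_point Q f P *: v)))//.
      by rewrite big1// => i _; rewrite hf mulr0.
    by move=> b u u' _ _; apply: tr_linv; apply: (adele_at hC).
  have hxQ : Q (f - x) by have := hx Q cQ; rewrite /at_point eqxx.
  exists x => // P cP; rewrite /shrink; case: eqP => [->|/eqP/negbTE PQ].
    have -> : x = f - (f - x) by ring.
    by apply: (@subspaceB _ _ iota K^o) => //; apply: QA.
  have := hx P cP; rewrite /at_point PQ sub0r => /(subalgN (cp_subalg hC cP)).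
  by rewrite opprK.
move=> f hf; have /choice[x hx] : forall i, exists x, L x /\ Q (f i - x).
  by move=> i; have [_ [x Lx Qx]] := hf i; exists x.
have hl' := dim_eq_le (@subspace0 _ _ iota K^o) hl.
have [i|c [c0 hc]] := hl' x.
  by have [] := hx i.
exists c; split=> //; have <- : lincomb iota c (fun i => f i - x i : K^o) = lincomb iota c f.
  by rewrite lincombBr hc subr0.
by apply: (@subspace_lincomb _ _ iota K^o) => [|i]; [exact: subalg_subspace|have [] := hx i].
Qed.

(* h^1(O(-mD)) grows at most like deg(mD). *)
Lemma hom_sections_growth Q a e F m : cp Q -> max_ideal Q a -> a != 0 ->
  @dim_eq _ _ iota K^o Q (scale a Q) e -> good_sheaf C F ->
  dim_le iota (hom_sections C omega (shrink Q (a ^+ m) F)) (hom_sections C omega F) (m * e).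
Proof.
move=> cQ ma a0 he gF; have [fF _] := gF.
have am0 : a ^+ m != 0 by rewrite expf_neq0.
have gFm := good_shrink Q am0 gF.
have [eps [Feps _ speps]] := dim_eq_pow cQ (max_ideal_sub ma) a0 (fF Q cQ) he m.
apply: (@dim_le_forms _ _ iota V _ _ _
  (fun i v => tr (fun P => at_point Q (eps i) P *: v))).
- exact: hom_sections_subspace.
- by move=> i c u v _ _; apply: tr_linv; apply: (adele_at hC).
move=> v hv hphi.
(* When all these forms vanish at v, the functional of v kills the stalks of F and not only those of
   F(-mD). Duality then shows that v maps F itself into omega. *)
have [|v' hv' hvv] := @form_hom F (fun al => tr (fun P => al P *: v)) gF.
  split=> [c al be /(adeleE _ gF) ha /(adeleE _ gF) hb|x|be hb].
  - exact: tr_lin.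
  - by have [_ tr0 _] := trH; apply: tr0.
  have [c hc] := speps _ (hb Q cQ).
  pose y := lincomb iota c eps.
  pose be' := iota (-1) *: at_point Q y + be.
  have hbe : be = iota 1 *: at_point Q y + be'.
    by rewrite /be' rmorphN rmorph1 scaleN1r scale1r addrA subrr add0r.
  have hbe' P : cp P -> shrink Q (a ^+ m) F P (be' P).
    move=> cP; rewrite /shrink /be' !fctE rmorphN1 scaleN1r /at_point.
    case: eqP => [->|_]; first by rewrite addrC; exact: hc.
    by rewrite oppr0 add0r; apply: hb.
  rewrite hbe tr_lin; [|exact: (adele_at hC)|exact: adele_good gFm hbe'].
  rewrite (hom_sections_tr gFm hv hbe') addr0 mul1r.
  rewrite (@form_lincomb _ _ iota K^o setT (fun f => tr (fun P => at_point Q f P *: v)))//.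
    by rewrite big1// => i _; rewrite hphi mulr0.
  by move=> b u u' _ _; apply: tr_at_lin.
suff -> : v = v' by [].
apply/eqP; rewrite -subr_eq0; apply/eqP; apply: hom_uniq => al ha.
have -> : v - v' = iota (-1) *: v' + v by rewrite rmorphN1 scaleN1r addrC.
by rewrite tr_linv// -hvv// mulN1r addNr.
Qed.

(** If v1 and v2 were independent, a basis of H^0(O(mD)) multiplied into both would give 2 (m e - g)
    independent elements of Hom(F(-mD), omega). Its dimension is at most m e + n0, a contradiction
    for large m. *)
Lemma omega_rank1 (v1 v2 : V) : v1 != 0 -> exists f, v2 = f *: v1.
Proof.
move=> v10; apply: contrapT => nf.
have free2 f1 f2 : f1 *: v1 + f2 *: v2 = 0 -> f1 = 0 /\ f2 = 0.
  move=> h; have f20 : f2 = 0.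
    apply: contrapT => /eqP f20; apply: nf; exists (- f2^-1 * f1).
    move/eqP: h; rewrite addrC addr_eq0 => /eqP h.
    by rewrite mulNr scaleNr -scalerA -scalerN -h scalerA mulVf// scale1r.
  by move/eqP: h; rewrite f20 scale0r addr0 scaler_eq0 (negbTE v10) orbF => /eqP.
have [Q cQ] := exists_cp hC; have [a ma a0] := cp_elt hC cQ.
have sQ := cp_subalg hC cQ; have Qa := max_ideal_sub ma.
have fQ := fracideal_self hC cQ.
have [e he] := fracideal_dim_eq hC cQ fQ (fracideal_scale a0 fQ).
have e0 := dim_quot_pos cQ ma he.
have [g hg] := pole_sections cQ ma a0 he.
have gF := good_multipliers hC cohw [:: v1; v2]; set F := (F in good_sheaf C F) in gF.
have [n0 hn0] := hom_sections_finite hC cohw gF.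
(* From 2 (m e - g) <= m e + n0 one gets m <= m e <= 2 g + n0. *)
pose m := (2 * g + n0).+1.
have gO := good_structure hC.
have am0 : a ^- m != 0 by rewrite invr_eq0 expf_neq0.
have gL := good_shrink Q am0 gO; set L := shrink Q (a ^- m) _ in gL.
have [n hn] := H0_finite hC gL.
have sL : @subspace _ _ iota K^o (global_sections C (L : set K -> set K^o)).
  by apply: H0_subspace => P cP; apply: (good_subspace hC gL).
have [l _ hl] := dim_le_dim_eq sL (@subspace0 _ _ iota K^o) hn.
have h1 := hg m l hl; have [x [Lx fx _]] := hl.
have h2 : dim_le iota (hom_sections C omega (shrink Q (a ^+ m) F)) [set 0] (m * e + n0).
  have hg0 := hom_sections_growth (m := m) cQ ma a0 he gF.
  apply: dim_le_trans hg0 hn0;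
    [exact: hom_sections_subspace|exact: hom_sections_subspace|exact: subspace0].
have hin v i : v \in [:: v1; v2] -> hom_sections C omega (shrink Q (a ^+ m) F) (x i *: v).
  move=> vv P h cP; have [_ _ wZ] := coherent_module hC cohw cP.
  have := Lx i P cP; rewrite /L /shrink; case: eqP => [PQ|_] Lxi.
    move=> [h0 [_ hh0] <-]; rewrite scalerA.
    have -> : a ^+ m * h0 * x i = (a ^+ m * x i) * h0 by ring.
    rewrite -scalerA; apply: wZ; last exact: hh0.
    by move: Lxi => /(scaleP _ _ am0); rewrite invrK PQ.
  by move=> [_ hh]; rewrite scalerA mulrC -scalerA; apply: wZ => //; apply: hh.
pose xv (v : V) (i : 'I_l) : V := (x i : K) *: v.
have h3 : (l + l <= m * e + n0)%N.
  apply: (free_le (e := cat_fun (xv v1) (xv v2)) _ _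
  (@subspace0 _ _ iota V) h2).
  - apply: (cat_fun_prop (P := hom_sections C omega (shrink Q (a ^+ m) F))) => i;
    by apply: hin; rewrite !inE eqxx ?orbT.
  - move=> c; rewrite lincomb_cat.
    have lE (d : 'I_l -> k) v : lincomb iota d (xv v) = lincomb iota d x *: v.
      rewrite /lincomb scaler_suml; apply: eq_bigr => i _.
      by rewrite scalerA.
    rewrite !lE => /free2[/fx c1 /fx c2] i.
    by case: (split_ordP i) => j ->.
have : (m <= m * e)%N by rewrite leq_pmulr.
rewrite /m in h1 h3 *; lia.
Qed.

Lemma canonical_exists : exists v0, [/\ v0 != 0, forall v, exists f, v = f *: v0 &
  canonical_sheaf (fun P => [set f | omega P (f *: v0)]) (fun al => tr (fun P => al P *: v0))].
Proof.
have [v0 v00] := omega_neq0; exists v0; split=> //.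
  by move=> v; apply: omega_rank1.
have /choice[c hc] : forall v, exists f, v = f *: v0 by move=> v; apply: omega_rank1.
have cinj f g : f *: v0 = g *: v0 -> f = g.
  move=> /eqP; rewrite -subr_eq0 -scalerBl scaler_eq0 (negbTE v00) orbF subr_eq0.
  by move/eqP.
have wE P : [set f | omega P (f *: v0)] = [set c v | v in omega P].
  apply/seteqP; split=> [f hf|_ [v hv <-]]; last by rewrite /= -hc.
  by exists (f *: v0) => //; apply: cinj; rewrite -hc.
split.
- rewrite (_ : (fun P => _) = (fun P => [set c v | v in omega P])); last exact/funext.
  apply: (coherent_good hC _ cohw); last first.
    by exists v0; apply: contraNneq v00 => c0; rewrite (hc v0) c0 scale0r.
  by move=> a v w; apply: cinj; rewrite -hc scalerDl -scalerA -!hc.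
- split.
  + by move=> b al be ha hb; apply: tr_lin.
  + by move=> x; have [_ h _] := trH; apply: h.
  + by move=> al h; have [_ _ h'] := trH; apply: h'.
- move=> F al gF ha h; apply: form_separates => // v hv.
  rewrite (hc v) -[RHS](h (c v)) => [|P f cP Ff].
    by congr tr; apply/funext => P; rewrite scalerA mulrC.
  by rewrite /= mulrC -scalerA -hc; apply: hv.
- move=> x h; suff /eqP : x *: v0 = 0 by rewrite scaler_eq0 (negbTE v00) orbF => /eqP.
  apply: hom_uniq => al ha; rewrite -[RHS](h al ha).
  by congr tr; apply/funext => P; rewrite scalerA mulrC.
Qed.

End Duality.

(** * Products and hyperelliptic curves *)

Definition prodset (K : fieldType) (A B : set K) : set K :=
  [set x | exists m (a b : 'I_m -> K),
     [/\ forall i, A (a i), forall i, B (b i) & x = \sum_i a i * b i]].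

Section Products.
Variable K : fieldType.
Implicit Types A B D : set K.

Lemma prodset_sub A B D : D 0 -> (forall x y, D x -> D y -> D (x + y)) ->
  (forall a b, A a -> B b -> D (a * b)) -> prodset A B `<=` D.
Proof.
move=> D0 DD DM _ [m [a [b [Aa Bb ->]]]].
by elim/big_rec: _ => // i x _ Dx; apply: DD => //; apply: DM.
Qed.

Lemma prodset_mem A B a b : A a -> B b -> prodset A B (a * b).
Proof. by move=> Aa Bb; exists 1%N, (fun=> a), (fun=> b); split=> //; rewrite big_ord1. Qed.

Lemma prodset0 A B : prodset A B 0.
Proof. by exists 0%N, (fun=> 0), (fun=> 0); split=> [[]|[]|]//; rewrite big_ord0. Qed.

Lemma prodsetD A B x y : prodset A B x -> prodset A B y -> prodset A B (x + y).
Proof.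
move=> [m [a [b [Aa Bb ->]]]] [n [c [d [Ac Bd ->]]]].
exists (m + n)%N, (cat_fun a c), (cat_fun b d); split.
- exact: (cat_fun_prop (P := A)).
- exact: (cat_fun_prop (P := B)).
- by rewrite big_split_ord; congr (_ + _); apply: eq_bigr => i _; rewrite ?cat_funl ?cat_funr.
Qed.

Lemma prodset_mull A B c x : (forall a, A a -> A (c * a)) -> prodset A B x -> prodset A B (c * x).
Proof.
move=> hA [m [a [b [Aa Bb ->]]]]; exists m, (fun i => c * a i), b; split=> //.
  by move=> i; apply: hA.
by rewrite mulr_sumr; apply: eq_bigr => i _; rewrite mulrA.
Qed.

Lemma prodset_mono A A' B B' : A `<=` A' -> B `<=` B' -> prodset A B `<=` prodset A' B'.
Proof.
by move=> AA BB _ [m [a [b [Aa Bb ->]]]]; exists m, a, b; split=> // i; [apply: AA|apply: BB].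
Qed.

End Products.

Section LocalModules.
Variables (k : closedFieldType) (K : fieldType) (iota : {rmorphism k -> K}).
Variable C : set (set K).
Hypothesis hC : complete_curve iota C.
Notation cp := (closed_points C).
Implicit Types P M N H : set K.

Lemma fracideal_prod P M N : cp P -> fracideal P M -> fracideal P N -> fracideal P (prodset M N).
Proof.
move=> cP fM fN; have sP := cp_subalg hC cP.
have [c [b [c0 b0 Pc Pb [cM bM]]]] := fracideal_bounds hC cP fM.
have [c' [b' [c'0 b'0 Pc' Pb' [cN bN]]]] := fracideal_bounds hC cP fN.
have [_ MZ _] := fM; have P1 := subalg1 sP.
split; first exact: prodsetD.
  by move=> a x Pa; apply: prodset_mull => y; apply: MZ.
exists (c * c'), (b * b'); rewrite !mulf_neq0//; split=> //.
  move=> x Px; rewrite mulrAC; apply: prodset_mem; first exact: cM.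
  by rewrite -[c']mulr1; apply: cN.
apply: (@prodset_sub _ _ _ (fun x => P (b * b' * x))); first by rewrite mulr0; apply: (subalg0 sP).
  by move=> x y hx hy; rewrite mulrDr; apply: (subalgD sP).
move=> x y Mx Ny; have -> : b * b' * (x * y) = b * x * (b' * y) by ring.
by apply: (subalgM sP); [apply: bM|apply: bN].
Qed.

Lemma prodset_unit P M : cp P -> fracideal P M -> prodset M P = M.
Proof.
move=> cP fM; have [MD MZ _] := fM; apply/seteqP; split.
  apply: prodset_sub => //; first exact: (fracideal0 hC cP fM).
  by move=> a b Ma Pb; rewrite mulrC; apply: MZ.
move=> x Mx; rewrite -[x]mulr1; apply: prodset_mem => //.
exact: (subalg1 (cp_subalg hC cP)).
Qed.

Lemma good_prod F G : good_sheaf C F -> good_sheaf C G ->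
  good_sheaf C (fun P => prodset (F P) (G P)).
Proof.
move=> [fF finF] [fG finG]; split.
  by move=> P cP; apply: fracideal_prod => //; [apply: fF|apply: fG].
apply: (@sub_finite_set _ _ ([set P | cp P /\ F P <> P] `|` [set P | cp P /\ G P <> P])).
  move=> P [cP nP]; have [FP|nF] := pselect (F P = P); last by left.
  right; split=> // GP; apply: nP; rewrite FP GP.
  by apply: prodset_unit => //; apply: (fracideal_self hC cP).
by rewrite finite_setU.
Qed.

Lemma fracideal_add P H x : cp P -> fracideal P H ->
  fracideal P [set y | exists h p, [/\ H h, P p & y = h + p * x]].
Proof.
move=> cP fH; have sP := cp_subalg hC cP; have [HD HZ _] := fH.
have [c [b [c0 b0 Pc Pb [cH bH]]]] := fracideal_bounds hC cP fH.
split.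
- move=> _ _ [h [p [Hh Pp ->]]] [h' [p' [Hh' Pp' ->]]]; exists (h + h'), (p + p').
  by split; [apply: HD|apply: (subalgD sP)|ring].
- move=> a _ Pa [h [p [Hh Pp ->]]]; exists (a * h), (a * p).
  by split; [apply: HZ|apply: (subalgM sP)|ring].
- have [u [v [Pu Pv v0 xE]]] := cp_frac hC x cP.
  exists c, (b * v); rewrite mulf_neq0//; split=> //.
    by move=> y Py; exists (c * y), 0; rewrite mul0r addr0; split=> //; [apply: cH|apply: (subalg0 sP)].
  move=> _ [h [p [Hh Pp ->]]].
  have -> : b * v * (h + p * x) = v * (b * h) + b * (p * u) by rewrite xE; field.
  apply: (subalgD sP); apply: (subalgM sP) => //; first exact: bH.
  exact: (subalgM sP).
Qed.

(** H is a submodule between N and M of minimal positive colength, so H + P x = M for each x of M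
    outside H. The argument of Nakayama's lemma then puts m_P M inside H, and M/H is a line because
    the residue field is k. *)
Lemma hyperplane P M N : cp P -> fracideal P M -> fracideal P N -> N `<=` M ->
  (exists2 x, M x & ~ N x) -> exists H, [/\ fracideal P H, N `<=` H, H `<=` M,
    exists2 e, M e & ~ H e &
    (forall a x, max_ideal P a -> M x -> H (a * x)) /\ @dim_le _ _ iota K^o M H 1].
Proof.
move=> cP fM fN NM [x0 Mx0 Nx0]; have lP := cp_local hC cP; have sP := lP.1.
pose Q n := `[< exists H, [/\ fracideal P H, N `<=` H, H `<=` M, @dim_eq _ _ iota K^o M H n & (0 < n)%N] >].
have pos H n x : H x -> forall H', H' `<=` H -> ~ H' x -> @dim_eq _ _ iota K^o H H' n -> (0 < n)%N.
  move=> Hx H' HH nx; case: n => // -[e [_ _ /(_ x Hx)[c]]].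
  by rewrite /lincomb big_ord0 subr0.
have exQ : exists n, Q n.
  have [n hn] := fracideal_dim_eq hC cP fM fN; exists n; apply/asboolP; exists N; split=> //.
  exact: (pos M n x0 Mx0 N NM Nx0 hn).
case: (ex_minnP exQ) => n /asboolP[H [fH NH HM hn n0]] minn.
have [HD HZ _] := fH; have [MD MZ _] := fM.
have add x : M x -> ~ H x -> forall y, M y -> exists h p, [/\ H h, P p & y = h + p * x].
  move=> Mx nHx; have fH' := fracideal_add x cP fH.
  set H' := (H' in fracideal P H') in fH'.
  have HH' : H `<=` H' by move=> h Hh; exists h, 0; rewrite mul0r addr0; split=> //; apply: (subalg0 sP).
  have H'M : H' `<=` M by move=> _ [h [p [Hh Pp ->]]]; apply: MD; [apply: HM|apply: MZ].
  have H'x : H' x.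
    exists 0, 1; rewrite mul1r add0r; split=> //; [exact: (fracideal0 hC cP fH)|exact: (subalg1 sP)].
  have [n1 h1] := fracideal_dim_eq hC cP fM fH'.
  have [n2 h2] := fracideal_dim_eq hC cP fH' fH.
  have h12 := dim_eq_add (fracideal_subspace hC cP fH') (fracideal_subspace hC cP fH) H'M HH' h1 h2.
  have e12 := dim_eq_uniq (fracideal_subspace hC cP fH) hn h12.
  have n20 := pos _ _ _ H'x _ HH' nHx h2.
  have n10 : n1 = 0%N.
    apply/eqP; rewrite -leqn0 leqNgt; apply/negP => n1p.
    have : (n <= n1)%N; last by lia.
    by apply: minn; apply/asboolP; exists H'; split=> //; apply: subset_trans HH'.
  rewrite n10 in h1; move: h1 => [e [_ _ se]] y My; have [c] := se y My.
  by rewrite /lincomb big_ord0 subr0.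
have mH a x : max_ideal P a -> M x -> H (a * x).
  move=> ma Mx; apply: contrapT => nHax.
  have Pa := max_ideal_sub ma.
  have [h [p [Hh Pp xE]]] := add (a * x) (MZ _ _ Pa Mx) nHax x Mx.
  have hE : h = (1 - p * a) * x.
    have -> : h = x - p * (a * x) by rewrite {1}xE addrK.
    by ring.
  have [u0 Pu] : 1 - p * a != 0 /\ P (1 - p * a)^-1.
    apply: unitP; first by apply: (subalgB sP); [apply: (subalg1 sP)|apply: (subalgM sP)].
    move=> mu; apply: (max_ideal1 sP); rewrite -(subrK (p * a) 1).
    by apply: lP.2 => //; apply: (max_idealM sP).
  apply: nHax; have -> : a * x = a * (1 - p * a)^-1 * h by rewrite hE; field.
  by apply: HZ => //; apply: (subalgM sP).
have [e Me nHe] : exists2 e, M e & ~ H e.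
  apply: contrapT => h; have MH : M `<=` H by move=> y My; apply: contrapT => ny; apply: h; exists y.
  have [e [Me fe _]] := hn.
  have /fe/(_ (Ordinal n0))/eqP : H (lincomb iota (fun=> 1) e).
    apply: (@subspace_lincomb _ _ iota K^o); first exact: (fracideal_subspace hC cP fH).
    by move=> i; apply: MH.
  by rewrite oner_eq0.
exists H; split=> //; first by exists e.
split=> //; apply: (@dim_le_spans _ _ iota K^o _ _ _ (fun=> e)).
  exact: (fracideal_subspace hC cP fH).
move=> y My; have [h [p [Hh Pp ->]]] := add e Me nHe y My.
have [c mc] := cp_residue hC cP Pp; exists (fun=> c).
rewrite /lincomb big_ord1 /GRing.scale/= -addrA -mulrBl.
by apply: HD => //; apply: mH.
Qed.

End LocalModules.

Section RationalFunctions.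
Variables (k : closedFieldType) (K : fieldType) (iota : {rmorphism k -> K}).
Variable x : K.
Notation ratx := (rational_subfield iota x).

Lemma ratB f g : ratx f -> ratx g -> ratx (f - g).
Proof.
move=> [p [q [q0 ->]]] [r [s [s0 ->]]]; exists (p * s - r * q), (q * s).
rewrite !rmorphB/= !rmorphM/= !hornerD !hornerN !hornerM mulf_neq0//; split=> //.
by field; rewrite ?q0 ?s0.
Qed.

Lemma ratM f g : ratx f -> ratx g -> ratx (f * g).
Proof.
move=> [p [q [q0 ->]]] [r [s [s0 ->]]]; exists (p * r), (q * s).
rewrite !rmorphM/= !hornerM mulf_neq0//; split=> //.
by field; rewrite ?q0 ?s0.
Qed.

Lemma rat_peval p : ratx (peval iota p x).
Proof. by exists p, 1; rewrite rmorph1 hornerC oner_neq0 divr1. Qed.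

Lemma ratV f : ratx f -> ratx f^-1.
Proof.
move=> [p [q [q0 ->]]]; have [p0|p0] := eqVneq (map_poly iota p).[x] 0.
  by rewrite p0 mul0r invr0 -(peval0 iota x); apply: rat_peval.
by exists q, p; rewrite invf_div.
Qed.

Lemma ratN f : ratx f -> ratx (- f).
Proof. by rewrite -sub0r => h; apply: ratB => //; rewrite -(peval0 iota x); apply: rat_peval. Qed.

Lemma degree_over_two e1 e2 :
  (forall f, exists c1 c2, [/\ ratx c1, ratx c2 & f = c1 * e1 + c2 * e2]) ->
  (forall c1 c2, ratx c1 -> ratx c2 -> c1 * e1 + c2 * e2 = 0 -> c1 = 0 /\ c2 = 0) ->
  degree_over iota x 2.
Proof.
move=> sp fr; exists (fun i => if i == ord0 then e1 else e2) => f.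
have [c1 [c2 [r1 r2 ->]]] := sp f.
exists [ffun i => if i == ord0 then c1 else c2]; split.
  split; first by move=> i; rewrite ffunE; case: eqP.
  by rewrite big_ord_recl big_ord1 !ffunE.
move=> c [rc]; rewrite big_ord_recl big_ord1 /= => hc.
have [] := fr (c1 - c ord0) (c2 - c (lift ord0 ord0)).
- exact: ratB.
- exact: ratB.
- by rewrite !mulrBl addrACA -opprD hc subrr.
move=> /eqP; rewrite subr_eq0 => /eqP e1' /eqP; rewrite subr_eq0 => /eqP e2'.
apply/ffunP => i; rewrite ffunE; case: (unliftP ord0 i) => [j|] -> /=.
  by rewrite (ord1 j) e2'.
by rewrite e1'.
Qed.

End RationalFunctions.

(** 1 and phi form a basis over k(phi^2): numerator and denominator are split into even and odd
    parts, and the denominator q0 + q1 phi is cleared with q0 - q1 phi. This is valid in every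
    characteristic. *)
Lemma degree_square (k : closedFieldType) (K : fieldType) (iota : {rmorphism k -> K}) (phi : K) :
  ~ range iota phi -> (forall f, rational_subfield iota phi f) -> degree_over iota (phi ^+ 2) 2.
Proof.
move=> nphi gen; set x := phi ^+ 2; have trphi := nonconst_transcendental nphi.
have split_poly p : peval iota p phi = peval iota (even_poly p) x + peval iota (odd_poly p) x * phi.
  rewrite -{1}(poly_even_odd p) pevalD pevalM pevalX.
  have sq q : peval iota (q \Po 'X^2) phi = peval iota q x.
    by rewrite /peval map_comp_poly map_polyXn horner_comp hornerXn.
  by rewrite !sq.
have parity a b : peval iota a x + peval iota b x * phi = 0 -> a = 0 /\ b = 0.
  have sq q : peval iota (q \Po 'X^2) phi = peval iota q x.
    by rewrite /peval map_comp_poly map_polyXn horner_comp hornerXn.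
  rewrite -!sq -[X in _ * X](pevalX iota) -pevalM -pevalD => /trphi h.
  have evenX2 (q : {poly k}) : even_poly (q \Po 'X^2) = q.
    apply/polyP => i; rewrite coef_even_poly coef_comp_poly_Xn// -muln2.
    by rewrite dvdn_mull// mulnK.
  have oddX2 (q : {poly k}) : odd_poly (q \Po 'X^2) = 0.
    apply/polyP => i; rewrite coef_odd_poly coef_comp_poly_Xn// coef0.
    by rewrite dvdn2 /= odd_double.
  split.
    have := congr1 (@even_poly _) h; rewrite even_polyD even_polyMX oddX2 mul0r addr0 evenX2.
    by rewrite even_polyC.
  have := congr1 (@odd_poly _) h; rewrite odd_polyD odd_polyMX oddX2 add0r evenX2.
  by rewrite odd_polyC.
have ndiff a b : a * phi = b -> rational_subfield iota x a -> rational_subfield iota x b ->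
    a = 0 /\ b = 0.
  move=> abE [p [q [q0 aE]]] [r [s [s0 bE]]].
  have : peval iota (- r * q) x + peval iota (p * s) x * phi = 0.
    rewrite !pevalM mulrAC; move: abE; rewrite aE bE -/(peval iota p x) -/(peval iota q x)
      -/(peval iota r x) -/(peval iota s x) in q0 s0 * => abE.
    have -> : peval iota p x * phi = peval iota p x / peval iota q x * phi * peval iota q x by field.
    have -> : peval iota (- r) x = - peval iota r x.
      by rewrite -[- r]sub0r pevalB peval0 sub0r.
    by rewrite abE; field.
  move=> /parity[_ ps0].
  have a0 : a = 0.
    have := congr1 (fun u => peval iota u x) ps0; rewrite pevalM peval0 => /eqP.
    by rewrite mulf_eq0 (negbTE s0) orbF aE => /eqP; rewrite /peval => ->; rewrite mul0r.
  by rewrite -abE a0 mul0r.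
apply: (@degree_over_two _ _ _ _ 1 phi).
- move=> f; have [p [q [q0 ->]]] := gen f.
  rewrite -/(peval iota p phi) -/(peval iota q phi) in q0 *; move: q0; rewrite !split_poly.
  set p0 := peval iota (even_poly p) x; set p1 := peval iota (odd_poly p) x.
  set q0 := peval iota (even_poly q) x; set q1 := peval iota (odd_poly q) x => qN.
  have cN : q0 - q1 * phi != 0.
    apply: contraNneq qN => h.
    have : peval iota (even_poly q) x + peval iota (- odd_poly q) x * phi = 0.
      by rewrite -[- odd_poly q]sub0r pevalB peval0 sub0r mulNr.
    by move=> /parity[e0 /eqP]; rewrite oppr_eq0 => /eqP o0; rewrite /q0 /q1 e0 o0 !peval0 mul0r addr0.
  have dE : (q0 + q1 * phi) * (q0 - q1 * phi) = q0 * q0 - q1 * q1 * x by rewrite /x; ring.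
  have dN : q0 * q0 - q1 * q1 * x != 0 by rewrite -dE mulf_neq0.
  have rx q' : rational_subfield iota x (peval iota q' x) by apply: rat_peval.
  have rp0 : rational_subfield iota x p0 := rx _.
  have rp1 : rational_subfield iota x p1 := rx _.
  have rq0 : rational_subfield iota x q0 := rx _.
  have rq1 : rational_subfield iota x q1 := rx _.
  have rxx : rational_subfield iota x x by have := rx 'X; rewrite pevalX.
  have rN : rational_subfield iota x (q0 * q0 - q1 * q1 * x).
    by apply: ratB; [apply: ratM|apply: ratM => //; apply: ratM].
  exists ((p0 * q0 - p1 * q1 * x) / (q0 * q0 - q1 * q1 * x)),
    ((p1 * q0 - p0 * q1) / (q0 * q0 - q1 * q1 * x)); split.
  + by apply: ratM; [apply: ratB; [apply: ratM|apply: ratM => //; apply: ratM]|apply: ratV].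
  + by apply: ratM; [apply: ratB; apply: ratM|apply: ratV].
  + rewrite -dE /x; field; by rewrite ?qN ?cN.
- move=> c1 c2 r1 r2; rewrite mulr1 addrC => /eqP; rewrite addr_eq0 => /eqP h.
  have [-> /eqP] := ndiff _ _ h r2 (ratN r1).
  by rewrite oppr_eq0 => /eqP.
Qed.

Section Hyperelliptic.
Variables (k : closedFieldType) (K : fieldType) (iota : {rmorphism k -> K}).
Variable C : set (set K).
Hypothesis hC : complete_curve iota C.
Notation cp := (closed_points C).

(** The point of the line below P is the localization of k[x] or k[1/x] at the trace of m_P. *)
Lemma dominates_line P x : local_ring iota P -> P x \/ P x^-1 ->
  exists2 Q, projective_line iota x Q & dominates P Q.
Proof.
move=> lP Px; have sP := lP.1.
suff key y : P y -> exists2 Q, affine_points (generated_algebra iota [:: y]) Q & dominates P Q.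
  by case: Px => /key[Q hQ dQ]; exists Q => //; [left|right].
move=> Py; set A := generated_algebra iota [:: y].
have sA : subalgebra iota A := generated_subalgebra iota _.
have AP : A `<=` P by move=> z; apply=> // u; rewrite inE => /eqP ->.
have pp : prime_ideal A (A `&` max_ideal P).
  split.
  - by move=> z [].
  - split; first by split; [exact: (subalg0 sA)|exact: (max_ideal0 sP)].
    by move=> u v [Au mu] [Av mv]; split; [exact: (subalgD sA)|exact: lP.2].
  - move=> a u Aa [Au mu]; split; first exact: (subalgM sA).
    by apply: (max_idealM sP) => //; apply: AP.
  - by move=> [_ /(max_ideal1 sP)].
  - by move=> u v Au Av [_ /(max_ideal_prime sP (AP _ Au) (AP _ Av))[]]; [left|right].
exists (localization A (A `&` max_ideal P)); first by exists (A `&` max_ideal P).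
have inv b : A b -> ~ (A `&` max_ideal P) b -> P b^-1.
  by move=> Ab nb; have [] := @unitP _ P b (AP _ Ab) (fun mb => nb (conj Ab mb)).
split.
  move=> _ [a [b [Aa Ab nb ->]]]; apply: (subalgM sP); [exact: AP|exact: inv].
move=> z /(max_ideal_localization pp)[a [b [[Aa ma] Ab nb ->]]].
by rewrite mulrC; apply: (max_idealM sP) => //; exact: inv.
Qed.

Lemma hyperelliptic_intro x : degree_over iota x 2 ->
  (forall P, cp P -> P x \/ P x^-1) -> hyperelliptic iota C.
Proof.
move=> dx h; exists x; split=> // P CP.
have lP : local_ring iota P.
  have [_ [[m [s [hs CE]]] _]] := hC; move: CP; rewrite CE => -[i Pi].
  exact: affine_local Pi.
apply: dominates_line => //; have [->|PT] := pselect (P = setT); first by left.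
exact: h.
Qed.

(** Q/bQ is finite-dimensional, so some nonzero polynomial in y lies in bQ. As y is in m_Q, this
    polynomial is a unit times a power of y. *)
Lemma nilpotent_mod Q y : cp Q -> max_ideal Q y ->
  forall b, Q b -> b != 0 -> exists m z, Q z /\ y ^+ m = b * z.
Proof.
move=> cQ my; have sQ := cp_subalg hC cQ; have lQ := cp_local hC cQ.
have Qy := max_ideal_sub my.
move=> b Qb b0; have [M hM] := cp_quot hC cQ Qb b0.
  have [p p0 hp] := dim_poly sQ Qy hM.
  suff : forall j, scale b Q (peval iota p y * y ^+ j) -> exists m z, Q z /\ y ^+ m = b * z.
    by move=> /(_ 0%N); rewrite expr0 mulr1; apply.
  elim/poly_ind: p p0 {hp} => [|r c IH]; first by rewrite eqxx.
  have [->|c0 _ j] := eqVneq c 0.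
    rewrite addr0 mulf_eq0 negb_or => /andP[r0 _] j.
    by rewrite pevalM pevalX -mulrA -exprS; apply: IH.
  rewrite pevalD pevalM pevalX pevalC => -[z Qz hz].
  set u := _ + iota c in hz.
  have [u0 Qu] : u != 0 /\ Q u^-1.
    apply: unitP.
      apply: (subalgD sQ); last exact: (subalg_const sQ).
      by apply: (subalgM sQ) => //; apply: subalgebra_peval.
    move=> mu; have := @max_ideal_const _ _ iota Q c sQ.
    have -> : iota c = u - peval iota r y * y by rewrite /u addrC addKr.
    move=> hc; move/eqP: c0; apply; apply: hc; apply: (max_idealB lQ) => //.
    by apply: (max_idealM sQ) => //; apply: subalgebra_peval.
  exists j, (u^-1 * z); split; first exact: (subalgM sQ).
  by rewrite mulrCA hz mulKf.
Qed.

(** m_Q = yQ makes Q a discrete valuation ring: dividing a nonzero a by y must stop, because some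
    power of y is a multiple of a, so every element is a power of y times a unit. *)
Lemma principal_valuation Q y : cp Q -> max_ideal Q y -> y != 0 ->
  (forall x, max_ideal Q x -> Q (x / y)) -> valuation_ring iota Q.
Proof.
move=> cQ my y0 hy; have sQ := cp_subalg hC cQ; have lQ := cp_local hC cQ.
have Qy := max_ideal_sub my.
have pow := nilpotent_mod cQ my.
have dec M : forall a z, Q a -> Q z -> y ^+ M = a * z ->
    exists m u, [/\ a = y ^+ m * u, Q u, u != 0 & Q u^-1].
  elim: M => [|M IH] a z Qa Qz.
    rewrite expr0 => az; have a0 : a != 0.
      by apply/eqP => a0; move/eqP: az; rewrite a0 mul0r oner_eq0.
    exists 0%N, a; rewrite mul1r; split=> //.
    by rewrite -[_^-1]mulr1 az mulKf.
  move=> az; have [ma|na] := pselect (max_ideal Q a); last first.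
    by have [a0 Qa'] := unitP Qa na; exists 0%N, a; rewrite mul1r.
  have [|m [u [aE Qu u0 Qu']]] := IH (a / y) z (hy a ma) Qz.
    by apply: (mulfI y0); rewrite -exprS az; field.
  exists m.+1, u; split=> //; rewrite exprS -mulrA -aE; by field.
split=> // f f0; have [a [b [Qa Qb b0 fE]]] := cp_frac hC f cQ.
have a0 : a != 0 by apply: contraNneq f0 => a0; rewrite fE a0 mul0r.
have [M [z [Qz hz]]] := pow a Qa a0; have [m [u [aE Qu u0 Qu']]] := dec M a z Qa Qz hz.
have [N [z' [Qz' hz']]] := pow b Qb b0; have [n [v [bE Qv v0 Qv']]] := dec N b z' Qb Qz' hz'.
have yn i : y ^+ i != 0 by rewrite expf_neq0.
have [mn|/ltnW nm] := leqP m n.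
  right; rewrite fE aE bE -(subnK mn) exprD.
  have -> : (y ^+ m * u / (y ^+ (n - m) * y ^+ m * v))^-1 = y ^+ (n - m) * (v * u^-1).
    by field; rewrite ?u0 ?v0 ?yn.
  by apply: (subalgM sQ); [apply: (subalgX sQ)|apply: (subalgM sQ)].
left; rewrite fE aE bE -(subnK nm) exprD.
have -> : y ^+ (m - n) * y ^+ n * u / (y ^+ n * v) = y ^+ (m - n) * (u * v^-1).
  by field; rewrite ?u0 ?v0 ?yn.
by apply: (subalgM sQ); [apply: (subalgX sQ)|apply: (subalgM sQ)].
Qed.

Lemma valuation_principal w P : cp P -> valuation_ring iota P -> fracideal P w ->
  exists e, w = scale e P.
Proof.
move=> cP vP fw; have [u [u0 wu hu]] := fracideal_valuation hC cP vP (@subset_refl _ P) fw.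
exists u; apply/seteqP; split=> [x wx|_ [p Pp <-]].
  by apply/(scaleP _ _ u0); rewrite mulrC; apply: hu.
by have [_ wZ _] := fw; rewrite mulrC; apply: wZ.
Qed.

(** If c is the residue of phi, polynomials in phi not vanishing at c are units of P. In a reduced
    fraction the numerator or the denominator is of this kind. *)
Lemma rational_valuation P phi : cp P -> P phi ->
  (forall f, rational_subfield iota phi f) -> valuation_ring iota P.
Proof.
move=> cP Pphi gen; have sP := cp_subalg hC cP; split=> // f f0.
have [c mc] := cp_residue hC cP Pphi; have lP := cp_local hC cP.
have unit (q : {poly k}) : ~~ root q c -> peval iota q phi != 0 /\ P (peval iota q phi)^-1.
  move=> nq; apply: unitP; first exact: subalgebra_peval.
  move=> mq; move/negP: nq; apply; apply/eqP.
  apply: (max_ideal_const sP).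
  have [r rE] : exists r, q = r * ('X - c%:P) + (q.[c])%:P.
    have /factor_theorem[r rE] : root (q - (q.[c])%:P) c.
      by rewrite /root hornerD hornerN hornerC subrr.
    by exists r; rewrite -rE subrK.
  have -> : iota q.[c] = peval iota q phi - peval iota r phi * (phi - iota c).
    by rewrite {2}rE pevalD pevalM pevalB pevalX !pevalC addrC addKr.
  by apply: (max_idealB lP) => //; apply: (max_idealM sP) => //; apply: subalgebra_peval.
have [p [q [q0 fE]]] := gen f; rewrite -/(peval iota p phi) -/(peval iota q phi) in q0 fE.
have qN0 : q != 0 by apply: contraNneq q0 => ->; rewrite peval0.
pose d := gcdp p q; have d0 : d != 0 by rewrite gcdp_eq0 negb_and qN0 orbT.
have pE : p = p %/ d * d by rewrite divpK// dvdp_gcdl.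
have qE : q = q %/ d * d by rewrite divpK// dvdp_gcdr.
have cop : coprimep (p %/ d) (q %/ d) by apply: coprimep_div_gcd; rewrite qN0 orbT.
have fE' : f = peval iota (p %/ d) phi / peval iota (q %/ d) phi.
  move: q0; rewrite fE {1 2}qE {1}pE !pevalM mulf_eq0 negb_or => /andP[h1 h2].
  by field; rewrite h1.
have [rp|nrp] := boolP (root (p %/ d) c).
  have [q0' Pq] := unit _ (coprimep_root cop rp).
  left; rewrite fE'; apply: (subalgM sP) => //; exact: subalgebra_peval.
have [p0' Pp] := unit _ nrp.
right; rewrite fE' invf_div; apply: (subalgM sP) => //; exact: subalgebra_peval.
Qed.

(* phi is a coordinate with a simple pole at Q, so C is the projective line. *)
Lemma simple_pole_line w Q phi : good_sheaf C w -> cp Q -> ~ range iota phi ->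
  (forall x, max_ideal Q x -> Q (phi * x)) -> (forall P, cp P -> P <> Q -> P phi) ->
  hyperelliptic iota C /\ forall P, cp P -> exists e, w P = scale e P.
Proof.
move=> [fw _] cQ nphi hphi hP; have sQ := cp_subalg hC cQ; have lQ := cp_local hC cQ.
(* Otherwise phi preserves the ideal sheaf of Q and is constant by [End_const]. *)
have [x0 mx0 nx0] : exists2 x, max_ideal Q x & ~ max_ideal Q (phi * x).
  apply: contrapT => h; apply: nphi.
  have mQ x : max_ideal Q x -> max_ideal Q (phi * x).
    by move=> mx; apply: contrapT => nx; apply: h; exists x.
  pose F P := if P == Q then max_ideal Q else P.
  have gF : good_sheaf C F.
    apply: (@good_congr _ _ (fun P => P) F [set Q]) => //; first exact: (good_structure hC).
      by move=> P _ nP; rewrite /F; case: eqP.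
    move=> P cP; rewrite /F; case: eqP => [->|_]; last exact: (fracideal_self hC cP).
    have [a ma a0] := cp_elt hC cQ; split; first exact: lQ.2.
      by move=> b x Qb mx; apply: (max_idealM sQ).
    exists a, 1; rewrite oner_eq0; split=> // x; last by move=> /max_ideal_sub; rewrite mul1r.
    by move=> Qx; rewrite mulrC; apply: (max_idealM sQ).
  apply: (End_const hC gF) => P x cP; rewrite /F; case: eqP => [_|PQ]; first exact: mQ.
  by apply: (subalgM (cp_subalg hC cP)); apply: hP.
have [u0 Qu] := unitP (hphi _ mx0) nx0.
have phi0 : phi != 0 by apply: contraNneq u0 => ->; rewrite mul0r.
(* y lies in m_Q and generates it, so Q is a valuation ring. *)
pose y := phi^-1; have y0 : y != 0 by rewrite invr_eq0.
have my : max_ideal Q y.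
  have -> : y = (phi * x0)^-1 * x0.
    by rewrite /y; field; rewrite phi0 andbT; apply: contraNneq u0 => ->; rewrite mulr0.
  exact: (max_idealM sQ).
have hy x : max_ideal Q x -> Q (x / y) by move=> mx; rewrite /y invrK mulrC; apply: hphi.
have vQ := principal_valuation cQ my y0 hy.
(* A polynomial in phi clears the poles of f away from Q. The remaining pole at Q is removed by
   subtracting constants times powers of phi, until a constant is left; so f is rational in phi. *)
have gen f : rational_subfield iota phi f.
  have [q q0 hq] : exists2 q : {poly k}, q != 0 & forall P, cp P -> P <> Q -> P (peval iota q phi * f).
    have /finite_seqP[T TE] := cp_finite hC f.
    have [q q0 hq] : exists2 q : {poly k}, q != 0 &
        forall P, P \in T -> cp P -> P <> Q -> P (peval iota q phi * f).
      elim: T {TE} => [|P T [q q0 hq]]; first by exists 1; rewrite ?oner_eq0.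
      have [r r0 hr] : exists2 r : {poly k}, r != 0 & cp P -> P <> Q -> P (peval iota r phi * f).
        have [[cP PQ]|nP] := pselect (cp P /\ P <> Q); last first.
          by exists 1; rewrite ?oner_eq0// => cP PQ; case: nP.
        have sP := cp_subalg hC cP.
        have [a [b [Pa Pb b0 fE]]] := cp_frac hC f cP.
        have [M hM] := cp_quot hC cP Pb b0.
        have [r r0 [z Pz hz]] := dim_poly sP (hP P cP PQ) hM.
        exists r => // _ _; rewrite -hz fE; have -> : b * z * (a / b) = z * a by field.
        exact: (subalgM sP).
      exists (q * r); first by rewrite mulf_neq0.
      move=> P'; rewrite inE pevalM => /orP[/eqP -> cP PQ|P'T cP PQ].
        rewrite -mulrA; apply: (subalgM (cp_subalg hC cP)); last exact: hr.
        by apply: (subalgebra_peval _ (cp_subalg hC cP)); apply: hP.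
      have -> : peval iota q phi * peval iota r phi * f =
        peval iota r phi * (peval iota q phi * f) by ring.
      apply: (subalgM (cp_subalg hC cP)); last exact: hq.
      by apply: (subalgebra_peval _ (cp_subalg hC cP)); apply: hP.
    exists q => // P cP PQ; have [Pf|nPf] := pselect (P f).
      apply: (subalgM (cp_subalg hC cP)) => //.
      by apply: (subalgebra_peval _ (cp_subalg hC cP)); apply: hP.
    by apply: hq => //; have : [set` T] P by rewrite -TE.
  have pole m : forall h, (forall P, cp P -> P <> Q -> P h) -> Q (y ^+ m * h) ->
      exists p, h = peval iota p phi.
    elim: m => [|m IH] h hh.
      rewrite mul1r => Qh; have [c _ <-] : range iota h.
        by apply: (regular_const hC) => P cP; have [->|PQ] := pselect (P = Q); last exact: hh.
      by exists c%:P; rewrite pevalC.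
    move=> Qh; have [c mc] := cp_residue hC cQ Qh.
    have [||p pE] := IH (h - iota c * phi ^+ m.+1).
    - move=> P cP PQ; apply: (subalgB (cp_subalg hC cP)); first exact: hh.
      apply: (subalgM (cp_subalg hC cP)); first exact: (subalg_const (cp_subalg hC cP)).
      by apply: (subalgX (cp_subalg hC cP)); apply: hP.
    - have -> : y ^+ m * (h - iota c * phi ^+ m.+1) = (y ^+ m.+1 * h - iota c) / y.
        by rewrite /y !exprVn !exprS; field; rewrite ?phi0 ?oner_neq0 ?expf_neq0.
      exact: hy.
    exists (p + c%:P * 'X^(m.+1)); rewrite pevalD pevalM pevalC pevalXn -pE subrK.
    by [].
  have [m Qm] : exists m, Q (y ^+ m * (peval iota q phi * f)).
    have [a [b [Qa Qb b0 hE]]] := cp_frac hC (peval iota q phi * f) cQ.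
    have [m [z [Qz yE]]] := nilpotent_mod cQ my Qb b0.
    exists m; rewrite yE hE; have -> : b * z * (a / b) = z * a by field.
    exact: (subalgM sQ).
  have [p pE] := pole m _ hq Qm.
  have qphi0 : peval iota q phi != 0.
    by apply: contraNneq q0 => /(nonconst_transcendental nphi) ->.
  exists p, q; split=> //; rewrite -/(peval iota p phi) -/(peval iota q phi) -pE.
  by field.
have hpt P : cp P -> P phi \/ P = Q.
  by move=> cP; have [->|PQ] := pselect (P = Q); [right|left; apply: hP].
split.
  (* On the line, the square of the coordinate is a map of degree two. *)
  apply: (@hyperelliptic_intro (phi ^+ 2)); first exact: degree_square.
  move=> P cP; case: (hpt P cP) => [Pphi|->]; first by left; apply: (subalgX (cp_subalg hC cP)).
  by right; rewrite -exprVn; apply: (subalgX sQ); apply: max_ideal_sub my.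
move=> P cP; apply: valuation_principal (fw P cP) => //.
by case: (hpt P cP) => [Pphi|-> //]; apply: rational_valuation gen.
Qed.

End Hyperelliptic.

(** * The canonical sheaf *)

Section Canonical.
Variables (k : closedFieldType) (K : fieldType) (iota : {rmorphism k -> K}).
Variable C : set (set K).
Hypothesis hC : complete_curve iota C.
Notation cp := (closed_points C).
Variables (w : set K -> set K) (t : (set K -> K^o) -> k).
Hypothesis hw : canonical_sheaf iota C w t.

Notation S := (global_sections C (w : set K -> set K^o)).

Let gw : good_sheaf C w. Proof. by case: hw. Qed.
Let fw P : cp P -> fracideal P (w P). Proof. by case: gw => h _; apply: h. Qed.
Let w0 P : cp P -> w P 0. Proof. by move=> cP; apply: (fracideal0 hC cP (fw cP)). Qed.
Let wD P x y : cp P -> w P x -> w P y -> w P (x + y).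
Proof. by move=> cP; have [h _ _] := fw cP; apply: h. Qed.
Let wM P a x : cp P -> P a -> w P x -> w P (a * x).
Proof. by move=> cP; have [_ h _] := fw cP; apply: h. Qed.
Let tD c al be : adele C al -> adele C be -> t (iota c *: al + be) = c * t al + t be.
Proof. by case: hw => _ [h _ _] _ _; apply: h. Qed.
Let tK x : t (fun=> x) = 0.
Proof. by case: hw => _ [_ h _] _ _; apply: h. Qed.
Let tw al : (forall P, cp P -> w P (al P)) -> t al = 0.
Proof. by case: hw => _ [_ _ h] _ _; apply: h. Qed.
Let tsep F al : good_sheaf C F -> adele C al ->
  (forall h, (forall P f, cp P -> F P f -> w P (h * f)) -> t (fun P => h * al P) = 0) ->
  exists x, forall P, cp P -> F P (al P - x).
Proof. by case: hw => _ _ h _; apply: h. Qed.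

Lemma sections_subspace : @subspace _ _ iota K^o S.
Proof. by apply: H0_subspace => P cP; apply: (good_subspace hC gw). Qed.

(* The sheaf equal to a G at P and to O elsewhere has no sections for small a, so an adele
   supported at P is cohomologous to 0 only if it is a section at P. *)
Lemma canonical_reflexive P G f : cp P -> fracideal P G ->
  (forall h, (forall g, G g -> w P (h * g)) -> w P (h * f)) -> G f.
Proof.
move=> cP fG hf; have sP := cp_subalg hC cP; have lP := cp_local hC cP.
pose G2 := [set x | forall h, (forall g, G g -> w P (h * g)) -> w P (h * x)].
(* a carries the bidual of G into m_P, so the section x = a (f - g) found below vanishes at P; being
   constant, it is 0. *)
have [a a0 ha] : exists2 a, a != 0 & forall x, G2 x -> max_ideal P (a * x).
  have [c [b [c0 b0 Pc Pb [cw bw]]]] := fracideal_bounds hC cP (fw cP).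
  have [_ [b' [_ b'0 _ Pb' [_ bG]]]] := fracideal_bounds hC cP fG.
  have [d md d0] := cp_elt hC cP.
  exists (d * (b * (c * b'))); first by rewrite !mulf_neq0.
  move=> x hx; rewrite -mulrA mulrC; apply: (max_idealM sP) => //.
  rewrite -mulrA; apply: bw; apply: hx => g Gg; rewrite -mulrA; apply: cw; exact: bG.
pose F R := if R == P then scale a G else R.
have gF : good_sheaf C F.
  apply: (@good_congr _ _ (fun P => P) F [set P]) => //; first exact: (good_structure hC).
    by move=> R _ nR; rewrite /F; case: eqP.
  move=> R cR; rewrite /F; case: eqP => [->|_]; last exact: (fracideal_self hC cR).
  exact: fracideal_scale.
have [|x hx] := tsep gF (adele_at hC P (a * f)).
  move=> h hh; apply: tw => R cR; rewrite /at_point; case: eqP => [RP|_]; last first.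
    by rewrite mulr0; apply: w0.
  rewrite RP mulrA; apply: hf => g Gg; rewrite -mulrA; apply: hh => //.
  by rewrite /F eqxx; exists g.
have [g Gg gE] : scale a G (a * f - x).
  by have := hx P cP; rewrite /F /at_point eqxx.
have xE : x = a * (f - g) by rewrite mulrBr gE; ring.
have G2D u v : G2 u -> G2 v -> G2 (u - v).
  move=> hu hv h hh; rewrite mulrBr -mulN1r; apply: wD => //; first exact: hu.
  by apply: wM => //; [apply: (subalgN sP); apply: (subalg1 sP)|apply: hv].
have mx : max_ideal P x by rewrite xE; apply: ha; apply: G2D => // h; apply.
have [c _ cx] : range iota x.
  apply: (regular_const hC) => R cR; have [->|/eqP/negbTE RP] := pselect (R = P).
    exact: max_ideal_sub mx.
  have := hx R cR; rewrite /F /at_point RP sub0r => /(subalgN (cp_subalg hC cR)).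
  by rewrite opprK.
move: mx xE; rewrite -cx => /(max_ideal_const sP) -> /esym/eqP.
by rewrite rmorph0 mulf_eq0 (negbTE a0)/= subr_eq0 => /eqP ->.
Qed.

Lemma canonical_reflexive1 P f : cp P -> (forall h, w P h -> w P (h * f)) -> P f.
Proof.
move=> cP hf; apply: (canonical_reflexive cP (fracideal_self hC cP)) => h hh; apply: hf.
by rewrite -[h]mulr1; apply: hh; apply: (subalg1 (cp_subalg hC cP)).
Qed.

Hypothesis nHG : ~ (hyperelliptic iota C /\ forall P, cp P -> exists e, w P = scale e P).

(** By [canonical_reflexive1], whatever multiplies each w_P into itself is regular. So phi is
    regular off Q and phi m_Q lies in O_Q, which puts C among the excluded curves. *)
Lemma no_simple_pole Q phi : cp Q -> ~ range iota phi ->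
  (forall P x, cp P -> P <> Q -> w P x -> w P (phi * x)) ->
  (forall a x, max_ideal Q a -> w Q x -> w Q (phi * (a * x))) -> False.
Proof.
move=> cQ nphi hP hQ; apply: nHG; apply: (simple_pole_line hC gw cQ nphi).
  move=> x mx; apply: canonical_reflexive1 => // h hh.
  have -> : h * (phi * x) = phi * (x * h) by ring.
  exact: hQ.
by move=> P cP PQ; apply: canonical_reflexive1 => // h hh; rewrite mulrC; apply: hP.
Qed.

(** Let F be w with stalk H at Q. A multiplier h from F to w is constant, or else has a simple pole
    at Q, which is impossible; for constant h the trace kills the adele e at Q. So e is a section
    modulo H, and that section is not in H. *)
Lemma hyperplane_sections Q H : cp Q -> fracideal Q H -> H `<=` w Q ->
  (forall a x, max_ideal Q a -> w Q x -> H (a * x)) -> (exists2 e, w Q e & ~ H e) ->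
  exists2 x, S x & ~ H x.
Proof.
move=> cQ fH Hw mH [e we nHe]; apply: contrapT => hS.
have SH x : S x -> H x by move=> Sx; apply: contrapT => nx; apply: hS; exists x.
pose F P := if P == Q then H else w P.
have gF : good_sheaf C F.
  apply: (@good_congr _ _ w F [set Q]) => //.
    by move=> P _ nP; rewrite /F; case: eqP.
  by move=> P cP; rewrite /F; case: eqP => [->|_] //; apply: fw.
have Fw P : cp P -> F P `<=` w P by move=> cP; rewrite /F; case: eqP => [->|_ x].
have [x] : exists x, forall P, cp P -> F P (at_point Q e P - x).
  apply: (tsep gF (adele_at hC Q e)) => h hh.
  have [[c _ cE]|nh] := pselect (range iota h).
    apply: tw => P cP; rewrite /at_point; case: eqP => [->|_]; last by rewrite mulr0; apply: w0.
    by rewrite -cE; apply: wM => //; apply: (subalg_const (cp_subalg hC cQ)).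
  case: (@no_simple_pole Q h) => //.
    move=> P x cP /eqP/negbTE PQ wx; apply: hh => //; by rewrite /F PQ.
  by move=> a x ma wx; apply: hh => //; rewrite /F eqxx; apply: mH.
move=> hx; have Sx : S x.
  move=> P cP; have := Fw P cP _ (hx P cP); rewrite /at_point; case: eqP => [PQ h|_ h].
    have -> : x = e + (-1) * (e - x) by ring.
    apply: wD => //; first by rewrite PQ.
    by apply: wM => //; apply: (subalgN (cp_subalg hC cP)); apply: (subalg1 (cp_subalg hC cP)).
  have -> : x = (-1) * (0 - x) by ring.
  by apply: wM => //; apply: (subalgN (cp_subalg hC cP)); apply: (subalg1 (cp_subalg hC cP)).
apply: nHe; have [HD _ _] := fH; rewrite -(subrK x e); apply: HD; last exact: SH.
by have := hx Q cQ; rewrite /F /at_point eqxx.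
Qed.

(** w_Q / a w_Q has the same length as O_Q / a O_Q, which is positive, so [hyperplane] applies to a
    w_Q inside w_Q. *)
Lemma canonical_hyperplane Q : cp Q -> exists H, [/\ fracideal Q H, H `<=` w Q,
  exists2 e, w Q e & ~ H e, forall a x, max_ideal Q a -> w Q x -> H (a * x) &
  @dim_le _ _ iota K^o (w Q) H 1].
Proof.
move=> cQ; have sQ := cp_subalg hC cQ.
have [a ma a0] := cp_elt hC cQ; have Qa := max_ideal_sub ma.
have faw := fracideal_scale a0 (fw cQ); have fQ := fracideal_self hC cQ.
have aww : scale a (w Q) `<=` w Q by move=> _ [x wx <-]; apply: wM.
have [|H [fH _ HM he [mH H1]]] := hyperplane hC cQ (fw cQ) faw aww; last by exists H.
apply: contrapT => h.
have [e he] := fracideal_dim_eq hC cQ fQ (fracideal_scale a0 fQ).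
have e0 := dim_quot_pos hC cQ ma he.
have [eps [weps feps _]] := fracideal_mult hC cQ Qa a0 fQ (fw cQ) he.
have /feps/(_ (Ordinal e0))/eqP : scale a (w Q) (lincomb iota (fun=> 1) eps).
  apply: (@subspace_lincomb _ _ iota K^o); first exact: (fracideal_subspace hC cQ faw).
  by move=> i; apply: contrapT => nx; apply: h; exists (eps i).
by rewrite oner_eq0.
Qed.

Lemma sections_nonzero : exists2 u, S u & u != 0.
Proof.
have [Q cQ] := exists_cp hC; have [H [fH HM he mH _]] := canonical_hyperplane cQ.
have [x Sx nHx] := hyperplane_sections cQ fH HM mH he.
exists x => //; apply/eqP => x0; apply: nHx; rewrite x0; exact: (fracideal0 hC cQ fH).
Qed.

Lemma fracideal_generated P : cp P -> fracideal P (prodset S P).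
Proof.
move=> cP; have sP := cp_subalg hC cP; have [u Su u0] := sections_nonzero.
have [_ [b [_ b0 _ Pb [_ bw]]]] := fracideal_bounds hC cP (fw cP).
split; first exact: prodsetD.
  move=> a _ Pa [m [x [y [Sx Py ->]]]]; rewrite mulr_sumr.
  exists m, x, (fun i => a * y i); split=> // [i|]; first exact: (subalgM sP).
  by apply: eq_bigr => i _; ring.
exists u, b; split=> //; first by move=> x Px; apply: prodset_mem.
move=> x hx; apply: bw; move: x hx; apply: prodset_sub => //; first exact: w0.
  by move=> x y; apply: wD.
by move=> x y Sx Py; rewrite mulrC; apply: wM => //; apply: Sx.
Qed.

(** A proper submodule generated by S would lie in a hyperplane, against [hyperplane_sections]. *)
Lemma canonical_generated P : cp P -> w P = prodset S P.
Proof.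
move=> cP; have sub : prodset S P `<=` w P.
  apply: prodset_sub => //; first exact: w0.
    by move=> x y; apply: wD.
  by move=> x y Sx Py; rewrite mulrC; apply: wM => //; apply: Sx.
apply/seteqP; split=> // x wx; apply: contrapT => nx.
have [|H [fH NH HM he [mH _]]] := hyperplane hC cP (fw cP) (fracideal_generated cP) sub.
  by exists x.
have [y Sy] := hyperplane_sections cP fH HM mH he; apply; apply: NH.
by rewrite -[y]mulr1; apply: prodset_mem => //; apply: (subalg1 (cp_subalg hC cP)).
Qed.

Lemma t_form h (c : k) al be : adele C al -> adele C be ->
  t (fun P => h * (iota c *: al + be) P) = c * t (fun P => h * al P) + t (fun P => h * be P).
Proof.
move=> ha hb; rewrite -tD; try exact: (adele_mul hC).
by congr t; apply/funext => P; rewrite !fctE mulrDr scalerAr.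
Qed.

(* deg(omega / u O) <= 2g - 2: the adeles in omega / uO with zero class in H^1(uO) come from S / ku,
   and H^1(uO) -> H^1(omega) is a nonzero map from a space of dimension g. *)
Lemma degree_bound u g (T : seq (set K)) (d : set K -> nat) : S u -> u != 0 ->
  @dim_eq _ _ iota K^o S [set 0] g.+1 -> uniq T -> (forall Q, Q \in T -> cp Q) ->
  (forall Q, Q \in T -> @dim_eq _ _ iota K^o (w Q) (scale u Q) (d Q)) ->
  (\sum_(Q <- T) d Q <= g + g)%N.
Proof.
move=> Su u0 hS uT cT hd.
pose ku : set K^o := [set x | exists c, x = iota c * u].
have sku : subspace iota ku.
  split; first by exists 0; rewrite rmorph0 mul0r.
  move=> c _ _ [x ->] [y ->]; exists (c * x + y).
  by rewrite rmorphD rmorphM /GRing.scale/=; ring.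
have kuS : ku `<=` S.
  by move=> _ [c ->] P cP; apply: wM; [|apply: (subalg_const (cp_subalg hC cP))|apply: Su].
have dimku : @dim_eq _ _ iota K^o ku [set 0] 1.
  exists (fun=> u); split.
  - by move=> _; exists 1; rewrite rmorph1 mul1r.
  - move=> c; rewrite /lincomb big_ord1 /GRing.scale/= => /eqP.
    rewrite mulf_eq0 (negbTE u0) orbF fmorph_eq0 => /eqP c0 i; by rewrite (ord1 i).
  - by move=> _ [c ->]; exists (fun=> c); rewrite /lincomb big_ord1 subrr.
have sS := sections_subspace.
have [g' hg'] : exists g', @dim_eq _ _ iota K^o S ku g'.
  have hS' : @dim_le _ _ iota K^o S ku g.+1.
    apply: dim_le_mono (dim_eq_le (@subspace0 _ _ iota K^o) hS) => // _ ->.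
    by case: sku.
  by have [m _ h] := dim_le_dim_eq sS sku hS'; exists m.
have s0 := @subspace0 _ _ iota K^o.
have g'E : g' = g.
  have zku : [set 0] `<=` ku by move=> _ ->; case: sku.
  by have := dim_eq_uniq s0 hS (dim_eq_add sku s0 kuS zku hg' dimku); rewrite addn1 => -[->].
subst g'; have [s [Ss fs sps]] := hg'.
pose E : lmodType K := (set K -> K^o).
pose A : set E := [set al | forall P, cp P -> w P (al P)].
pose B : set E := [set al | forall P, cp P -> scale u P (al P)].
have guO : good_sheaf C (fun P => scale u P).
  split; first by move=> P cP; apply: fracideal_scale => //; apply: (fracideal_self hC cP).
  apply: (@sub_finite_set _ _ ([set P | cp P /\ ~ P u] `|` [set P | cp P /\ ~ P u^-1])).
    move=> P [cP nP]; have [Pu|nPu] := pselect (P u); last by left.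
    right; split=> // Pu'; apply: nP; have sP := cp_subalg hC cP; apply/seteqP; split.
      by move=> _ [x Px <-]; apply: (subalgM sP).
    by move=> x Px; apply/(scaleP _ _ u0); apply: (subalgM sP).
  by rewrite finite_setU; split; exact: (cp_finite hC _).
have sA : subspace iota A.
  split; first by move=> P cP; apply: w0.
  move=> c al be ha hb P cP; apply: wD => //; last exact: hb.
  by apply: wM => //; [apply: (subalg_const (cp_subalg hC cP))|apply: ha].
have suP P : cp P -> @subspace _ _ iota K^o (scale u P).
  by move=> cP; apply: scale_subspace; apply: subalg_subspace; apply: (cp_subalg hC cP).
have sB : subspace iota B.
  split; first by move=> P /suP[].
  by move=> c al be ha hb P cP; have [_ h] := suP P cP; apply: h; [apply: ha|apply: hb].
have uPw P : cp P -> scale u P `<=` w P.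
  by move=> cP _ [x Px <-]; rewrite mulrC; apply: wM => //; apply: Su.
have adA al : A al -> adele C al by move=> ha; apply: (adele_good gw).
pose A1 : set E := [set al | A al /\ exists2 x, S x & forall P, cp P -> scale u P (al P - x)].
have sA1 : subspace iota A1.
  split.
    split; first by case: sA.
    by exists 0; [case: sS|move=> P cP; rewrite subr0; case: (suP P cP)].
  move=> c al be [ha [x Sx hx]] [hb [y Sy hy]]; split; first by have [_ h] := sA; apply: h.
  exists (iota c * x + y); first by have [_ h] := sS; apply: h.
  move=> P cP; have [_ h] := suP P cP; have := h c _ _ (hx P cP) (hy P cP).
  suff -> : (iota c *: al + be) P - (iota c * x + y) =
    iota c *: (al P - x : K^o) + (be P - y) by [].
  by rewrite !fctE scalerBr opprD addrACA.
(* Hom(uO, omega) = u^-1 S has dimension g + 1, but its element 1 gives the form t, which vanishes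
   on A. The s_i / u account for the others. *)
have AA1 : dim_le iota A A1 g.
  apply: (@dim_le_forms _ _ iota E A A1 g (fun i al => t (fun P => s i / u * al P))) => //.
    by move=> i c al be ha hb; apply: t_form; apply: adA.
  move=> al ha hal; split=> //.
  have [|x hx] := tsep guO (adA _ ha).
    move=> h hh.
    have Shu : S (h * u).
      by move=> P cP; apply: hh => //; exists 1; rewrite ?mulr1//; apply: (subalg1 (cp_subalg hC cP)).
    have [c [c0 hc]] := sps _ Shu.
    have hE : h = lincomb iota c s / u + iota c0.
      have -> : h = (h * u - lincomb iota c s) / u + lincomb iota c s / u by field.
      by rewrite hc mulfK// addrC.
    have -> : (fun P => h * al P) =
        iota 1 *: (fun P => lincomb iota c s / u * al P : K^o) + (fun P => iota c0 * al P).
      by apply/funext => P; rewrite !fctE rmorph1 scale1r hE mulrDl.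
    have ada := adA _ ha.
    rewrite tD; try exact: (adele_mul hC).
    rewrite [X in _ + X]tw => [|P cP]; last first.
      by apply: wM => //; [apply: (subalg_const (cp_subalg hC cP))|apply: ha].
    rewrite addr0 mul1r.
    rewrite (@form_lincomb _ _ iota K^o setT (fun f => t (fun P => f / u * al P)))//.
      by rewrite big1// => i _; rewrite hal mulr0.
    move=> b x y _ _; rewrite -tD; try exact: (adele_mul hC).
    by congr t; apply/funext => P; rewrite !fctE /GRing.scale/=; ring.
  exists x => // P cP; have h1 := uPw P cP _ (hx P cP).
  have -> : x = al P + (-1) * (al P - x) by ring.
  apply: wD => //; first exact: ha.
  by apply: wM => //; apply: (subalgN (cp_subalg hC cP)); apply: (subalg1 (cp_subalg hC cP)).
have A1B : dim_le iota A1 B g.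
  move=> al hal; have /choice[x hx] : forall i, exists x, S x /\
      forall P, cp P -> scale u P (al i P - x).
    by move=> i; have [_ [x Sx h]] := hal i; exists x.
  have hS' := dim_eq_le sku hg'.
  have [i|c [c0 [z hz]]] := hS' x; first by have [] := hx i.
  exists c; split=> // P cP.
  have -> : lincomb iota c al P =
      lincomb iota c (fun i => al i P - x i : K^o) + lincomb iota c x.
    rewrite -[X in _ + X]/(lincomb iota c (fun i => x i)) lincombBr subrK /lincomb.
    by rewrite fct_sumE.
  apply: (@subspaceD _ _ iota K^o); first exact: suP.
    by apply: subspace_lincomb; [exact: suP|move=> i; have [_] := hx i; apply].
  by rewrite hz; exists (iota z); [apply: (subalg_const (cp_subalg hC cP))|rewrite mulrC].
have AB := dim_le_trans sA sA1 sB AA1 A1B.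
(* Bases of the quotients w_Q / u O_Q, each placed at its own point of T, remain independent modulo
   B. *)
have [fam [Af sf ff]] : exists fam : 'I_(\sum_(Q <- T) d Q) -> E,
    [/\ forall i, A (fam i), forall i P, P \notin T -> fam i P = 0 & free_mod iota B fam].
  elim: T uT cT hd => [|Q T IH] /=.
    by exists (fun=> 0); rewrite big_nil; split=> [[]|[]|c _ []].
  move=> /andP[nQ uT] cT hd; rewrite big_cons.
  have cQ : cp Q by apply: cT; rewrite inE eqxx.
  have [|||fam [Af sf ff]] := IH => //.
  - by move=> P PT; apply: cT; rewrite inE PT orbT.
  - by move=> P PT; apply: hd; rewrite inE PT orbT.
  have [e [we fe _]] := hd Q (mem_head _ _).
  exists (cat_fun (fun i => at_point Q (e i)) fam); split.
  - apply: (cat_fun_prop (P := A)) => // i P cP; rewrite /at_point.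
    by case: eqP => [->|_]; [apply: we|apply: w0].
  - move=> i P; rewrite inE negb_or => /andP[/negbTE PQ PT].
    by case: (split_ordP i) => j ->; rewrite ?cat_funl ?cat_funr ?sf// /at_point PQ.
  - move=> c hc; have c1 j : c (lshift _ j) = 0.
      move: j; apply: fe; have := hc Q cQ; rewrite lincomb_cat.
      have -> : forall al be : E, (al + be) Q = al Q + be Q by [].
      rewrite /lincomb !fct_sumE [X in _ + X]big1 ?addr0 => [|j _]; last first.
        by rewrite fctE sf ?scaler0.
      congr (scale u Q _); apply: eq_bigr => j _.
      by rewrite fctE /at_point eqxx.
    move: hc; rewrite lincomb_cat [X in X + _]/lincomb big1 ?add0r => [/ff c2 i|j _].
      by case: (split_ordP i) => j ->.
    by rewrite c1 rmorph0 scale0r.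
exact: (free_le Af ff sB AB).
Qed.

End Canonical.

(** * Products of subspaces of a field *)

Section LinearVosper.
Variables (k : closedFieldType) (K : fieldType) (iota : {rmorphism k -> K}).
Notation dimK := (@dim_eq k K iota K^o).
Notation subK := (@subspace k K iota K^o).
Implicit Types A B D : set K.

Lemma dim_scale0 a A n : a != 0 -> dimK A [set 0] n -> dimK (scale a A) [set 0] n.
Proof.
move=> a0 h; have := dim_eq_scale a0 h.
suff -> : scale a [set 0] = [set (0 : K)] by [].
by apply/seteqP; split=> [_ [_ -> <-]|_ ->]; [rewrite /= mulr0|exists 0 => //; rewrite mulr0].
Qed.

Lemma dim_eq_le_dim A D n d : subK A -> subK D -> A `<=` D -> dimK A [set 0] n ->
  dimK D [set 0] d -> (n <= d)%N.
Proof.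
move=> sA sD AD [e [Ae fe _]] hD; apply: (free_le _ fe (@subspace0 _ _ iota K^o) (dim_eq_le (@subspace0 _ _ iota K^o) hD)).
by move=> i; apply: AD.
Qed.

Lemma sub_dim_eq A D d : subK A -> A `<=` D -> dimK D [set 0] d ->
  exists2 n, (n <= d)%N & dimK A [set 0] n.
Proof.
move=> sA AD hD; apply: (dim_le_dim_eq sA (@subspace0 _ _ iota K^o)).
by apply: dim_le_mono (dim_eq_le (@subspace0 _ _ iota K^o) hD).
Qed.

Lemma sub_full A D d : subK A -> subK D -> A `<=` D -> dimK A [set 0] d ->
  dimK D [set 0] d -> A = D.
Proof.
move=> sA sD AD hA hD; have s0 := @subspace0 _ _ iota K^o.
apply/seteqP; split=> // x Dx.
have [m _ hDA] : exists2 m, (m <= d)%N & dimK D A m.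
  apply: (dim_le_dim_eq sD sA); apply: dim_le_mono (dim_eq_le s0 hD) => //.
  by move=> _ ->; case: sA.
have A0 : [set 0] `<=` A by move=> _ ->; case: sA.
have := dim_eq_uniq s0 hD (dim_eq_add sA s0 AD A0 hDA hA).
move=> /eqP; rewrite -{1}[d]add0n eqn_add2r => /eqP m0; subst m.
by have [e [_ _ /(_ x Dx)[c]]] := hDA; rewrite /lincomb big_ord0 subr0.
Qed.

Lemma proper_dim A D d x : subK A -> subK D -> A `<=` D -> D x -> ~ A x ->
  dimK D [set 0] d -> exists2 n, (n < d)%N & dimK A [set 0] n.
Proof.
move=> sA sD AD Dx nx hD; have [n nd hA] := sub_dim_eq sA AD hD; exists n => //.
rewrite ltn_neqAle nd andbT; apply/eqP => nE; apply: nx; subst n.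
by rewrite (sub_full sA sD AD hA hD).
Qed.

(** The span of the geometric progression b, b z, ..., b z^(n-1); [n] counts the terms. *)
Definition polys_at (b z : K) (n : nat) : set K :=
  [set x | exists2 p : {poly k}, (size p <= n)%N & x = b * peval iota p z].

Lemma polys_at_subspace b z n : subK (polys_at b z n).
Proof.
split; first by exists 0; rewrite ?size_poly0// peval0 mulr0.
move=> c _ _ [p sp ->] [q sq ->]; exists (c%:P * p + q).
  rewrite (leq_trans (size_polyD _ _))// geq_max sq andbT mul_polyC.
  exact: leq_trans (size_scale_leq _ _) sp.
by rewrite pevalD pevalM pevalC /GRing.scale/=; ring.
Qed.

Lemma mem_polys_at b z n i : (i < n)%N -> polys_at b z n (b * z ^+ i).
Proof. by move=> ni; exists 'X^i; rewrite ?pevalXn// size_polyXn. Qed.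

Lemma polys_at_sub b z n B : subK B -> (forall i, (i < n)%N -> B (b * z ^+ i)) ->
  polys_at b z n `<=` B.
Proof.
move=> sB h _ [p sp ->]; rewrite (pevalE _ _ sp) mulr_sumr.
apply: (@subspace_sum _ _ iota K^o) => // i _.
have -> : b * (iota p`_i * z ^+ i) = iota p`_i *: (b * z ^+ i : K^o).
  by rewrite /GRing.scale/=; ring.
by apply: (@subspaceZ _ _ iota K^o) => //; apply: h.
Qed.

Lemma polys_at_dim b z n : b != 0 -> ~ range iota z -> dimK (polys_at b z n) [set 0] n.
Proof.
move=> b0 nz.
have lE (c : 'I_n -> k) : lincomb iota c (fun i => b * z ^+ i : K^o) =
    b * peval iota (\poly_(i < n) (if insub i is Some j then c j else 0)) z.
  rewrite (@pevalE _ _ _ n) ?size_poly// mulr_sumr; apply: eq_bigr => i _.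
  by rewrite coef_poly ltn_ord valK /GRing.scale/=; ring.
exists (fun i => b * z ^+ i); split.
- by move=> i; exists 'X^i; rewrite ?pevalXn// size_polyXn.
- move=> c; rewrite lE => /eqP; rewrite mulf_eq0 (negbTE b0)/= => /eqP.
  move=> /(nonconst_transcendental nz) h i.
  have := congr1 (fun p : {poly k} => p`_i) h; rewrite coef0 coef_poly ltn_ord.
  by rewrite valK.
- move=> _ [p sp ->]; exists (fun i => p`_i); rewrite lE /=.
  suff -> : \poly_(i < n) (if insub i is Some j then p`_(j : 'I_n) else 0) = p by rewrite subrr.
  apply/polyP => i; rewrite coef_poly; case: ltnP => [ni|ni]; last first.
    by rewrite nth_default// (leq_trans sp).
  by rewrite insubT.
Qed.

(** For z nonconstant the elements b z^i are independent, too many for a finite-dimensional B. *)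
Lemma stable_const B z m : subK B -> dimK B [set 0] m.+1 ->
  (forall x, B x -> B (z * x)) -> range iota z.
Proof.
move=> sB hB zB; have [e [Be fe _]] := hB; set b := e ord0.
have b0 : b != 0.
  apply/eqP => b0; have := fe (fun i => (i == ord0)%:R).
  by rewrite lincomb_delta => /(_ b0 ord0)/eqP; rewrite eqxx oner_eq0.
have Bz i : B (b * z ^+ i).
  elim: i => [|i IH]; first by rewrite mulr1; apply: Be.
  by rewrite exprS mulrCA; apply: zB.
apply: contrapT => nz.
have sP := polys_at_subspace b z m.+2.
have sub : polys_at b z m.+2 `<=` B by apply: (polys_at_sub sB).
by have := dim_eq_le_dim sP sB sub (polys_at_dim m.+2 b0 nz) hB; rewrite ltnn.
Qed.

(** The case of a factor spanned by 1 and z. The elements of B that z keeps in B form a subspace B1,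
    proper because z is nonconstant, and of codimension at most dim D - dim B <= 1. Induction
    applies to B1 inside B, and z B1 supplies the last term. *)
Lemma two_dim_progression z : ~ range iota z -> forall m B D d, subK B -> subK D ->
  dimK B [set 0] m.+1 -> dimK D [set 0] d -> (d <= m.+2)%N ->
  B `<=` D -> (forall x, B x -> D (z * x)) ->
  exists2 b, b != 0 & B = polys_at b z m.+1.
Proof.
move=> nz; have s0 := @subspace0 _ _ iota K^o.
elim=> [|m IH] B D d sB sD hB hD dm BD zBD.
  have [e [Be fe _]] := hB; set b := e ord0.
  have b0 : b != 0.
    apply/eqP => b0; have := fe (fun i => (i == ord0)%:R).
    by rewrite lincomb_delta => /(_ b0 ord0)/eqP; rewrite eqxx oner_eq0.
  exists b => //; apply/esym; apply: (sub_full (polys_at_subspace _ _ _) sB _ (polys_at_dim 1 b0 nz) hB).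
  move=> _ [p sp ->]; rewrite (size1_polyC sp) pevalC mulrC.
  exact: (@subspaceZ _ _ iota K^o _ _ _ sB (Be ord0)).
pose B1 : set K := [set x | B x /\ B (z * x)].
have sB1 : subK B1.
  split; first by rewrite /B1 /= mulr0; case: sB.
  move=> c x y [Bx Bzx] [By Bzy]; have [_ h] := sB; split; first exact: h.
  by have := h c _ _ Bzx Bzy; congr B; rewrite /GRing.scale/=; ring.
have B1B : B1 `<=` B by move=> x [].
have [x Bx nB1x] : exists2 x, B x & ~ B1 x.
  apply: contrapT => h; apply: nz; apply: (stable_const sB hB) => x Bx.
  by apply: contrapT => nx; apply: h; exists x => // -[].
have [n1 n1m h1] := proper_dim sB1 sB B1B Bx nB1x hB.
have zB1 : [set 0] `<=` B1 by move=> _ ->; case: sB1.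
have zB : [set 0] `<=` B by move=> _ ->; case: sB.
have [q hq] : exists q, dimK D B q.
  have hDB : @dim_le _ _ iota K^o D B d by apply: dim_le_mono (dim_eq_le s0 hD).
  by have [q _ hq] := dim_le_dim_eq sD sB hDB; exists q.
have dE := dim_eq_uniq s0 hD (dim_eq_add sB s0 BD zB hq hB).
have hBB1 : @dim_le _ _ iota K^o B B1 q.
  apply: (@dim_le_image _ _ _ K^o K^o (fun x => z * x)) (dim_eq_le sB hq) => //.
    by move=> l c e _; rewrite -lincomb_mull.
  by move=> l c e Be hze; split=> //; apply: (@subspace_lincomb _ _ iota K^o).
have [q' qq hBB1'] := dim_le_dim_eq sB sB1 hBB1.
have mE := dim_eq_uniq s0 hB (dim_eq_add sB1 s0 B1B zB1 hBB1' h1).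
have n1E : n1 = m.+1 by lia.
subst n1; have [b b0 B1E] := IH B1 B m.+2 sB1 sB h1 hB (leqnn _) B1B (fun x h => h.2).
exists b => //; apply/esym.
apply: (sub_full (polys_at_subspace _ _ _) sB _ (polys_at_dim m.+2 b0 nz) hB).
have Bz i : (i < m.+1)%N -> B1 (b * z ^+ i).
  by move=> im; rewrite B1E; apply: mem_polys_at.
apply: (polys_at_sub sB) => -[|i] im.
  by apply: B1B; apply: Bz.
by rewrite exprS mulrCA; have [] := Bz i im.
Qed.

Lemma polys_at_shift b z c n : polys_at b (z - iota c) n `<=` polys_at b z n.
Proof.
move=> _ [p sp ->]; exists (p \Po ('X - c%:P)); last first.
  by rewrite /peval map_comp_poly rmorphB/= map_polyX map_polyC horner_comp
    [in RHS]hornerD hornerN hornerX hornerC.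
by rewrite size_comp_poly2 ?size_XsubC.
Qed.

(** Let a have the least valuation in A. Quotients x/a have residues in k, so the elements of larger
    valuation form a hyperplane. *)
Lemma hopf_step R A n : valuation_ring iota R -> R <> setT ->
  (forall x, R x -> exists c, max_ideal R (x - iota c)) ->
  subK A -> dimK A [set 0] n.+1 ->
  exists a, [/\ A a, a != 0, forall x, A x -> R (x / a),
    subK (A `&` [set x | max_ideal R (x / a)]) &
    dimK (A `&` [set x | max_ideal R (x / a)]) [set 0] n].
Proof.
move=> vR RT res sA hA; have s0 := @subspace0 _ _ iota K^o.
have lR := valuation_local vR; have sR := lR.1.
have [e [Ae fe se]] := hA.
have [a [a0 Aa ha]] : exists a, [/\ a != 0, A a & forall x, A x -> R (x / a)].
  case: (valuation_best (codom e) vR) => [e0|[a [a0 /codomP[i aE] ha]]].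
    have := fe (fun i => (i == ord0)%:R); rewrite lincomb_delta.
    by move=> /(_ (e0 _ (codom_f e _)) ord0)/eqP; rewrite eqxx oner_eq0.
  exists a; split=> //; first by rewrite aE.
  move=> x Ax; have [c /= /eqP] := se x Ax; rewrite subr_eq0 => /eqP ->.
  rewrite /lincomb mulr_suml; apply: (subalg_sum sR) => j _.
  rewrite /GRing.scale/= -mulrA; apply: (subalgM sR); first exact: (subalg_const sR).
  by apply: ha; apply: codom_f.
exists a; set A' := A `&` _.
have sA' : subK A'.
  split; first by split; [case: sA|rewrite /= mul0r; apply: (max_ideal0 sR)].
  move=> c x y [Ax mx] [Ay my]; split; first by have [_ h] := sA; apply: h.
  rewrite /= /GRing.scale/= mulrDl -mulrA; apply: lR.2 => //.
  by apply: (max_idealM sR) => //; apply: (subalg_const sR).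
have AA' : A' `<=` A by move=> x [].
have zA' : [set 0] `<=` A' by move=> _ ->; case: sA'.
split=> //; have [m _ hm] := sub_dim_eq sA' AA' hA.
suff h1 : dimK A A' 1.
  have := dim_eq_uniq s0 hA (dim_eq_add sA' s0 AA' zA' h1 hm).
  by rewrite add1n => -[->].
exists (fun=> a); split=> //.
- move=> c; rewrite /lincomb big_ord1 => -[_ /=]; rewrite /GRing.scale/= mulfK//.
  by move=> /(max_ideal_const sR) c0 i; rewrite (ord1 i).
- move=> x Ax; have [c mc] := res _ (ha x Ax); exists (fun=> c).
  rewrite /lincomb big_ord1; split.
    by apply: (@subspaceB _ _ iota K^o) => //; apply: (@subspaceZ _ _ iota K^o).
  by rewrite /= /GRing.scale/= mulrBl mulfK.
Qed.

Section WithPlace.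
Variable R : set K.
Hypotheses (vR : valuation_ring iota R) (RT : R <> setT).
Hypothesis res : forall x, R x -> exists c, max_ideal R (x - iota c).

Let sR : subalgebra iota R. Proof. by case: vR. Qed.
Let lR : local_ring iota R. Proof. exact: valuation_local. Qed.

(* Removing from A the elements of least valuation removes the least valuation from AB. *)
Lemma drop_lead A B D n m d : subK A -> subK B -> subK D ->
  (forall a b, A a -> B b -> D (a * b)) ->
  dimK A [set 0] n.+1 -> dimK B [set 0] m.+1 -> dimK D [set 0] d ->
  exists A' D' d', [/\ A' `<=` A /\ D' `<=` D, subK A' /\ subK D',
    forall a b, A' a -> B b -> D' (a * b),
    dimK A' [set 0] n & dimK D' [set 0] d' /\ (d' < d)%N].
Proof.
move=> sA sB sD AB hA hB hD.
have [a [Aa a0 ha sA' hA']] := hopf_step vR RT res sA hA.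
have [b [Bb b0 hb _ _]] := hopf_step vR RT res sB hB.
pose D' := D `&` [set x | max_ideal R (x / (a * b))].
have sD' : subK D'.
  split; first by split; [case: sD|rewrite /= mul0r; apply: (max_ideal0 sR)].
  move=> c x y [Dx mx] [Dy my]; split; first by have [_ h] := sD; apply: h.
  rewrite /= /GRing.scale/= mulrDl -mulrA; apply: lR.2 => //.
  by apply: (max_idealM sR) => //; apply: (subalg_const sR).
have D'D : D' `<=` D by move=> x [].
have nab : ~ D' (a * b).
  by move=> [_ /=]; rewrite mulfV ?mulf_neq0// => /(max_ideal1 sR).
have [d' dd hD'] := proper_dim sD' sD D'D (AB _ _ Aa Bb) nab hD.
pose A' := A `&` [set x | max_ideal R (x / a)].
have AB' x y : A' x -> B y -> D' (x * y).
  move=> [Ax mx] By; split; first exact: AB.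
  rewrite /=; have -> : x * y / (a * b) = (y / b) * (x / a) by field; rewrite ?a0 ?b0.
  by apply: (max_idealM sR) => //; apply: hb.
by exists A', D', d'; split=> //; split=> // x [].
Qed.

(** Each of n applications of [drop_lead] costs one dimension of A and at least one of D. *)
Lemma drop_to_two A B D n m d : subK A -> subK B -> subK D ->
  (forall a b, A a -> B b -> D (a * b)) ->
  dimK A [set 0] n.+2 -> dimK B [set 0] m.+1 -> dimK D [set 0] d -> (d <= n + m.+2)%N ->
  exists A' D' d', [/\ subK D', forall a b, A' a -> B b -> D' (a * b),
    dimK A' [set 0] 2, dimK D' [set 0] d' & (d' <= m.+2)%N].
Proof.
move=> + sB + + + hB; elim: n A D d => [|n IH] A D d sA sD AB hA hD dd.
  by exists A, D, d.
have [A' [D' [d' [_ [sA' sD'] AB' hA' [hD' dd']]]]] := drop_lead sA sB sD AB hA hB hD.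
by apply: (IH A' D' d') => //; lia.
Qed.

(** If z is in R its residue is subtracted, which leaves the span unchanged; otherwise the
    progression is read backwards with ratio 1/z. *)
Lemma polys_at_place b z m : b != 0 -> ~ range iota z ->
  exists b' w, [/\ b' != 0, ~ range iota w, max_ideal R w & polys_at b z m.+1 = polys_at b' w m.+1].
Proof.
move=> b0 nz; have [Rz|nRz] := pselect (R z).
  have [c mc] := res Rz; exists b, (z - iota c); split=> //.
    by move=> [d _ dE]; apply: nz; exists (d + c); rewrite // rmorphD dE subrK.
  apply/seteqP; split; last exact: polys_at_shift.
  have -> : polys_at b z m.+1 = polys_at b (z - iota c - iota (- c)) m.+1.
    by rewrite rmorphN opprK subrK.
  exact: polys_at_shift.
have [z0 mz] := valuation_nonunit vR nRz.
have bz0 : b * z ^+ m != 0 by rewrite mulf_neq0 ?expf_neq0.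
have nzV : ~ range iota z^-1.
  by move=> [d _ dE]; apply: nz; exists d^-1; rewrite // fmorphV dE invrK.
exists (b * z ^+ m), z^-1; split=> //.
apply/esym; apply: (sub_full (polys_at_subspace _ _ _) (polys_at_subspace _ _ _) _
  (polys_at_dim _ bz0 nzV) (polys_at_dim _ b0 nz)).
apply: (polys_at_sub (polys_at_subspace _ _ _)) => i im.
have -> : b * z ^+ m * z^-1 ^+ i = b * z ^+ (m - i).
  have -> : z ^+ m = z ^+ (m - i) * z ^+ i by rewrite -exprD subnK.
  by rewrite exprVn; field; rewrite expf_neq0.
by apply: mem_polys_at; rewrite ltnS leq_subr.
Qed.

(* The equality case of Hopf's inequality dim AB >= dim A + dim B - 1. *)
Lemma linear_vosper A B D n m : subK A -> subK B -> subK D ->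
  (forall a b, A a -> B b -> D (a * b)) ->
  dimK A [set 0] n.+2 -> dimK B [set 0] m.+2 -> dimK D [set 0] (n + m.+3) ->
  exists s z, [/\ s != 0, ~ range iota z & D = polys_at s z (n + m.+3)].
Proof.
move=> sA sB sD AB hA hB hD.
have [A' [D' [d' [sD' AB' hA' hD' d'm]]]] := drop_to_two sA sB sD AB hA hB hD (leqnn _).
have [e [Ae fe _]] := hA'; set e0 := e ord0; set e1 := e (lift ord0 ord0).
have li c0 c1 : iota c0 * e0 + iota c1 * e1 = 0 -> c0 = 0 /\ c1 = 0.
  move=> h; have h2 := fe (fun i => if i == ord0 then c0 else c1).
  have {h2} h3 : forall i : 'I_2, (if i == ord0 then c0 else c1) = 0.
    by apply: h2; rewrite /lincomb big_ord_recl big_ord1.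
  by split; [have := h3 ord0|have := h3 (lift ord0 ord0)].
have e00 : e0 != 0.
  apply/eqP => e00; have [|/eqP] := li 1 0; last by rewrite oner_eq0.
  by rewrite e00 mulr0 rmorph0 mul0r addr0.
pose z := e1 / e0; have nz : ~ range iota z.
  move=> [c _ cE]; have [|_ /eqP] := li c (-1); last by rewrite oppr_eq0 oner_eq0.
  by rewrite cE /z divfK// rmorphN1 mulN1r subrr.
have e0V : e0^-1 != 0 by rewrite invr_eq0.
(* A' is spanned by e0 and z e0, so B and zB both lie in e0^-1 D'. *)
have [||b b0 BE] := two_dim_progression nz sB (scale_subspace e0^-1 sD') hB (dim_scale0 e0V hD') d'm.
- by move=> x Bx; apply/(scaleP _ _ e0V); rewrite invrK; exact: AB' (Ae _) Bx.
- move=> x Bx; apply/(scaleP _ _ e0V); rewrite invrK.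
  have -> : e0 * (z * x) = e1 * x by rewrite /z; field.
  exact: AB' (Ae _) Bx.
have [b' [w [b'0 nw mw BE']]] := polys_at_place m.+1 b0 nz.
rewrite BE' in BE; have w0 : w != 0 by apply/eqP => w0; apply: nw; exists 0; rewrite ?rmorph0.
have [a [Aa a0 ha _ _]] := hopf_step vR RT res sA hA.
pose v j := a * (b' * w ^+ j); have v0 j : v j != 0 by rewrite !mulf_neq0 ?expf_neq0.
(* The roles are exchanged: v_j is the least valuation occurring in A b' w^j. Passing from Dj j to
   Dj (j+1) loses v_j, so dim Dj m <= n + 3. This space contains A b' w^m and A b' w^(m+1), so A is
   a progression with the same ratio w. *)
pose Dj j := D `&` [set x | R (x / v j)].
have sDj j : subK (Dj j).
  split; first by split; [case: sD|rewrite /= mul0r; apply: (subalg0 sR)].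
  move=> c x y [Dx mx] [Dy my]; split; first by have [_ h] := sD; apply: h.
  rewrite /= /GRing.scale/= mulrDl -mulrA; apply: (subalgD sR) => //.
  by apply: (subalgM sR) => //; apply: (subalg_const sR).
have Rw : R w := max_ideal_sub mw.
have [dm dmE hdm] : exists2 dm, (dm + m <= n + m.+3)%N & dimK (Dj m) [set 0] dm.
  suff : forall j, (j <= m)%N -> exists2 dj, (dj + j <= n + m.+3)%N & dimK (Dj j) [set 0] dj.
    exact.
  elim=> [_|j IH jm].
    by have [dj h1 h2] := sub_dim_eq (sDj 0%N) (fun x h => h.1) hD; exists dj; rewrite ?addn0.
  have [dj h1 h2] := IH (ltnW jm).
  have [|||n1 h3 h4] := @proper_dim (Dj j.+1) (Dj j) dj (v j) (sDj _) (sDj _) _ _ _ h2.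
  - move=> x [Dx hx]; split=> //=.
    have -> : x / v j = w * (x / v j.+1).
      by rewrite /v exprS; field; rewrite ?oner_neq0 ?a0 ?b'0 ?w0 ?expf_neq0.
    exact: (subalgM sR).
  - split; last by rewrite /= mulfV//; apply: (subalg1 sR).
    by apply: AB => //; rewrite BE; apply: mem_polys_at; lia.
  - move=> [_ /=]; have -> : v j / v j.+1 = w^-1.
      by rewrite /v exprS; field; rewrite ?oner_neq0 ?a0 ?b'0 ?w0 ?expf_neq0.
    exact: max_ideal_not_unit.
  by exists n1 => //; lia.
have u0 : (b' * w ^+ m)^-1 != 0 by rewrite invr_eq0 mulf_neq0 ?expf_neq0.
have inD x i : A x -> (m <= i)%N -> (i < m.+2)%N -> Dj m (x * (b' * w ^+ i)).
  move=> Ax mi im; split; first by apply: AB => //; rewrite BE; apply: mem_polys_at.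
  rewrite /= -(subnK mi) exprD.
  have -> : x * (b' * (w ^+ (i - m) * w ^+ m)) / v m = w ^+ (i - m) * (x / a).
    by rewrite /v; field; rewrite ?oner_neq0 ?a0 ?b'0 ?w0 ?expf_neq0.
  by apply: (subalgM sR); [apply: (subalgX sR)|apply: ha].
have [|||a' a'0 AE] := two_dim_progression nw sA (scale_subspace (b' * w ^+ m)^-1 (sDj m)) hA (dim_scale0 u0 hdm).
- lia.
- by move=> x Ax; apply/(scaleP _ _ u0); rewrite invrK mulrC; apply: inD.
- move=> x Ax; apply/(scaleP _ _ u0); rewrite invrK.
  have -> : b' * w ^+ m * (w * x) = x * (b' * w ^+ m.+1) by rewrite exprS; ring.
  by apply: inD.
exists (a' * b'), w; split=> //; first by rewrite mulf_neq0.
have ab0 : a' * b' != 0 by rewrite mulf_neq0.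
apply/esym; apply: (sub_full (polys_at_subspace _ _ _) sD _ (polys_at_dim _ ab0 nw) hD).
apply: (polys_at_sub sD) => i im.
have [iE i1 i2] : [/\ i = (minn i n.+1 + (i - minn i n.+1))%N, (minn i n.+1 < n.+2)%N &
    (i - minn i n.+1 < m.+2)%N] by split; lia.
have -> : a' * b' * w ^+ i = (a' * w ^+ minn i n.+1) * (b' * w ^+ (i - minn i n.+1)).
  by rewrite {1}iE exprD; ring.
by apply: AB; [rewrite AE|rewrite BE]; apply: mem_polys_at.
Qed.

End WithPlace.

End LinearVosper.

(** * Multiplication of sections *)

(** Stalks of omega^n: modulo torsion, the symmetric power of a fractional ideal is its n-th power
    inside K. *)
Fixpoint mod_power (K : fieldType) (w : set K -> set K) (n : nat) (P : set K) : set K :=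
  if n is m.+1 then prodset (w P) (mod_power w m P) else P.

(** The image of Sym^n S in K. *)
Fixpoint sec_power (k : closedFieldType) (K : fieldType) (iota : {rmorphism k -> K})
    (S : set K) (n : nat) : set K :=
  if n is m.+1 then prodset S (sec_power iota S m) else range iota.

(** Independent forms take prescribed values jointly. By induction vectors dual to all forms but one
    exist; if the remaining form vanished on the common kernel of the others, it would be a
    combination of them. *)
Lemma dual_vectors (k : closedFieldType) (K : fieldType) (iota : {rmorphism k -> K})
    (E : lmodType K) (A : set E) N (phi : 'I_N -> E -> k) : subspace iota A ->
  (forall i a x y, A x -> A y -> phi i (iota a *: x + y) = a * phi i x + phi i y) ->
  (forall c : 'I_N -> k, (forall x, A x -> \sum_i c i * phi i x = 0) -> forall i, c i = 0) ->
  forall v : 'I_N -> k, exists x, A x /\ forall i, phi i x = v i.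
Proof.
move=> sA; elim: N phi => [|N IH] phi lphi ind v.
  by exists 0; split=> [|[]]; case: sA.
pose psi i := phi (lift ord0 i).
have {}IH : forall v : 'I_N -> k, exists x, A x /\ forall i, psi i x = v i.
  apply: IH => [i a x y|c hc i]; first exact: lphi.
  have := ind (fun j => if unlift ord0 j is Some i then c i else 0) _ (lift ord0 i).
  rewrite liftK; apply=> x Ax; rewrite big_ord_recl unlift_none mul0r add0r.
  by rewrite -[RHS](hc x Ax); apply: eq_bigr => j _; rewrite liftK.
have [x hx] := choice (fun j : 'I_N => IH (fun i => (i == j)%:R)).
have [be [Abe psibe phibe]] : exists be, [/\ A be, forall i, psi i be = 0 & phi ord0 be != 0].
  apply: contrapT => h.
  have key y : A y -> phi ord0 y = \sum_j psi j y * phi ord0 (x j).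
    move=> Ay; pose z := iota (-1) *: lincomb iota (fun j => psi j y) x + y.
    have Ax : A (lincomb iota (fun j => psi j y) x).
      by apply: subspace_lincomb => // j; have [] := hx j.
    have Az : A z by have [_ hA] := sA; apply: hA.
    have : phi ord0 z = 0.
      apply: contrapT => /eqP z0; apply: h; exists z; split=> // i.
      rewrite /z /psi lphi// (form_lincomb _ sA (lphi _)) => [|j]; last by have [] := hx j.
      rewrite (bigD1 i)//= big1 ?addr0 => [|j ji].
        have [_ h1] := hx i; rewrite (h1 i : phi (lift ord0 i) (x i) = _).
        by rewrite eqxx mulr1 mulN1r addNr.
      have [_ h1] := hx j; rewrite (h1 i : phi (lift ord0 i) (x j) = _).
      by rewrite eq_sym (negbTE ji) mulr0.
    rewrite /z lphi// (form_lincomb _ sA (lphi _)) => [|j]; last by have [] := hx j.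
    by rewrite mulN1r addrC => /eqP; rewrite subr_eq0 => /eqP.
  have := ind (fun j => if unlift ord0 j is Some i then - phi ord0 (x i) else 1) _ ord0.
  rewrite unlift_none => /(_ _)/eqP; rewrite oner_eq0 => h1; apply: notF; apply: h1 => y Ay.
  rewrite big_ord_recl unlift_none mul1r key// -[RHS](subrr (\sum_j psi j y * phi ord0 (x j))).
  congr (_ + _); rewrite -sumrN; apply: eq_bigr => j _.
  by rewrite liftK mulNr mulrC.
have [y [Ay hy]] := IH (fun i => v (lift ord0 i)).
exists (iota ((v ord0 - phi ord0 y) / phi ord0 be) *: be + y); split.
  by have [_ hA] := sA; apply: hA.
move=> i; rewrite lphi//; case: (unliftP ord0 i) => [j|] ->.
  by rewrite -/(psi j be) psibe mulr0 add0r; apply: hy.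
by rewrite divfK// subrK.
Qed.

Section Multiplication.
Variables (k : closedFieldType) (K : fieldType) (iota : {rmorphism k -> K}).
Variable C : set (set K).
Hypothesis hC : complete_curve iota C.
Notation cp := (closed_points C).
Variables (w : set K -> set K) (t : (set K -> K^o) -> k).
Hypothesis hw : canonical_sheaf iota C w t.
Hypothesis nHG : ~ (hyperelliptic iota C /\ forall P, cp P -> exists e, w P = scale e P).

Notation S := (global_sections C (w : set K -> set K^o)).
Notation wn := (mod_power w).
Notation Om n := (global_sections C (wn n : set K -> set K^o)).

Let gw : good_sheaf C w. Proof. by case: hw. Qed.
Let fw P : cp P -> fracideal P (w P). Proof. by case: gw => h _; apply: h. Qed.
Let w0 P : cp P -> w P 0. Proof. by move=> cP; apply: (fracideal0 hC cP (fw cP)). Qed.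
Let wD P x y : cp P -> w P x -> w P y -> w P (x + y).
Proof. by move=> cP; have [h _ _] := fw cP; apply: h. Qed.
Let wM P a x : cp P -> P a -> w P x -> w P (a * x).
Proof. by move=> cP; have [_ h _] := fw cP; apply: h. Qed.
Let tD c al be : adele C al -> adele C be -> t (iota c *: al + be) = c * t al + t be.
Proof. by case: hw => _ [h _ _] _ _; apply: h. Qed.
Let tK x : t (fun=> x) = 0.
Proof. by case: hw => _ [_ h _] _ _; apply: h. Qed.
Let tw al : (forall P, cp P -> w P (al P)) -> t al = 0.
Proof. by case: hw => _ [_ _ h] _ _; apply: h. Qed.
Let tsep F al : good_sheaf C F -> adele C al ->
  (forall h, (forall P f, cp P -> F P f -> w P (h * f)) -> t (fun P => h * al P) = 0) ->
  exists x, forall P, cp P -> F P (al P - x).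
Proof. by case: hw => _ _ h _; apply: h. Qed.
Let tuniq h : (forall al, adele C al -> t (fun P => h * al P) = 0) -> h = 0.
Proof. by case: hw => _ _ _; apply. Qed.

Let sS : @subspace _ _ iota K^o S. Proof. exact: (sections_subspace hC hw). Qed.

Lemma good_mod_power n : good_sheaf C (wn n).
Proof.
elim: n => [|n IH]; first exact: (good_structure hC).
exact: (good_prod hC).
Qed.

Lemma mod_power1 P : cp P -> wn 1 P = w P.
Proof. by move=> cP; apply: (prodset_unit hC cP); apply: fw. Qed.

Lemma t_mull (al : set K -> K^o) c x y : adele C al ->
  t (fun P => (iota c *: (x : K^o) + y) * al P) =
  c * t (fun P => x * al P) + t (fun P => y * al P).
Proof.
move=> ha; rewrite -tD; try exact: (adele_mul hC).
by congr t; apply/funext => P; rewrite !fctE /GRing.scale/=; ring.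
Qed.

Lemma sections_pow_subspace n : @subspace _ _ iota K^o (Om n).
Proof. by apply: H0_subspace => P cP; apply: (good_subspace hC (good_mod_power n)). Qed.

(* A section of omega^(n+1) outside S Omega_n is detected by a class in H^1(Hom(omega^(n+1), omega))
   that is annihilated by S. *)
Lemma exists_class n f0 : Om n.+1 f0 -> ~ prodset S (Om n) f0 -> exists al, [/\ adele C al,
  forall s h, S s -> Om n h -> t (fun P => h * (s * al P)) = 0 & t (fun P => f0 * al P) != 0].
Proof.
move=> Of0 nf0; set T := prodset S (Om n) in nf0.
have sT : @subspace _ _ iota K^o T.
  split; first exact: prodset0.
  move=> c x y Tx Ty; apply: prodsetD => //; apply: prodset_mull => // a Sa.
  exact: (@subspaceZ _ _ iota K^o _ _ _ sS Sa).
have TO : T `<=` Om n.+1.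
  apply: prodset_sub; first by case: (sections_pow_subspace n.+1).
    by move=> x y; apply: (@subspaceD _ _ iota K^o); apply: sections_pow_subspace.
  by move=> s h Ss Oh P cP; apply: prodset_mem; [apply: Ss|apply: Oh].
have [lam [lamD lamT lamf0]] := @separating_form _ _ iota K^o T f0 sT nf0.
have [N hN] := H0_finite hC (good_mod_power n.+1).
have s0 := @subspace0 _ _ iota K^o.
have [N' _ [e [Oe fe se]]] := dim_le_dim_eq (sections_pow_subspace n.+1) s0 hN.
pose E : lmodType K := (set K -> K^o).
have sad : @subspace _ _ iota E (adele C).
  by split; [exact: (adele_const hC 0)|move=> c al be ha hb; apply: (adele_lin hC)].
(* lam vanishes on S Om_n and is 1 at f0. The forms that send al to t(e_i al), for a basis e of the
   sections of omega^(n+1), are independent because t is nondegenerate, so some adele realizes the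
   values of lam on this basis. *)
have [||al [ha hal]] := @dual_vectors _ _ iota E (adele C) N'
    (fun i al => t (fun P => e i * al P)) sad _ _ (fun i => lam (e i)).
- by move=> i a x y hx hy; apply: (t_form hC hw).
- move=> c hc; apply: fe; apply: tuniq => al ha.
  rewrite (@form_lincomb _ _ iota K^o setT (fun f => t (fun P => f * al P)))//.
    exact: hc.
  by move=> a x y _ _; apply: t_mull.
have key f : Om n.+1 f -> t (fun P => f * al P) = lam f.
  move=> Of; have [c /= /eqP] := se f Of; rewrite subr_eq0 => /eqP ->.
  rewrite (@form_lincomb _ _ iota K^o setT (fun f => t (fun P => f * al P)))//; last first.
    by move=> a x y _ _; apply: t_mull.
  rewrite (@form_lincomb _ _ iota K^o setT lam)//; first by apply: eq_bigr => i _; rewrite hal.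
exists al; split=> //.
  move=> s h Ss Oh; have Tsh : T (s * h) by apply: prodset_mem.
  rewrite -(lamT _ Tsh) -(key _ (TO _ Tsh)); congr t; apply/funext => P; ring.
by rewrite key// lamf0 oner_neq0.
Qed.

Section Class.
Variables (m : nat) (al : set K -> K^o).
Hypothesis ha : adele C al.
Hypothesis hal : forall s h, S s -> Om m h -> t (fun P => h * (s * al P)) = 0.

(** By reflexivity the multipliers from Hom(omega^m, omega) to omega are the elements of omega^m. As
    s al is killed by all of Om_m, it is zero in H^1(Hom(omega^m, omega)). *)
Lemma class_lift s : S s -> exists x, forall P, cp P -> forall g, wn m P g -> w P ((s * al P - x) * g).
Proof.
move=> Ss; have gM := good_colon hC gw (good_mod_power m).
have [|x hx] := tsep gM (adele_mul hC s ha); last by exists x.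
move=> h hh; apply: hal => // P cP.
have [fwn _] := good_mod_power m.
apply: (canonical_reflexive hC hw cP (fwn P cP)) => h' hh'; rewrite mulrC; apply: hh => //.
Qed.

(** S generates omega, so phi - al multiplies omega^(m+1) into omega. Hence f al differs from the
    constant f phi by an adele with values in omega, and t kills both. *)
Lemma class_trivial phi f :
  (forall s P g, S s -> cp P -> wn m P g -> w P ((phi * s - s * al P) * g)) ->
  Om m.+1 f -> t (fun P => f * al P) = 0.
Proof.
move=> hphi Of.
have hf P : cp P -> w P (f * (phi - al P)).
  move=> cP; have [fwn _] := good_mod_power m; have [_ wnM _] := fwn P cP.
  have := Of P cP; move: f {Of}.
  apply: (@prodset_sub _ _ _ (fun f => w P (f * (phi - al P)))); first by rewrite mul0r; apply: w0.
    by move=> x y hx hy; rewrite mulrDl; apply: wD.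
  move=> a b; rewrite {1}(canonical_generated hC hw nHG cP) => + wb; move: a.
  apply: (@prodset_sub _ _ _ (fun a => w P (a * b * (phi - al P)))).
  - by rewrite !mul0r; apply: w0.
  - by move=> x y hx hy; rewrite !mulrDl; apply: wD.
  move=> s p Ss Pp; have -> : s * p * b * (phi - al P) = (phi * s - s * al P) * (p * b) by ring.
  by apply: hphi => //; apply: wnM.
have -> : (fun P => f * al P) =
    iota (-1) *: (fun P => f * (phi - al P) : K^o) + (fun=> f * phi).
  by apply/funext => P; rewrite !fctE rmorphN1 scaleN1r; ring.
rewrite tD ?tK ?tw ?mulr0 ?addr0//; last exact: (adele_const hC).
exact: (adele_good gw).
Qed.

(** (y s - x u) g = (s al - x) (u g) - (u al - y) (s g): al cancels, and multiplying g by a section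
    raises the power of omega by one, which is why the commutator acts on one power less. *)
Lemma class_commutator s u x y : S s -> S u ->
  (forall P, cp P -> forall g, wn m P g -> w P ((s * al P - x) * g)) ->
  (forall P, cp P -> forall g, wn m P g -> w P ((u * al P - y) * g)) ->
  forall j P g, m = j.+1 -> cp P -> wn j P g -> w P ((y * s - x * u) * g).
Proof.
move=> Ss Su hx hy j P g mj cP wg; have wmul v : S v -> wn m P (v * g).
  by move=> Sv; rewrite mj; apply: prodset_mem => //; apply: Sv.
have -> : (y * s - x * u) * g = (s * al P - x) * (u * g) + (-1) * ((u * al P - y) * (s * g)).
  by ring.
apply: wD => //; first by apply: hx => //; apply: wmul.
apply: wM => //; last by apply: hy => //; apply: wmul.
by apply: (subalgN (cp_subalg hC cP)); apply: (subalg1 (cp_subalg hC cP)).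
Qed.

End Class.

Lemma multiplier_const y : (forall P f, cp P -> w P f -> w P (y * f)) -> range iota y.
Proof. by move=> h; apply: (End_const hC gw) => P f cP; apply: h. Qed.

(** y s1^(j+1) and y s1^j s2 multiply omega into itself and are therefore constants; if y were
    nonzero, so would be their quotient s2/s1. *)
Lemma multiplier_zero j y s1 s2 : S s1 -> S s2 -> s1 != 0 -> ~ range iota (s2 / s1) ->
  (forall P g, cp P -> wn j.+2 P g -> w P (y * g)) -> y = 0.
Proof.
move=> S1 S2 s10 ns hy; apply: contrapT => /eqP y0; apply: ns.
have wpow P f i : cp P -> wn i P f -> wn (j + i) P (s1 ^+ j * f).
  move=> cP wf; elim: (j) => [|l IH]; first by rewrite mul1r.
  by rewrite exprS -mulrA; apply: prodset_mem; [apply: S1|].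
have yc s : S s -> range iota (y * (s1 ^+ j * s)).
  move=> Ss; apply: multiplier_const => P f cP wf; rewrite -!mulrA; apply: hy => //.
  rewrite -addn2; apply: wpow => //; apply: prodset_mem; first exact: Ss.
  by rewrite -/(wn 1 P) mod_power1.
have [c1 _ e1] := yc _ S1; have [c2 _ e2] := yc _ S2.
exists (c2 / c1) => //; rewrite fmorph_div e1 e2; field.
by rewrite y0 s10 expf_neq0.
Qed.

Definition progression (S : set K) :=
  exists s z N, [/\ s != 0, ~ range iota z & S = polys_at iota s z N.+2].

Lemma dim_two_progression : @dim_eq _ _ iota K^o S [set 0] 2 -> progression S.
Proof.
move=> hS; have [e [Se fe _]] := hS; set e0 := e ord0; set e1 := e (lift ord0 ord0).
have li c0 c1 : iota c0 * e0 + iota c1 * e1 = 0 -> c0 = 0 /\ c1 = 0.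
  move=> h; have h2 := fe (fun i => if i == ord0 then c0 else c1).
  have {h2} h3 : forall i : 'I_2, (if i == ord0 then c0 else c1) = 0.
    by apply: h2; rewrite /lincomb big_ord_recl big_ord1.
  by split; [have := h3 ord0|have := h3 (lift ord0 ord0)].
have e00 : e0 != 0.
  apply/eqP => e00; have [|/eqP] := li 1 0; last by rewrite oner_eq0.
  by rewrite e00 mulr0 rmorph0 mul0r addr0.
pose z := e1 / e0; have nz : ~ range iota z.
  move=> [c _ cE]; have [|_ /eqP] := li c (-1); last by rewrite oppr_eq0 oner_eq0.
  by rewrite cE /z divfK// rmorphN1 mulN1r subrr.
exists e0, z, 0%N; split=> //; apply/esym.
apply: (sub_full (polys_at_subspace _ _ _ _) sS _ (polys_at_dim 2 e00 nz) hS).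
apply: (polys_at_sub sS) => -[|[|//]] _; first by rewrite mulr1; apply: Se.
by rewrite expr1 /z mulrC divfK//; apply: Se.
Qed.

Lemma two_sections g : @dim_eq _ _ iota K^o S [set 0] g.+2 ->
  exists s1 s2, [/\ S s1, S s2, s1 != 0 & ~ range iota (s2 / s1)].
Proof.
move=> [e [Se fe _]]; pose i1 : 'I_g.+2 := lift ord0 ord0; set e0 := e ord0; set e1 := e i1.
have li c0 c1 : iota c0 * e0 + iota c1 * e1 = 0 -> c0 = 0 /\ c1 = 0.
  move=> h; have h2 := fe (fun i => c0 * (i == ord0)%:R + c1 * (i == i1)%:R).
  have {h2} h3 : forall i : 'I_g.+2, c0 * (i == ord0)%:R + c1 * (i == i1)%:R = 0.
    by apply: h2; rewrite lincombD !lincombZ !lincomb_delta.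
  have := h3 i1; have := h3 ord0; rewrite !eqxx mulr1 mulr0 addr0 => -> /=.
  by rewrite mul0r mulr1 add0r => ->.
have e00 : e0 != 0.
  apply/eqP => e00; have [|/eqP] := li 1 0; last by rewrite oner_eq0.
  by rewrite e00 mulr0 rmorph0 mul0r addr0.
exists e0, e1; split; try exact: Se; first exact: e00.
move=> [c _ cE]; have [|_ /eqP] := li c (-1); last by rewrite oppr_eq0 oner_eq0.
by rewrite cE divfK// rmorphN1 mulN1r subrr.
Qed.

Lemma mult_high g j : @dim_eq _ _ iota K^o S [set 0] g.+2 -> Om j.+4 `<=` prodset S (Om j.+3).
Proof.
move=> hS f0 Of0; apply: contrapT => nf0.
have [al [ha hal tf0]] := exists_class Of0 nf0.
have [s1 [s2 [S1 S2 s10 ns]]] := two_sections hS.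
have [x hx] := class_lift ha hal S1.
(* When the commutators vanish, x_s / s does not depend on s, and its value at s1 serves as phi. *)
move/eqP: tf0; apply; apply: (class_trivial (m := j.+3) (phi := x / s1)) => //.
move=> s P g' Ss cP wg'; have [y hy] := class_lift ha hal Ss.
have /eqP : y * s1 - x * s = 0.
  apply: (multiplier_zero (j := j) S1 S2 s10 ns) => Q h cQ wh.
  exact: (class_commutator S1 Ss hx hy (erefl _) cQ wh).
rewrite subr_eq0 => /eqP yE.
have -> : (x / s1 * s - s * al P) * g' = (-1) * ((s * al P - y) * g').
  have -> : y = x / s1 * s by rewrite mulrAC -yE mulfK.
  by ring.
apply: wM => //; last exact: hy.
by apply: (subalgN (cp_subalg hC cP)); apply: (subalg1 (cp_subalg hC cP)).
Qed.

(* With beta(s, u) = x_u s - x_s u constant, the Pluecker relation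
   r beta(s, u) + s beta(u, r) + u beta(r, s) = 0 bounds dim S by 2 unless beta = 0. *)
Lemma mult_three g : @dim_eq _ _ iota K^o S [set 0] g.+2 ->
  Om 3 `<=` prodset S (Om 2) \/ progression S.
Proof.
move=> hS; case: g hS => [hS|g hS]; first by right; apply: dim_two_progression.
left=> f0 Of0; apply: contrapT => nf0.
have [al [ha hal tf0]] := exists_class Of0 nf0.
have /choice[x hx] : forall s, exists x, S s ->
    forall P, cp P -> forall g, wn 2 P g -> w P ((s * al P - x) * g).
  move=> s; have [Ss|nS] := pselect (S s); last by exists 0.
  by have [x hx] := class_lift ha hal Ss; exists x.
have beta s u : S s -> S u -> range iota (x u * s - x s * u).
  move=> Ss Su; apply: multiplier_const => P f cP wf.
  by apply: (class_commutator Ss Su (hx s Ss) (hx u Su) (erefl _) cP); rewrite mod_power1.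
have beta0 s u : S s -> S u -> x u * s - x s * u = 0.
  move=> Ss Su; apply: contrapT => /eqP b0; have [c _ cE] := beta _ _ Ss Su.
  have : @dim_le _ _ iota K^o S [set 0] 2.
    apply: (@dim_le_spans _ _ iota K^o _ _ _ (fun i : 'I_2 => if i == ord0 then s else u)).
      exact: subspace0.
    move=> r Sr; have [c1 _ c1E] := beta _ _ Su Sr; have [c2 _ c2E] := beta _ _ Sr Ss.
    exists (fun i => if i == ord0 then - (c1 / c) else - (c2 / c)).
    rewrite /lincomb big_ord_recl big_ord1 /GRing.scale/= !rmorphN !fmorph_div c1E c2E cE.
    by field.
  by move=> /(dim_eq_leq (@subspace0 _ _ iota K^o) hS).
have [s1 [_ [S1 _ s10 _]]] := two_sections hS.
move/eqP: tf0; apply; apply: (class_trivial (m := 2) (phi := x s1 / s1)) => //.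
move=> s P g' Ss cP wg'; move/eqP: (beta0 _ _ S1 Ss); rewrite subr_eq0 => /eqP yE.
have -> : (x s1 / s1 * s - s * al P) * g' = (-1) * ((s * al P - x s) * g').
  have -> : x s = x s1 / s1 * s by rewrite mulrAC -yE mulfK.
  by ring.
apply: wM => //; last exact: hx.
by apply: (subalgN (cp_subalg hC cP)); apply: (subalg1 (cp_subalg hC cP)).
Qed.

End Multiplication.

(** * The case n = 2: extensions of omega by O *)

Section Quadrics.
Variables (k : closedFieldType) (K : fieldType) (iota : {rmorphism k -> K}).
Variable C : set (set K).
Hypothesis hC : complete_curve iota C.
Notation cp := (closed_points C).
Variables (w : set K -> set K) (t : (set K -> K^o) -> k).
Hypothesis hw : canonical_sheaf iota C w t.
Hypothesis nHG : ~ (hyperelliptic iota C /\ forall P, cp P -> exists e, w P = scale e P).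

Notation S := (global_sections C (w : set K -> set K^o)).
Notation wn := (mod_power w).
Notation Om n := (global_sections C (wn n : set K -> set K^o)).

Let gw : good_sheaf C w. Proof. by case: hw. Qed.
Let fw P : cp P -> fracideal P (w P). Proof. by case: gw => h _; apply: h. Qed.
Let wD P x y : cp P -> w P x -> w P y -> w P (x + y).
Proof. by move=> cP; have [h _ _] := fw cP; apply: h. Qed.
Let wM P a x : cp P -> P a -> w P x -> w P (a * x).
Proof. by move=> cP; have [_ h _] := fw cP; apply: h. Qed.
Let sS : @subspace _ _ iota K^o S. Proof. exact: (sections_subspace hC hw). Qed.
Let s0 := @subspace0 _ _ iota K^o.

Lemma exists_place : exists R, [/\ valuation_ring iota R, R <> setT &
  forall x, R x -> exists c, max_ideal R (x - iota c)].
Proof.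
have [z nz] := exists_transcendental hC; have [R [vR _ nR]] := valuation_exists nz.
have RT : R <> setT by move=> RT; apply: nR; rewrite RT.
by exists R; split=> // x; apply: (valuation_residue hC.1).
Qed.

Notation E2 := ((K^o * K^o)%type : lmodType K).

Lemma lincomb_pair n (c : 'I_n -> k) (e : 'I_n -> E2) :
  lincomb iota c e = (lincomb iota c (fun i => (e i).1), lincomb iota c (fun i => (e i).2)) :> E2.
Proof.
rewrite [LHS]surjective_pairing; congr (_, _); rewrite /lincomb raddf_sum;
  by apply: eq_bigr.
Qed.

Section Extension.
Variables (al : set K -> K^o) (g : nat).
Hypothesis ha : adele C al.
Hypothesis hS : @dim_eq _ _ iota K^o S [set 0] g.+2.
Hypothesis lift : forall s, S s -> exists x, forall P, cp P -> P (s * al P - x).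

(* Global sections of the extension of omega by O defined by the class of al. *)
Definition ext_sections : set E2 := [set xs | S xs.2 /\ forall P, cp P -> P (xs.2 * al P - xs.1)].

Lemma ext_subspace : subspace iota ext_sections.
Proof.
split; first by split=> [|P cP]; [case: sS|rewrite /= mul0r subr0; apply: (subalg0 (cp_subalg hC cP))].
move=> c [x s] [y u] [/= Ss hs] [/= Su hu]; split; first by have [_ h] := sS; apply: h.
move=> P cP; have sP := cp_subalg hC cP.
have -> : (iota c *: ((x, s) : E2) + (y, u)).2 * al P - (iota c *: ((x, s) : E2) + (y, u)).1 =
  iota c * (s * al P - x) + (u * al P - y) by rewrite /= /GRing.scale/=; ring.
apply: (subalgD sP); last exact: hu.
by apply: (subalgM sP); [apply: (subalg_const sP)|apply: hs].
Qed.

(** The projection to S is onto by [lift], and its kernel is H^0(O) = k. *)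
Lemma ext_dim : dim_eq iota ext_sections [set 0] g.+3.
Proof.
have [e [Se fe se]] := hS.
have /choice[x hx] : forall i, exists x, forall P, cp P -> P (e i * al P - x).
  by move=> i; apply: lift.
pose W0 : set E2 := [set xs | exists c, xs = (iota c, 0)].
have sW0 : subspace iota W0.
  split; first by exists 0; rewrite rmorph0.
  move=> c _ _ [a ->] [b ->]; exists (c * a + b).
  by rewrite /GRing.scale/= /GRing.add/= /add_pair/= /GRing.scale/= mulr0 addr0 rmorphD rmorphM.
have dW0 : dim_eq iota W0 [set 0] 1.
  exists (fun=> (1, 0)); split.
  - by move=> _; exists 1; rewrite rmorph1.
  - move=> c; rewrite lincomb_pair /lincomb !big_ord1 => -[/eqP].
    by rewrite /GRing.scale/= mulr1 fmorph_eq0 => /eqP h _ i; rewrite (ord1 i).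
  - move=> _ [c ->]; exists (fun=> c); rewrite lincomb_pair /lincomb !big_ord1.
    by rewrite /GRing.scale/= mulr1 mulr0 subrr.
have W0W : W0 `<=` ext_sections.
  move=> _ [c ->]; split=> [|P cP] /=; first by case: sS.
  have sP := cp_subalg hC cP; rewrite mul0r; apply: (subalgB sP); first exact: (subalg0 sP).
  exact: (subalg_const sP).
have z0 : [set 0] `<=` W0 by move=> _ ->; case: sW0.
have dW : dim_eq iota ext_sections W0 g.+2.
  exists (fun i => (x i, e i)); split.
  - by move=> i; split; [apply: Se|move=> P cP; apply: hx].
  - by move=> c; rewrite lincomb_pair => -[b [_ h]]; apply: fe.
  - move=> [y s] [/= Ss hs]; have [c /= /eqP] := se s Ss; rewrite subr_eq0 => /eqP sE.
    exists c; rewrite lincomb_pair /=.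
    have [b _ bE] : range iota (y - lincomb iota c x).
      apply: (regular_const hC) => P cP; have sP := cp_subalg hC cP.
      have -> : y - lincomb iota c x = lincomb iota c (fun i => e i * al P - x i : K^o) - (s * al P - y).
        rewrite lincombBr sE; have -> : lincomb iota c (fun i => e i * al P : K^o) = lincomb iota c e * al P.
          by rewrite /lincomb mulr_suml; apply: eq_bigr => i _; rewrite /GRing.scale/=; ring.
        ring.
      apply: (subalgB sP); last exact: hs.
      apply: (@subspace_lincomb _ _ iota K^o); first exact: subalg_subspace.
      by move=> i; apply: hx.
    by exists b; rewrite bE sE /GRing.add/= /add_pair/= /GRing.opp/= subrr.
have := dim_eq_add sW0 (@subspace0 _ _ iota E2) W0W z0 dW dW0.
by rewrite addn1.
Qed.

Lemma ext_split_or_progression :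
  (exists phi, forall s P, S s -> cp P -> P (phi * s - s * al P)) \/ progression iota S.
Proof.
have [Q cQ] := exists_cp hC; have sQ := cp_subalg hC cQ; have lQ := cp_local hC cQ.
have [H [fH HM he mH H1]] := canonical_hyperplane hC hw cQ.
have [HD HZ _] := fH; have sH := fracideal_subspace hC cQ fH.
have sW := ext_subspace; have dW := ext_dim.
(* A section (x, a) is said to vanish at Q when a is in H and a al_Q - x is in m_Q. Each condition
   has codimension at most one, and there are at least three independent sections. *)
pose W1 : set E2 := [set xs | ext_sections xs /\ H xs.2].
have sW1 : subspace iota W1.
  split; first by split; [case: sW|case: sH].
  move=> c [x s] [y u] [hx Hs] [hy Hu]; split; first by have [_ h] := sW; apply: h.
  by have [_ h] := sH; apply: h.
pose W2 : set E2 := [set xs | W1 xs /\ max_ideal Q (xs.2 * al Q - xs.1)].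
have smQ := max_ideal_subspace lQ.
have sW2 : subspace iota W2.
  split; first by split; [case: sW1|rewrite /= mul0r subr0; apply: (max_ideal0 sQ)].
  move=> c [x s] [y u] [hx mx] [hy my]; split; first by have [_ h] := sW1; apply: h.
  have [_ h] := smQ; have := h c _ _ mx my; congr (max_ideal Q _).
  by rewrite /= /GRing.scale/=; ring.
have h1 : dim_le iota ext_sections W1 1.
  apply: (@dim_le_image _ _ iota E2 K^o (fun xs => xs.2)) H1.
  - by move=> m c e _; rewrite lincomb_pair.
  - by move=> [x s] [Ss _]; apply: Ss.
  - by move=> m c e he' hH; split=> //; apply: subspace_lincomb.
have hm1 : @dim_le _ _ iota K^o Q (max_ideal Q) 1.
  apply: (@dim_le_spans _ _ iota K^o _ _ _ (fun=> 1)) => // y Qy.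
  have [c mc] := cp_residue hC cQ Qy; exists (fun=> c).
  by rewrite /lincomb big_ord1 /GRing.scale/= mulr1.
have h2 : dim_le iota W1 W2 1.
  apply: (@dim_le_image _ _ iota E2 K^o (fun xs => xs.2 * al Q - xs.1)) hm1.
  - move=> m c e _; rewrite lincomb_pair /= lincombBr; congr (_ - _).
    by rewrite /lincomb mulr_suml; apply: eq_bigr => i _; rewrite /GRing.scale/=; ring.
  - by move=> [x s] [[_ h] _]; apply: h.
  - by move=> m c e he' hH; split=> //; apply: subspace_lincomb.
have [x [a [[[Wxa Ha] mxa] xa0]]] : exists x a, W2 (x, a) /\ ((x, a) : E2) <> 0.
  apply: contrapT => h; have W20 : W2 `<=` [set 0].
    by move=> [x a] hx; apply: contrapT => nx; apply: h; exists x, a.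
  have := dim_le_mono (@subset_refl _ _) W20 (dim_le_trans sW sW1 sW2 h1 h2).
  by move=> /(dim_eq_leq (@subspace0 _ _ iota E2) dW).
have Sa : S a by case: Wxa.
(* For a = 0 the section would be a constant of O vanishing at Q. *)
have a0 : a != 0.
  apply/eqP => a0; apply: xa0; rewrite a0; congr (_, _).
  have mx : max_ideal Q x.
    by move: mxa; rewrite /= a0 mul0r sub0r => /(max_idealN lQ); rewrite opprK.
  have [c _ cE] : range iota x.
    apply: (regular_const hC) => P cP; have [_ /(_ P cP)] := Wxa.
    by rewrite /= a0 mul0r sub0r => /(subalgN (cp_subalg hC cP)); rewrite opprK.
  by move: mx; rewrite -cE => /(max_ideal_const sQ) ->; rewrite rmorph0.
pose phi := x / a.
(* A describes the sections on the K-line through (x, a), and B the values on all sections of the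
   form y - phi s that cuts out this line. Rank and nullity give dim A + dim B = g + 3. *)
pose A : set K := [set s | ext_sections (phi * s, s)].
pose B : set K := [set b | exists y s, ext_sections (y, s) /\ b = y - phi * s].
pose Wp : set E2 := [set xs | ext_sections xs /\ xs.1 = phi * xs.2].
have sA : @subspace _ _ iota K^o A.
  split; first by rewrite /A /= mulr0; case: sW.
  move=> c s u hs hu; have [_ h] := sW; have := h c _ _ hs hu; rewrite /A /=.
  suff -> : iota c *: ((phi * s, s) : E2) + (phi * u, u) =
    (phi * (iota c *: (s : K^o) + u), iota c *: (s : K^o) + u) by [].
  by rewrite [LHS]surjective_pairing; congr (_, _); rewrite /= /GRing.scale/=; ring.
have sWp : subspace iota Wp.
  split; first by split; [case: sW|rewrite /= mulr0].
  move=> c [y s] [y' s'] [hs /= e1] [hs' /= e2]; split; first by have [_ h] := sW; apply: h.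
  by rewrite /= e1 e2 /GRing.scale/=; ring.
have sB : @subspace _ _ iota K^o B.
  split; first by exists 0, 0; split; [case: sW|rewrite mulr0 subr0].
  move=> c _ _ [y [s [hs ->]]] [y' [s' [hs' ->]]].
  exists (iota c * y + y'), (iota c * s + s'); split; first by have [_ h] := sW; apply: (h c _ _ hs hs').
  by rewrite /GRing.scale/=; ring.
have WpW : Wp `<=` ext_sections by move=> xs [].
have z0 : [set 0] `<=` Wp by move=> _ ->; case: sWp.
have sE0 := @subspace0 _ _ iota E2.
have [p _ dWp] : exists2 p, (p <= g.+3)%N & dim_eq iota Wp [set 0] p.
  by apply: (dim_le_dim_eq sWp sE0); apply: dim_le_mono (dim_eq_le sE0 dW).
have [q _ dWq] : exists2 q, (q <= g.+3)%N & dim_eq iota ext_sections Wp q.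
  by apply: (dim_le_dim_eq sW sWp); apply: dim_le_mono (dim_eq_le sE0 dW).
have pq := dim_eq_uniq sE0 dW (dim_eq_add sWp sE0 WpW z0 dWq dWp).
have dA : @dim_eq _ _ iota K^o A [set 0] p.
  have [e [We fe se]] := dWp; have e1 i : (e i).1 = phi * (e i).2 by have [] := We i.
  exists (fun i => (e i).2); split.
  - by move=> i; have [h _] := We i; rewrite /A /= -e1 -surjective_pairing.
  - move=> c hc; apply: fe; rewrite lincomb_pair /= (hc : _ = 0).
    congr (_, _); rewrite (_ : (fun i => (e i).1) = fun i => phi * (e i).2 : K^o); last exact/funext.
    by rewrite lincomb_mull (hc : _ = 0) mulr0.
  - move=> s hs; have [|c] := se (phi * s, s); first by [].
    by rewrite lincomb_pair => -[_ h]; exists c.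
have dB : @dim_eq _ _ iota K^o B [set 0] q.
  have [e [We fe se]] := dWq.
  have lE (c : 'I_q -> k) : lincomb iota c (fun i => (e i).1 - phi * (e i).2 : K^o) =
      lincomb iota c (fun i => (e i).1) - phi * lincomb iota c (fun i => (e i).2).
    by rewrite lincombBr lincomb_mull.
  exists (fun i => (e i).1 - phi * (e i).2); split.
  - by move=> i; exists (e i).1, (e i).2; rewrite -surjective_pairing.
  - move=> c hc; apply: fe; split; first exact: subspace_lincomb.
    rewrite lincomb_pair /=; apply/eqP; rewrite -subr_eq0 -lE; apply/eqP; exact: hc.
  - move=> _ [y [s [hs ->]]]; have [c [_ hc]] := se _ hs; exists c.
    rewrite lE /=; move: hc; rewrite lincomb_pair /= => hc.
    have -> : y - phi * s - (lincomb iota c (fun i => (e i).1) - phi * lincomb iota c (fun i => (e i).2))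
      = (y - lincomb iota c (fun i => (e i).1)) - phi * (s - lincomb iota c (fun i => (e i).2)) by ring.
    by apply/eqP; rewrite subr_eq0; apply/eqP.
(* u b is the determinant of the sections (y, s) and (phi u, u), and the determinant of the
   extension is omega. *)
have AB u b : A u -> B b -> S (u * b).
  move=> [Su hu] [y [s [[/= Ss hs] ->]]] P cP.
  have -> : u * (y - phi * s) = (- (s * al P - y)) * u + (u * al P - phi * u) * s by ring.
  apply: wD => //; apply: wM => //; try by [apply: Su|apply: Ss].
    by apply: (subalgN (cp_subalg hC cP)); apply: hs.
  exact: hu.
have Aa : A a by rewrite /A /= /phi divfK.
have B1 : B 1.
  exists 1, 0; rewrite mulr0 subr0; split=> //; split=> [|P cP] /=; first by case: sS.
  have sP := cp_subalg hC cP; rewrite mul0r; apply: (subalgB sP).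
    exact: (subalg0 sP).
  exact: (subalg1 sP).
case: p dWp pq dA => [|[|p]] dWp pq dA.
- have [e [_ _ /(_ a Aa)[c]]] := dA; rewrite /lincomb big_ord0 subr0 => /eqP.
  by rewrite (negbTE a0).
(* If A is a line, then S = a B by dimension. Since (x, a) vanishes at Q, all of a B would lie in H,
   against [hyperplane_sections]. *)
- have [e [Ae fe se]] := dA.
  have qE : q = g.+2 by lia.
  subst q; have saB := @scale_subspace _ _ iota a B sB.
  have aBS : scale a B `<=` S by move=> _ [b Bb <-]; apply: AB.
  have SE := sub_full saB sS aBS (dim_scale0 a0 dB) hS.
  have [y Sy nHy] := hyperplane_sections hC hw nHG cQ fH HM mH he.
  case: nHy; move: Sy; rewrite -SE => -[_ [y' [s [[/= Ss hs] ->]]] <-].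
  have -> : a * (y' - phi * s) = (- (s * al Q - y')) * a + (a * al Q - x) * s.
    by rewrite /phi; field.
  apply: HD; last by apply: mH => //; apply: Ss.
  by apply: HZ => //; apply: (subalgN sQ); apply: hs.
case: q dWq pq dB => [|[|q]] dWq pq dB.
- have [e [_ _ /(_ 1 B1)[c]]] := dB; rewrite /lincomb big_ord0 subr0 => /eqP.
  by rewrite oner_eq0.
(* If B is a line, it consists of the constants, since 1 is in it. So every lift y of s differs from
   phi s by a constant, and phi splits the extension. *)
- left; exists phi => s P Ss cP; have sP := cp_subalg hC cP.
  have [y hy] := lift Ss; have [e [Be fe se]] := dB.
  have Bs : B (y - phi * s) by exists y, s.
  have [c1 /= h1'] := se _ B1; have [c2 /= h2'] := se _ Bs.
  move: h1' h2'; rewrite /lincomb !big_ord1 /GRing.scale/= => /eqP; rewrite subr_eq0 => /eqP h1'.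
  move=> /eqP; rewrite subr_eq0 => /eqP h2'.
  have c10 : iota (c1 ord0) != 0 by apply: contraPneq h1' => ->; rewrite mul0r; apply/eqP; exact: oner_neq0.
  have eE : e ord0 = (iota (c1 ord0))^-1 by rewrite -[LHS](mulKf c10) -h1' mulr1.
  have -> : phi * s - s * al P = - (y - phi * s) - (s * al P - y) by ring.
  apply: (subalgB sP); last exact: hy.
  rewrite h2' eE -fmorphV; apply: (subalgN sP); apply: (subalgM sP); exact: (subalg_const sP).
(* Both dimensions are now at least 2, namely p + 2 and q + 2, while dim S = p + q + 3. *)
right; have [R [vR RT res]] := exists_place.
have gE : g.+2 = (p + q.+3)%N by lia.
move: hS; rewrite gE => hS'.
have [s [z [sn0 nz SE]]] := linear_vosper vR RT res sA sB sS AB dA dB hS'.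
by exists s, z, (p + q.+1)%N; split=> //; rewrite SE !addnS.
Qed.

End Extension.

Lemma mult_two g : @dim_eq _ _ iota K^o S [set 0] g.+2 ->
  Om 2 `<=` prodset S (Om 1) \/ progression iota S.
Proof.
move=> hS; have [hp|np] := pselect (progression iota S); first by right.
left=> f0 Of0; apply: contrapT => nf0.
have [al [ha hal tf0]] := exists_class hC hw Of0 nf0.
have [|[phi hphi]|//] := @ext_split_or_progression al g hS.
  move=> s Ss; have [x hx] := class_lift hC hw ha hal Ss; exists x => P cP.
  apply: (canonical_reflexive1 hC hw cP) => h wh; rewrite mulrC; apply: hx => //.
  by rewrite (mod_power1 hC hw).
move/eqP: tf0; apply; apply: (class_trivial hC hw nHG (m := 1) (phi := phi)) => //.
move=> s P g' Ss cP; rewrite (mod_power1 hC hw)// => wg; apply: wM => //; exact: hphi.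
Qed.

Lemma mult_all g : @dim_eq _ _ iota K^o S [set 0] g.+2 -> progression iota S \/
  forall m, Om m.+2 `<=` prodset S (Om m.+1).
Proof.
move=> hS; have [h2|] := mult_two hS; last by left.
have [h3|] := mult_three hC hw nHG hS; last by left.
right=> -[|[|m]] //; exact: (mult_high hC hw nHG hS).
Qed.

End Quadrics.

(** * Geometric progressions of sections *)

Section Powers.
Variables (k : closedFieldType) (K : fieldType) (iota : {rmorphism k -> K}).
Variables (P : set K) (sP : subalgebra iota P).

Lemma powers_le z l m x : (l <= m)%N -> powers P z l x -> powers P z m x.
Proof. by move=> lm [p [hp sp ->]]; exists p; split=> //; apply: leq_trans sp _. Qed.

Lemma powers_mul z l m x y : powers P z l x -> powers P z m y -> powers P z (l + m) (x * y).
Proof.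
move=> [p [hp sp ->]] [q [hq sq ->]]; exists (p * q); rewrite hornerM; split=> //.
  exact: (poly_inM sP).
apply: leq_trans (size_polyMleq _ _) _.
by move: sp sq; case: (size p) => [|a]; case: (size q) => [|b]; lia.
Qed.

Lemma powers_peval z (q : {poly k}) : powers P z (size q) (peval iota q z).
Proof.
exists (map_poly iota q); rewrite size_map_poly; split=> // i.
by rewrite coef_map; apply: (subalg_const sP).
Qed.

Lemma powers_base z l a : P a -> powers P z l a.
Proof.
move=> Pa; exists a%:P; rewrite hornerC; split=> //; first exact: (poly_inC sP).
by rewrite size_polyC; case: eqP.
Qed.

Lemma powers_shift z c l : powers P z l `<=` powers P (z - iota c) l.
Proof.
move=> _ [p [hp sp ->]]; exists (p \Po ('X + (iota c)%:P)); split.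
- apply: (poly_in_comp sP) => //; apply: (poly_inD sP); first exact: (poly_inX sP).
  by apply: (poly_inC sP); apply: (subalg_const sP).
- by rewrite size_comp_poly2// size_XaddC.
- by rewrite horner_comp [in RHS]hornerD hornerX hornerC subrK.
Qed.

Lemma powers_inv w l x : w != 0 -> powers P w l x -> powers P w^-1 l (x / w ^+ l).
Proof.
move=> w0 [p [hp sp ->]]; exists (\poly_(i < l.+1) p`_(l - i)); split.
- by move=> i; rewrite coef_poly; case: ifP => // _; apply: (subalg0 sP).
- exact: size_poly.
- rewrite (horner_coef_wide _ sp) (@horner_coef_wide _ l.+1) ?size_poly// mulr_suml.
  rewrite (reindex_inj rev_ord_inj)/=; apply: eq_bigr => i _.
  rewrite coef_poly ltn_ord subSS -mulrA; congr (_ * _).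
  have -> : w ^+ l = w ^+ (l - i) * w ^+ i by rewrite -exprD subnK// -ltnS.
  by rewrite exprVn; field; rewrite !expf_neq0.
Qed.

Lemma powers_mem z l : P z -> powers P z l `<=` P.
Proof. by move=> Pz _ [p [hp _ ->]]; apply: (poly_in_horner sP). Qed.

End Powers.

(** * Stalks and growth of omega^n when S is a progression *)

Section Progression.
Variables (k : closedFieldType) (K : fieldType) (iota : {rmorphism k -> K}).
Variable C : set (set K).
Hypothesis hC : complete_curve iota C.
Notation cp := (closed_points C).
Variables (w : set K -> set K) (t : (set K -> K^o) -> k).
Hypothesis hw : canonical_sheaf iota C w t.
Hypothesis nHG : ~ (hyperelliptic iota C /\ forall P, cp P -> exists e, w P = scale e P).

Notation S := (global_sections C (w : set K -> set K^o)).
Notation wn := (mod_power w).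
Notation Om n := (global_sections C (wn n : set K -> set K^o)).

Let gw : good_sheaf C w. Proof. by case: hw. Qed.
Let fw P : cp P -> fracideal P (w P). Proof. by case: gw => h _; apply: h. Qed.
Let sS : @subspace _ _ iota K^o S. Proof. exact: (sections_subspace hC hw). Qed.
Let s0 := @subspace0 _ _ iota K^o.

Lemma sec_power_subspace n : @subspace _ _ iota K^o (sec_power iota S n).
Proof.
case: n => [|n].
  split; first by exists 0; rewrite ?rmorph0.
  by move=> c _ _ [a _ <-] [b _ <-]; exists (c * a + b) => //; rewrite rmorphD rmorphM.
split; first exact: prodset0.
move=> c x y hx hy; apply: prodsetD => //; apply: prodset_mull => // a Sa.
exact: (@subspaceZ _ _ iota K^o _ _ _ sS Sa).
Qed.

Lemma mult_sec_power : (forall m, Om m.+2 `<=` prodset S (Om m.+1)) ->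
  forall m, Om m.+1 `<=` sec_power iota S m.+1.
Proof.
move=> h; elim=> [|m IH].
  move=> x Ox; rewrite -[x]mulr1; apply: prodset_mem; last by exists 1; rewrite ?rmorph1.
  by move=> P cP; rewrite -(mod_power1 hC hw cP); apply: Ox.
by apply: subset_trans (h m) _; apply: prodset_mono.
Qed.

Variables (s z : K) (N : nat).
Hypotheses (sn0 : s != 0) (nz : ~ range iota z) (SE : S = polys_at iota s z N.+2).
(** The top degree in z occurring in S. As dim S = M + 1, the bound of [degree_bound] reads M +
    M. *)
Let M := N.+1.

Let z0 : z != 0.
Proof. by apply/eqP => z0; apply: nz; exists 0; rewrite ?rmorph0. Qed.

Lemma progression_stalk P : cp P -> w P = scale s (powers P z M).
Proof.
move=> cP; have sP := cp_subalg hC cP; rewrite (canonical_generated hC hw nHG cP).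
have fp := powers_fracideal hC z M cP; have [pD pZ _] := fp.
apply/seteqP; split.
  apply: prodset_sub.
  - by exists 0; rewrite ?mulr0//; apply: (fracideal0 hC cP fp).
  - by move=> _ _ [x hx <-] [y hy <-]; exists (x + y); [apply: pD|rewrite mulrDr].
  - move=> a b; rewrite SE => -[p sp ->] Pb; exists (b * peval iota p z); last by ring.
    apply: pZ => //; exists (map_poly iota p); rewrite size_map_poly; split=> // i.
    by rewrite coef_map; apply: (subalg_const sP).
move=> _ [_ [p [hp sp ->]] <-]; rewrite (horner_coef_wide _ sp) mulr_sumr.
elim/big_rec: _ => [|i x _ hx]; first exact: prodset0.
apply: prodsetD => //; have -> : s * (p`_i * z ^+ i) = (s * z ^+ i) * p`_i by ring.
by apply: prodset_mem => //; rewrite SE; apply: mem_polys_at.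
Qed.

Lemma progression_power P n : cp P -> wn n P = scale (s ^+ n) (powers P z (n * M)).
Proof.
move=> cP; have sP := cp_subalg hC cP; elim: n => [|n IH].
  rewrite expr0 scale1 mul0n; apply/seteqP; split=> [x Px|_ [p [hp sp ->]]]; first exact: (powers_base sP).
  by rewrite (size1_polyC sp) hornerC.
have fp := powers_fracideal hC z (n.+1 * M) cP; have [pD pZ _] := fp.
rewrite /= IH (progression_stalk cP); apply/seteqP; split.
  apply: prodset_sub.
  - by exists 0; rewrite ?mulr0//; apply: (fracideal0 hC cP fp).
  - by move=> _ _ [x hx <-] [y hy <-]; exists (x + y); [apply: pD|rewrite mulrDr].
  - move=> _ _ [x hx <-] [y hy <-]; exists (x * y); last by rewrite exprS; ring.
    by rewrite mulSn; apply: (powers_mul sP).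
move=> _ [_ [p [hp sp ->]] <-]; rewrite (horner_coef_wide _ sp) mulr_sumr.
elim/big_rec: _ => [|i x _ hx]; first exact: prodset0.
apply: prodsetD => //.
have [iE i1 i2] : [/\ i = (minn i M + (i - minn i M))%N :> nat, (minn i M <= M)%N &
    (i - minn i M <= n * M)%N].
  by have := ltn_ord i; move: (nat_of_ord i) => j; rewrite mulSn => ?; split; lia.
have -> : s ^+ n.+1 * (p`_i * z ^+ i) =
    (s * z ^+ minn i M) * (s ^+ n * (p`_i * z ^+ (i - minn i M))).
  have zE : z ^+ i = z ^+ minn i M * z ^+ (i - minn i M) by rewrite -exprD -iE.
  by rewrite zE exprS; ring.
apply: prodset_mem.
  by exists (z ^+ minn i M) => //; apply: (mem_powers hC).
exists (p`_i * z ^+ (i - minn i M)) => //.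
have [_ pZ' _] := powers_fracideal hC z (n * M) cP.
by apply: pZ' => //; apply: (mem_powers hC).
Qed.

(** The points where z fails to define a map to the line. At the others omega is generated by s or
    by s z^M ([good_stalk]). *)
Definition bad_point P := cp P /\ ~ P z /\ ~ P z^-1.

Lemma good_stalk P : cp P -> ~ bad_point P -> exists e, w P = scale e P /\
  forall n, wn n P = scale (e ^+ n) P.
Proof.
move=> cP nb; have sP := cp_subalg hC cP.
have [Pz|nPz] := pselect (P z).
  have pE l : powers P z l = P.
    by apply/seteqP; split=> [|x Px]; [exact: (powers_mem sP)|exact: (powers_base sP)].
  exists s; split; first by rewrite (progression_stalk cP) pE.
  by move=> n; rewrite (progression_power n cP) pE.
have Pz' : P z^-1 by apply: contrapT => h; apply: nb.
have pE l : powers P z l = scale (z ^+ l) P.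
  apply/seteqP; split=> [x hx|_ [x Px <-]].
    apply/scaleP; first by rewrite expf_neq0.
    rewrite mulrC; apply: (powers_mem sP Pz' (l := l)).
    exact: (powers_inv sP).
  rewrite mulrC; have [_ pZ _] := powers_fracideal hC z l cP; apply: pZ => //.
  exact: (mem_powers hC).
exists (s * z ^+ M); split; first by rewrite (progression_stalk cP) pE scaleA.
by move=> n; rewrite (progression_power n cP) pE scaleA exprMn -exprM mulnC.
Qed.

(** Up to clearing denominators, independence over k(z). *)
Definition indep_over r (e : 'I_r -> K) := forall c : 'I_r -> {poly k},
  \sum_i peval iota (c i) z * e i = 0 -> forall i, c i = 0.

(** Only finitely many points lack e. At such a point write e = a/b: the powers 1, ..., z^D are
    dependent modulo b, where D is the length of O_Q/bO_Q, so some q(z) e is a polynomial in z over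
    the local ring. The product of these q serves everywhere. *)
Lemma clear_denominators e : exists p l, p != 0 /\
  forall P, cp P -> powers P z l (peval iota p z * e).
Proof.
have /finite_seqP[T TE] := cp_finite hC e.
have [p [l [p0 hp]]] : exists p l, p != 0 /\
    forall P, cp P -> P \in T \/ P e -> powers P z l (peval iota p z * e).
  elim: T {TE} => [|Q T [p [l [p0 hp]]]].
    exists 1, 0%N; rewrite oner_neq0; split=> // P cP [//|Pe].
    by rewrite peval1 mul1r; apply: (powers_base (cp_subalg hC cP)).
  have [q [l' [q0 hq]]] : exists q l', q != 0 /\ (cp Q -> powers Q z l' (peval iota q z * e)).
    have [cQ|nQ] := pselect (cp Q); last by exists 1, 0%N; rewrite oner_neq0.
    have sQ := cp_subalg hC cQ; have [a [b [Qa Qb b0 eE]]] := cp_frac hC e cQ.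
    have fQ := fracideal_self hC cQ.
    have [D hD] := fracideal_dim_eq hC cQ fQ (fracideal_scale b0 fQ).
    have fM := powers_fracideal hC z D cQ.
    have hM := fracideal_mult hC cQ Qb b0 fQ fM hD.
    have hM' := dim_eq_le (fracideal_subspace hC cQ (fracideal_scale b0 fM)) hM.
    have [i|c [[j cj] [x hx hc]]] := hM' (fun i => z ^+ i).
      by apply: (mem_powers hC) => //; rewrite -ltnS.
    pose q := \poly_(i < D.+1) c (inord i).
    have qi (i : 'I_D.+1) : q`_i = c i by rewrite coef_poly ltn_ord inord_val.
    exists q, D; split=> [|_].
      by apply: contraNneq cj => /(congr1 (fun r : {poly k} => r`_j)); rewrite qi coef0 => ->.
    have -> : peval iota q z * e = a * x.
      have -> : peval iota q z = b * x.
        rewrite (@pevalE _ _ _ D.+1) ?size_poly// hc; apply: eq_bigr => i _.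
        by rewrite qi.
      by rewrite eE; field.
    by have [_ pZ _] := fM; apply: pZ.
  exists (q * p), (maxn (size q + l) (size p + l'))%N; rewrite mulf_neq0//; split=> // P cP.
  have sP := cp_subalg hC cP.
  have old : P \in T \/ P e ->
      powers P z (maxn (size q + l) (size p + l')) (peval iota (q * p) z * e).
    move=> h; apply: powers_le (leq_maxl _ _) _; rewrite pevalM -mulrA.
    by apply: (powers_mul sP); [apply: powers_peval|apply: hp].
  case=> [|Pe]; last by apply: old; right.
  rewrite inE => /orP[/eqP PQ|PT]; last by apply: old; left.
  apply: powers_le (leq_maxr _ _) _; rewrite pevalM [_ * peval _ p _]mulrC -mulrA.
  by apply: (powers_mul sP); [apply: powers_peval|rewrite PQ; apply: hq; rewrite -PQ].
exists p, l; split=> // P cP; apply: hp => //.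
have [Pe|nPe] := pselect (P e); first by right.
by left; have : [set` T] P by rewrite -TE.
Qed.

(** The elements s^n z^j p_i(z) e_i with j < (n - m0) M are independent sections of omega^n; m0
    bounds the degrees in z that clearing denominators introduces, and m0 <= m0 M leaves room for
    them. *)
Lemma sections_lower_bound r (e : 'I_r -> K) : indep_over e -> exists m0, forall n d,
  (m0 <= n)%N -> @dim_le _ _ iota K^o (Om n) [set 0] d -> (r * ((n - m0) * M) <= d)%N.
Proof.
move=> ie; have /choice[pl hpl] : forall i, exists pl : {poly k} * nat, pl.1 != 0 /\
    forall P, cp P -> powers P z pl.2 (peval iota pl.1 z * e i).
  by move=> i; have [p [l h]] := clear_denominators (e i); exists (p, l).
pose m0 := (\max_i (pl i).2)%N; exists m0 => n d mn hd.
set L := ((n - m0) * M)%N.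
pose mat := \matrix_(i < r, j < L) (s ^+ n * (z ^+ j * (peval iota (pl i).1 z * e i))).
pose fam (u : 'I_(r * L)) : K^o := mxvec mat 0 u.
apply: (free_le (e := fam) _ _ s0 hd).
  move=> u; case/mxvec_indexP: u => i j; rewrite /fam mxvecE mxE => P cP.
  have sP := cp_subalg hC cP.
  rewrite (progression_power n cP); exists (z ^+ j * (peval iota (pl i).1 z * e i)) => //.
  have [_ h] := hpl i.
  apply: (@powers_le _ _ _ (j + (pl i).2)); last first.
    by apply: (powers_mul sP); [apply: (mem_powers hC)|apply: h].
  have h1 : ((pl i).2 <= m0)%N by exact: (leq_bigmax i).
  have h2 := ltn_ord j; rewrite /L in h2.
  have h3 : (m0 <= m0 * M)%N by rewrite leq_pmulr.
  rewrite -(subnK mn) mulnDl; apply: leq_add; first exact: ltnW.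
  exact: leq_trans h1 h3.
move=> c hc.
pose q i := \poly_(j < L) (if insub j is Some j' then c (mxvec_index i j') else 0).
have qE (i : 'I_r) : peval iota (q i) z = \sum_(j < L) iota (c (mxvec_index i j)) * z ^+ j.
  rewrite (@pevalE _ _ _ L) ?size_poly//; apply: eq_bigr => j _.
  by rewrite coef_poly ltn_ord valK.
have lE : lincomb iota c fam = s ^+ n * \sum_i peval iota (q i * (pl i).1) z * e i.
  rewrite /lincomb (reindex _ (curry_mxvec_bij r L)) mulr_sumr.
  transitivity (\sum_(p : 'I_r * 'I_L) iota (c (mxvec_index p.1 p.2)) *: fam (mxvec_index p.1 p.2)).
    by apply: eq_bigr => -[i j] _.
  rewrite -(pair_bigA _ (fun i j => iota (c (mxvec_index i j)) *: fam (mxvec_index i j)))/=.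
  apply: eq_bigr => i _; rewrite pevalM qE !mulr_suml mulr_sumr; apply: eq_bigr => j _.
  by rewrite /fam mxvecE mxE /GRing.scale/=; ring.
move: hc; rewrite lE => /eqP; rewrite mulf_eq0 expf_eq0 (negbTE sn0) andbF/= => /eqP.
move=> /ie hq u; case/mxvec_indexP: u => i j.
have [pl0 _] := hpl i; have /eqP := hq i; rewrite mulf_eq0 (negbTE pl0) orbF => /eqP qi0.
have := congr1 (fun p : {poly k} => p`_j) qi0.
by rewrite coef_poly ltn_ord valK coef0.
Qed.

Lemma bad_finite : finite_set [set P | bad_point P].
Proof. by apply: sub_finite_set (cp_finite hC z) => P [cP [nz' _]]. Qed.

Lemma generic_shift (T : seq (set K)) : exists c, forall P, P \in T -> cp P ->
  exists D (b : nat -> K), (forall i, P (b i)) /\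
    (z - iota c)^-1 ^+ D = \sum_(i < D) b i * (z - iota c)^-1 ^+ i.
Proof.
suff [L hL] : exists L : seq k, forall c, c \notin L -> forall P, P \in T -> cp P ->
    exists D (b : nat -> K), (forall i, P (b i)) /\
    (z - iota c)^-1 ^+ D = \sum_(i < D) b i * (z - iota c)^-1 ^+ i.
  by have [c cL] := exists_notin L; exists c; apply: hL.
elim: T => [|P T [L hL]]; first by exists [::].
have [cP|nP] := pselect (cp P); last first.
  exists L => c cL Q; rewrite inE => /orP[/eqP -> //|]; exact: hL.
have [L' hL'] := integral_shift hC cP nz.
exists (L' ++ L) => c; rewrite mem_cat negb_or => /andP[cL' cL] Q.
by rewrite inE => /orP[/eqP -> _|]; [exact: hL'|exact: hL].
Qed.

(* deg(omega^n) <= n (2g - 2) + O(1), where a bad point P contributes O(1) instead of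
   n dim(omega_P / u P), for u = s (z - c)^M with c general. *)
Lemma sections_upper_bound : exists b, (forall n, @dim_le _ _ iota K^o (Om n) [set 0] (n * (M + M) + b)) /\
  ((exists P, bad_point P) -> forall n, @dim_le _ _ iota K^o (Om n) [set 0] (n * (M + M).-1 + b)).
Proof.
have /finite_seqP[Tb TbE] := bad_finite.
(* For this c, 1/(z - c) is integral over the local ring of each bad point. *)
have [c hc] := generic_shift Tb.
have v0 : z - iota c != 0 by rewrite subr_eq0; apply/eqP => h; apply: nz; exists c.
pose u := s * (z - iota c) ^+ M; have u0 : u != 0 by rewrite mulf_neq0 ?expf_neq0.
have Su : S u.
  rewrite SE; exists (('X - c%:P) ^+ M); first by rewrite size_exp_XsubC.
  rewrite /u; congr (_ * _); rewrite /peval rmorphXn/= rmorphB/= map_polyX map_polyC/=.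
  by rewrite horner_exp hornerD hornerN hornerX hornerC.
have hS : @dim_eq _ _ iota K^o S [set 0] N.+2 by rewrite SE; apply: polys_at_dim.
have finT : finite_set [set P | cp P /\ w P <> scale u P].
  have [_ fin] := gw; apply: (@sub_finite_set _ _ ([set P | cp P /\ w P <> P] `|`
      [set P | cp P /\ exists2 x, x \in [:: u; u^-1] & ~ P x])).
    move=> P [cP nP]; have [wP|nwP] := pselect (w P = P); last by left.
    right; split=> //; apply: contrapT => h; apply: nP; rewrite wP.
    have Px x : x \in [:: u; u^-1] -> P x by move=> hx; apply: contrapT => nx; apply: h; exists x.
    have sP := cp_subalg hC cP; apply/seteqP; split=> [x hx|_ [x hx <-]].
      by apply/(scaleP _ _ u0); apply: (subalgM sP) => //; apply: Px; rewrite !inE eqxx orbT.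
    by apply: (subalgM sP) => //; apply: Px; rewrite inE eqxx.
  by rewrite finite_setU; split=> //; exact: (cp_finite_seq hC).
have /finite_seqP[T0 T0E] := finT; pose T := undup T0.
have Tcp P : P \in T -> cp P /\ w P <> scale u P.
  by rewrite mem_undup => PT; have : [set` T0] P by []; rewrite -T0E.
have TP P : cp P -> w P <> scale u P -> P \in T.
  by move=> cP h; rewrite mem_undup; have : [set` T0] P by rewrite -T0E.
have /choice[d hd] : forall P, exists d, P \in T -> @dim_eq _ _ iota K^o (w P) (scale u P) d.
  move=> P; have [PT|nT] := boolP (P \in T); last by exists 0%N.
  have [cP _] := Tcp P PT.
  have [d hd] := fracideal_dim_eq hC cP (fw cP) (fracideal_scale u0 (fracideal_self hC cP)).
  by exists d.
have dsum : (\sum_(P <- T) d P <= M + M)%N.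
  apply: (degree_bound hC hw Su u0 hS (undup_uniq _)) => [P /Tcp[]//|P PT].
  exact: hd.
have badTb P : bad_point P -> P \in Tb.
  by move=> bP; have : [set` Tb] P by rewrite -TbE.
(* bad points: the stalk of omega^n lies in u^n P[1/(z - c)] *)
have hbad P : bad_point P -> exists b, forall n,
    @dim_le _ _ iota K^o (wn n P) (scale (u ^+ n) P) b.
  move=> bP; have cP := bP.1; have sP := cp_subalg hC cP.
  have [D [b [Pb hb]]] := hc P (badTb P bP) cP.
  have [m hm] := fracideal_dim hC cP (powers_fracideal hC (z - iota c)^-1 D cP) (fracideal_self hC cP).
  exists m => n; have un0 : u ^+ n != 0 by rewrite expf_neq0.
  apply: dim_le_mono (dim_le_scale un0 hm) => // x.
  rewrite (progression_power n cP) => -[y hy <-].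
  have := powers_inv sP v0 (powers_shift sP c hy).
  move=> /(integral_powers hC cP Pb hb) h.
  exists (y / (z - iota c) ^+ (n * M)) => //.
  by rewrite /u exprMn -exprM [(M * n)%N]mulnC; field; rewrite expf_neq0.
(* At a good point w_P = eP and u = v e, so the colength of u^n P in e^n P is n d_P. *)
have hgood P : P \in T -> ~ bad_point P -> forall n,
    @dim_le _ _ iota K^o (wn n P) (scale (u ^+ n) P) (n * d P).
  move=> PT nb n; have [cP _] := Tcp P PT; have sP := cp_subalg hC cP.
  have [e [wE wnE]] := good_stalk cP nb.
  have e0 : e != 0.
    apply/eqP => e0; have [_ _ [c' [_ [c'0 _ hc' _]]]] := fw cP.
    have := hc' 1 (subalg1 sP); rewrite wE e0 mulr1 => -[x _ /eqP].
    by rewrite mul0r eq_sym (negbTE c'0).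
  have eV0 : e^-1 != 0 by rewrite invr_eq0.
  pose v := u / e; have v'0 : v != 0 by rewrite mulf_neq0.
  have Pv : P v.
    by have := Su P cP; rewrite wE => /(scaleP _ _ e0); rewrite mulrC.
  have hv : @dim_eq _ _ iota K^o P (scale v P) (d P).
    have := dim_eq_scale eV0 (hd P PT).
    by rewrite wE !scaleA mulVf// scale1 [e^-1 * u]mulrC.
  have := dim_eq_scale (expf_neq0 n e0) (dim_eq_pow hC cP Pv v'0 (fracideal_self hC cP) hv n).
  rewrite scaleA -exprMn /v [e * _]mulrC divfK// -wnE => h.
  apply: (dim_eq_le _ h); apply: (fracideal_subspace hC cP).
  by apply: fracideal_scale; [rewrite expf_neq0|apply: (fracideal_self hC cP)].
have /choice[bb hbb] : forall P, exists b, bad_point P -> forall n,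
    @dim_le _ _ iota K^o (wn n P) (scale (u ^+ n) P) b.
  move=> P; have [bP|nb] := pselect (bad_point P); last by exists 0%N.
  by have [b hb] := hbad P bP; exists b.
pose isbad P := `[< bad_point P >].
pose cnt n P := (if isbad P then bb P else n * d P)%N.
have upper n : @dim_le _ _ iota K^o (Om n) [set 0] (\sum_(P <- T) cnt n P + 1).
  have un0 : u ^+ n != 0 by rewrite expf_neq0.
  have sO := sections_pow_subspace hC hw n.
  have suT P : P \in T -> @subspace _ _ iota K^o (scale (u ^+ n) P).
    by move=> /Tcp[cP _]; apply: scale_subspace; apply: subalg_subspace; apply: (cp_subalg hC cP).
  have hcnt P : P \in T -> @dim_le _ _ iota K^o (Om n) (scale (u ^+ n) P) (cnt n P).
    move=> PT; have [cP _] := Tcp P PT.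
    have sub : Om n `<=` wn n P by move=> x; apply.
    rewrite /cnt /isbad; case: asboolP => bP; first exact: dim_le_mono (hbb P bP n).
    exact: dim_le_mono (hgood P PT bP n).
  have hI := dim_le_inter sO suT hcnt.
  apply: (dim_le_trans sO _ s0 hI).
    apply: subspaceI => //; split=> [P PT|a x y hx hy P PT]; first by case: (suT P PT).
    by have [_ h] := suT P PT; apply: h; [apply: hx|apply: hy].
  (* Off T the stalk of omega^n is u^n P. A section in u^n P at the points of T as well is a
     constant times u^n, whence the summand 1. *)
  apply: (@dim_le_spans _ _ iota K^o _ _ _ (fun=> u ^+ n)) => // f [Of hf].
  have [a _ aE] : range iota (f / u ^+ n).
    apply: (regular_const hC) => P cP.
    suff /(scaleP _ _ un0) : scale (u ^+ n) P f by rewrite mulrC.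
    have [wP|nwP] := pselect (w P = scale u P); last by apply: hf; apply: TP.
    suff <- : wn n P = scale (u ^+ n) P by apply: Of.
    elim: (n) => [|m IH]; first by rewrite expr0 scale1.
    rewrite /= IH wP; have sP := cp_subalg hC cP; apply/seteqP; split.
      apply: prodset_sub.
      - by exists 0; rewrite ?mulr0//; apply: (subalg0 sP).
      - by move=> _ _ [x hx <-] [y hy <-]; exists (x + y); [apply: (subalgD sP)|rewrite mulrDr].
      - move=> _ _ [x hx <-] [y hy <-]; exists (x * y); first exact: (subalgM sP).
        by rewrite exprS; ring.
    move=> _ [x Px <-]; rewrite exprS -mulrA; apply: prodset_mem; last by exists x.
    by exists 1; rewrite ?mulr1//; apply: (subalg1 sP).
  exists (fun=> a); rewrite /lincomb big_ord1 aE /GRing.scale/= divfK//.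
  by rewrite subrr.
pose dg P := (if isbad P then 0 else d P)%N.
have cntE n : (\sum_(P <- T) cnt n P <= n * (\sum_(P <- T) dg P) + \sum_(P <- T) bb P)%N.
  rewrite big_distrr -big_split; apply: leq_sum => P _; rewrite /cnt /dg.
  by case: ifP => _ /=; rewrite ?muln0 ?add0n ?leq_addr.
have dgle : (\sum_(P <- T) dg P <= \sum_(P <- T) d P)%N.
  by apply: leq_sum => P _; rewrite /dg; case: ifP.
exists ((\sum_(P <- T) bb P) + 1)%N; split=> [n|[P0 bP0] n].
  apply: dim_le_leq (upper n); rewrite addnA leq_add2r.
  apply: leq_trans (cntE n) _; rewrite leq_add2r leq_mul2l; apply/orP; right.
  exact: leq_trans dgle dsum.
have cP0 := bP0.1; have sP0 := cp_subalg hC cP0.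
(* Otherwise s (z - c)^N / u = 1/(z - c) would be regular at P0, and then z or 1/z as well. So d_P0
   > 0, and omitting it leaves a slope of at most 2M - 1. *)
have nw : w P0 <> scale u P0.
  move=> wE; pose y := (z - iota c)^-1; have Py : P0 y.
    have : w P0 (s * (z - iota c) ^+ N).
      rewrite (progression_stalk cP0); exists ((z - iota c) ^+ N) => //.
      exists (('X - (iota c)%:P) ^+ N); rewrite horner_exp hornerD hornerN hornerX hornerC.
      rewrite size_exp_XsubC; split=> //.
      elim: (N) => [|j IH]; first by rewrite expr0; apply: (poly_inC sP0); apply: (subalg1 sP0).
      rewrite exprS; apply: (poly_inM sP0) => //; rewrite -polyCN; apply: (poly_inD sP0).
        exact: (poly_inX sP0).
      by apply: (poly_inC sP0); apply: (subalgN sP0); apply: (subalg_const sP0).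
    rewrite wE => /(scaleP _ _ u0).
    have -> : u^-1 * (s * (z - iota c) ^+ N) = y.
      by rewrite /u /y /M exprS; field; rewrite ?sn0 ?v0 ?expf_neq0.
    by [].
  have y0 : y != 0 by rewrite invr_eq0.
  have zE : z = iota c + y^-1 by rewrite /y invrK addrC subrK.
  case: bP0 => _ [nPz nPz']; have [my|ny] := pselect (max_ideal P0 y).
    have lP := cp_local hC cP0.
    have [h0 Ph] : 1 + iota c * y != 0 /\ P0 (1 + iota c * y)^-1.
      apply: unitP.
        apply: (subalgD sP0); first exact: (subalg1 sP0).
        by apply: (subalgM sP0) => //; apply: (subalg_const sP0).
      move=> m1; apply: (max_ideal1 sP0); rewrite -(addrK (iota c * y) 1).
      apply: (max_idealB lP) => //; apply: (max_idealM sP0) => //; exact: (subalg_const sP0).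
    apply: nPz'; have -> : z^-1 = y * (1 + iota c * y)^-1.
      have zE2 : z = (1 + iota c * y) / y by rewrite {1}zE; field.
      by rewrite zE2 invf_div.
    exact: (subalgM sP0).
  have [_ Py'] := unitP Py ny; apply: nPz; rewrite zE; apply: (subalgD sP0) => //.
  exact: (subalg_const sP0).
have P0T := TP _ cP0 nw.
have dP0 : (0 < d P0)%N.
  rewrite lt0n; apply/eqP => d0; apply: nw; have := hd P0 P0T; rewrite d0 => -[e [_ _ se]].
  apply/seteqP; split=> [x wx|_ [x Px <-]].
    by have [c'] := se x wx; rewrite /lincomb big_ord0 subr0.
  by have [_ wZ _] := fw cP0; rewrite mulrC; apply: wZ => //; apply: Su.
have dglt : (\sum_(P <- T) dg P < \sum_(P <- T) d P)%N.
  rewrite (big_rem P0)//= [X in (_ < X)%N](big_rem P0)//=.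
  have -> : dg P0 = 0%N by rewrite /dg /isbad; case: asboolP.
  rewrite add0n -add1n; apply: leq_add => //.
  by apply: leq_sum => P _; rewrite /dg; case: ifP.
apply: dim_le_leq (upper n); rewrite addnA leq_add2r.
apply: leq_trans (cntE n) _; rewrite leq_add2r leq_mul2l; apply/orP; right.
have := leq_trans dglt dsum; rewrite /M; lia.
Qed.

End Progression.

(** * Generation of the sections of omega^n by products *)

Section Noether.
Variables (k : closedFieldType) (K : fieldType) (iota : {rmorphism k -> K}).
Variable C : set (set K).
Hypothesis hC : complete_curve iota C.
Notation cp := (closed_points C).
Variables (w : set K -> set K) (t : (set K -> K^o) -> k).
Hypothesis hw : canonical_sheaf iota C w t.
Hypothesis nHG : ~ (hyperelliptic iota C /\ forall P, cp P -> exists e, w P = scale e P).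

Notation S := (global_sections C (w : set K -> set K^o)).
Notation wn := (mod_power w).
Notation Om n := (global_sections C (wn n : set K -> set K^o)).

Let sS : @subspace _ _ iota K^o S. Proof. exact: (sections_subspace hC hw). Qed.
Let s0 := @subspace0 _ _ iota K^o.

Lemma poly_remainder (p : {poly k}) c : exists r, p = r * ('X - c%:P) + (p.[c])%:P.
Proof.
have /factor_theorem[r rE] : root (p - (p.[c])%:P) c.
  by rewrite /root hornerD hornerN hornerC subrr.
by exists r; rewrite -rE subrK.
Qed.

Section Progression.
Variables (s z : K) (N : nat).
Hypotheses (sn0 : s != 0) (nz : ~ range iota z) (SE : S = polys_at iota s z N.+2).
Let M := N.+1.

(** If f is not in k(z), then 1 and f give growth at least 2M n. A bad point would allow only (2M -
    1) n, and a third element independent over k(z) would force 3M n. So [K : k(z)] = 2 and z or 1/z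
    is regular at every point: C is hyperelliptic with principal stalks, the excluded case. *)
Lemma progression_rational f : rational_subfield iota z f.
Proof.
apply: contrapT => nf; have tz := nonconst_transcendental nz.
have ratio (a b : {poly k}) : b != 0 -> peval iota a z + peval iota b z * f = 0 -> False.
  move=> b0 h; apply: nf; exists (- a), b.
  have b0' : peval iota b z != 0 by apply: contraNneq b0 => /tz ->.
  split=> //; rewrite rmorphN hornerN; apply/esym.
  apply: (mulfI b0'); rewrite mulrCA mulfV// mulr1 mulrC.
  by apply/eqP; rewrite eq_sym mulrC -addr_eq0 addrC; apply/eqP.
pose e2 (i : 'I_2) := if i == ord0 then 1 else f.
have ind2 : indep_over iota z e2.
  move=> c; rewrite big_ord_recl big_ord1 /e2 /= mulr1 => h.
  have c1 : c (lift ord0 ord0) = 0 by apply: contrapT => /eqP /ratio; apply; exact: h.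
  move: h; rewrite c1 peval0 mul0r addr0 => /tz c0 i.
  by case: (unliftP ord0 i) => [j|] ->; rewrite ?(ord1 j).
have [b [ub ubbad]] := sections_upper_bound hC hw nHG sn0 nz SE.
have nobad P : cp P -> P z \/ P z^-1.
  move=> cP; apply: contrapT => h; have bP : bad_point C z P.
    by split=> //; split=> h'; apply: h; [left|right].
  have [m0 lb] := sections_lower_bound hC hw nHG sn0 nz SE ind2.
  (* 2 M x <= (m0 + x) (2 M - 1) + b would give x <= m0 (2 M - 1) + b. *)
  pose x := (m0 * (M + M).-1 + b).+1.
  have := lb (m0 + x)%N _ (leq_addr _ _) (ubbad (ex_intro _ P bP) _).
  by rewrite addKn /x /M /=; nia.
have dep3 h : exists c0 c1 c2 : {poly k}, c2 != 0 /\
    peval iota c0 z + peval iota c1 z * f + peval iota c2 z * h = 0.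
  pose e3 (i : 'I_3) := if unlift ord_max i is Some j then e2 j else h.
  have nind3 : ~ indep_over iota z e3.
    move=> ind3; have [m0 lb] := sections_lower_bound hC hw nHG sn0 nz SE ind3.
    pose x := (m0 * (M + M) + b).+1.
    have := lb (m0 + x)%N _ (leq_addr _ _) (ub _).
    by rewrite addKn /x /M /=; nia.
  apply: contrapT => nc; apply: nind3 => c; rewrite big_ord_recr /e3 /= unlift_none.
  have lE i : widen_ord (leqnSn 2) i = lift ord_max i.
    by apply: val_inj; rewrite /= /bump leqNgt ltn_ord.
  under eq_bigr => i _ do rewrite lE liftK.
  move=> hc; have c2 : c ord_max = 0.
    apply: contrapT => /eqP c20; apply: nc.
    exists (c (lift ord_max ord0)), (c (lift ord_max (lift ord0 ord0))), (c ord_max); split=> //.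
    by move: hc; rewrite big_ord_recl big_ord1 /e2 /= mulr1.
  move: hc; rewrite c2 peval0 mul0r addr0 => /(ind2 (fun i => c (lift ord_max i))) hc i.
  by case: (unliftP ord_max i) => [j|] ->.
have deg2 : degree_over iota z 2.
  apply: (@degree_over_two _ _ _ _ 1 f).
    move=> h; have [c0 [c1 [c2 [c20 hE]]]] := dep3 h.
    have c20' : peval iota c2 z != 0 by apply: contraNneq c20 => /tz ->.
    exists (- (peval iota c0 z / peval iota c2 z)), (- (peval iota c1 z / peval iota c2 z)).
    split; try by apply: ratN; apply: ratM; [exact: rat_peval|apply: ratV; exact: rat_peval].
    apply: (mulfI c20'); move/eqP: hE; rewrite addrC addr_eq0 => /eqP ->.
    by field.
  move=> c1 c2 r1 r2 h; have c20 : c2 = 0.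
    apply: contrapT => /eqP c20; apply: nf.
    have -> : f = - (c1 / c2).
      apply: (mulfI c20); move/eqP: h; rewrite mulr1 addrC addr_eq0 => /eqP ->; by field.
    by apply: ratN; apply: ratM => //; apply: ratV.
  by move: h; rewrite c20 mul0r addr0 mulr1.
apply: nHG; split; first exact: (hyperelliptic_intro hC deg2).
move=> P cP; have nb : ~ bad_point C z P.
  by move=> [_ [n1 n2]]; case: (nobad P cP).
have [e [we _]] := good_stalk hC hw nHG sn0 nz SE cP nb.
by exists e.
Qed.

Lemma sec_power_monomial n i : (i <= n * M)%N -> sec_power iota S n (s ^+ n * z ^+ i).
Proof.
elim: n i => [|n IH] i.
  by rewrite mul0n leqn0 => /eqP ->; exists 1; rewrite ?rmorph1// !expr0 mulr1.
rewrite mulSn => hi.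
have [iE i1 i2] : [/\ i = (minn i M + (i - minn i M))%N, (minn i M <= M)%N &
    (i - minn i M <= n * M)%N] by split; lia.
have -> : s ^+ n.+1 * z ^+ i = (s * z ^+ minn i M) * (s ^+ n * z ^+ (i - minn i M)).
  by rewrite {1}iE exprD exprS; ring.
by apply: prodset_mem; [rewrite SE; apply: mem_polys_at|apply: IH].
Qed.

(** f / s^n is a rational function of z lying in R + R z + ... + R z^(nM) at every place R. Places
    where z is finite show that it is a polynomial, and the place z = infinity bounds its degree by
    nM. *)
Lemma progression_sec_power n : Om n `<=` sec_power iota S n.
Proof.
move=> f Of; have z0 : z != 0 by apply/eqP => z0; apply: nz; exists 0; rewrite ?rmorph0.
have sn : s ^+ n != 0 by rewrite expf_neq0.
pose f' : K := (f : K) / s ^+ n.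
have hR R : valuation_ring iota R -> R <> setT -> powers R z (n * M) f'.
  move=> vR RT; have [P cP [PR _]] := cp_dominated hC vR RT.
  have := Of P cP; rewrite (progression_power hC hw nHG sn0 nz SE n cP) => /(scaleP _ _ sn).
  rewrite mulrC -/f' => -[p [hp sp ->]]; exists p; split=> // i; exact: PR.
have [p [q [q0 fE]]] := progression_rational f'.
rewrite -/(peval iota p z) -/(peval iota q z) in q0 fE.
have qN0 : q != 0 by apply: contraNneq q0 => ->; rewrite peval0.
pose d := gcdp p q; have d0 : d != 0 by rewrite gcdp_eq0 negb_and qN0 orbT.
have pE : p = p %/ d * d by rewrite divpK// dvdp_gcdl.
have qE : q = q %/ d * d by rewrite divpK// dvdp_gcdr.
have cop : coprimep (p %/ d) (q %/ d) by apply: coprimep_div_gcd; rewrite qN0 orbT.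
set p1 := p %/ d in pE cop; set q1 := q %/ d in qE cop.
have qz : peval iota q z = peval iota q1 z * peval iota d z by rewrite -pevalM -qE.
have pz : peval iota p z = peval iota p1 z * peval iota d z by rewrite -pevalM -pE.
have [q10 dz0] : peval iota q1 z != 0 /\ peval iota d z != 0.
  by move: q0; rewrite qz mulf_eq0 negb_or => /andP[].
have fE1 : f' * peval iota q1 z = peval iota p1 z.
  by rewrite fE qz pz -mulf_div divff// mulr1 divfK.
(* At a place over a root c of q1, where f' is regular, p1(z) = f' q1(z) vanishes too, so c would be
   a common root. *)
have q1const : size q1 = 1%N.
  apply/eqP; rewrite eqn_leq lt0n size_poly_eq0 andbC.
  have q1N0 : q1 != 0 by apply: contraNneq q10 => ->; rewrite peval0.
  rewrite q1N0 /= leqNgt; apply/negP => sq.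
  have /closed_rootP[c rc] : size q1 != 1 by rewrite neq_ltn sq orbT.
  have nzc : ~ range iota (z - iota c).
    by move=> [a _ aE]; apply: nz; exists (a + c); rewrite // rmorphD aE subrK.
  have [R [vR Rz nRz]] := valuation_exists nzc.
  have RT : R <> setT by move=> RT; apply: nRz; rewrite RT.
  have sR : subalgebra iota R by case: vR.
  have lR := valuation_local vR.
  have zc0 : z - iota c != 0 by apply/eqP => h; apply: nzc; exists 0; rewrite ?rmorph0.
  have mz : max_ideal R (z - iota c) by apply: max_idealP.
  have Rz' : R z by rewrite -(subrK (iota c) z); apply: (subalgD sR) => //; apply: (subalg_const sR).
  have Rf := powers_mem sR Rz' (hR R vR RT).
  have [r rE] := poly_remainder q1 c.
  have mp : max_ideal R (peval iota p1 z).
    rewrite -fE1 rE (rootP rc) addr0 pevalM pevalB pevalX pevalC mulrA.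
    apply: (max_idealM sR) => //; apply: (subalgM sR) => //; exact: subalgebra_peval.
  have [r' r'E] := poly_remainder p1 c.
  have /(max_ideal_const sR) pc : max_ideal R (iota p1.[c]).
    have -> : iota p1.[c] = peval iota p1 z - peval iota r' z * (z - iota c).
      by rewrite {2}r'E pevalD pevalM pevalB pevalX !pevalC addrC addKr.
    by apply: (max_idealB lR) => //; apply: (max_idealM sR) => //; apply: subalgebra_peval.
  have := coprimep_root cop (introT eqP pc); by move/eqP: rc => ->; rewrite eqxx.
have [a a0 q1E] : exists2 a, a != 0 & q1 = a%:P by apply/size_poly1P/eqP.
pose p2 := (a^-1)%:P * p1.
have f'E : f' = peval iota p2 z.
  move: fE1; rewrite q1E /p2 pevalM !pevalC => <-.
  by rewrite fmorphV; field; rewrite fmorph_eq0.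
(* At a place where y = 1/z vanishes, f' / z^(nM) is regular. A degree D > nM would make f' / z^D
   vanish there, although its residue is the leading coefficient of p2. *)
have sp2 : (size p2 <= (n * M).+1)%N.
  rewrite leqNgt; apply/negP => sp.
  have nzV : ~ range iota z^-1.
    by move=> [c _ cE]; apply: nz; exists c^-1; rewrite // fmorphV cE invrK.
  have [R [vR Ry nRy]] := valuation_exists nzV; rewrite invrK in nRy.
  have RT : R <> setT by move=> RT; apply: nRy; rewrite RT.
  have sR : subalgebra iota R by case: vR.
  have lR := valuation_local vR; set y := z^-1 in Ry.
  have y0 : y != 0 by rewrite invr_eq0.
  have my : max_ideal R y by apply: max_idealP; rewrite ?invrK.
  have Rf : R (f' / z ^+ (n * M)).
    by apply: (powers_mem sR Ry (l := n * M)); apply: (powers_inv sR z0); apply: hR.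
  pose D := (size p2).-1.
  have DE : size p2 = D.+1 by rewrite /D prednK//; apply: leq_trans sp.
  have Dn : (n * M < D)%N by rewrite -ltnS -DE.
  have rev : f' / z ^+ D = iota (lead_coef p2) + (\sum_(i < D) iota p2`_i * y ^+ (D - i.+1)) * y.
    rewrite f'E (@pevalE _ _ _ D.+1) ?DE// big_ord_recr /= mulrDl addrC.
    rewrite /lead_coef DE /= mulfK ?expf_neq0//; congr (_ + _).
    rewrite !mulr_suml; apply: eq_bigr => i _.
    rewrite -!mulrA -exprSr subnSK//; congr (_ * _).
    have -> : z ^+ D = z ^+ (D - i) * z ^+ i by rewrite -exprD subnK// ltnW.
    by rewrite /y exprVn; field; rewrite !expf_neq0.
  have ml : max_ideal R (iota (lead_coef p2)).
    have -> : iota (lead_coef p2) =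
        (f' / z ^+ (n * M) * y ^+ (D - (n * M).+1)) * y -
        (\sum_(i < D) iota p2`_i * y ^+ (D - i.+1)) * y.
      have -> : f' / z ^+ (n * M) * y ^+ (D - (n * M).+1) * y = f' / z ^+ D.
        rewrite -mulrA -exprSr subnSK//.
        have -> : z ^+ D = z ^+ (D - n * M) * z ^+ (n * M) by rewrite -exprD subnK// ltnW.
        by rewrite /y exprVn; field; rewrite !expf_neq0.
      by rewrite rev addrK.
    apply: (max_idealB lR); apply: (max_idealM sR) => //.
      by apply: (subalgM sR) => //; apply: (subalgX sR).
    apply: (subalg_sum sR) => i _; apply: (subalgM sR); first exact: (subalg_const sR).
    exact: (subalgX sR).
  have /eqP := max_ideal_const sR ml; rewrite lead_coef_eq0 -size_poly_eq0 DE.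
  by [].
have -> : f = s ^+ n * peval iota p2 z by rewrite -f'E /f'; field.
rewrite (pevalE _ _ sp2) mulr_sumr.
apply: (@subspace_sum _ _ iota K^o) => [|i _]; first exact: (sec_power_subspace hC hw).
have -> : s ^+ n * (iota p2`_i * z ^+ i) = iota p2`_i *: (s ^+ n * z ^+ i : K^o).
  by rewrite /GRing.scale/=; ring.
apply: (@subspaceZ _ _ iota K^o); first exact: (sec_power_subspace hC hw).
by apply: sec_power_monomial; rewrite -ltnS.
Qed.

End Progression.

(** With dim S = 1 the degree bound is 0, so w = uO, and every section of omega^n is a constant
    times u^n. *)
Lemma elliptic_sec_power u n : @dim_eq _ _ iota K^o S [set 0] 1 -> S u -> u != 0 ->
  Om n `<=` sec_power iota S n.
Proof.
move=> hS Su u0 f Of; have gw : good_sheaf C w by case: hw.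
have wE P : cp P -> w P = scale u P.
  move=> cP; have fw : fracideal P (w P) by case: gw => h _; apply: h.
  have [d hd] := fracideal_dim_eq hC cP fw (fracideal_scale u0 (fracideal_self hC cP)).
  have := degree_bound hC hw (T := [:: P]) (d := fun=> d) Su u0 hS isT.
  rewrite big_seq1 leqn0 => h; have /eqP d0 : d == 0%N.
    by apply: h => Q; rewrite inE => /eqP ->.
  rewrite d0 in hd; have [e [_ _ se]] := hd; apply/seteqP; split=> [x wx|_ [x Px <-]].
    by have [c] := se x wx; rewrite /lincomb big_ord0 subr0.
  by have [_ wM _] := fw; rewrite mulrC; apply: wM => //; apply: Su.
have un0 : u ^+ n != 0 by rewrite expf_neq0.
have [c _ cE] : range iota (f / u ^+ n).
  apply: (regular_const hC) => P cP; have sP := cp_subalg hC cP.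
  have hsub m : wn m P `<=` scale (u ^+ m) P.
    elim: m => [|m IH]; first by rewrite expr0 scale1.
    apply: prodset_sub.
    - by exists 0; rewrite ?mulr0//; apply: (subalg0 sP).
    - by move=> _ _ [x hx <-] [y hy <-]; exists (x + y); [apply: (subalgD sP)|rewrite mulrDr].
    - move=> a b; rewrite (wE P cP) => -[x hx <-] /IH[y hy <-]; exists (x * y).
        exact: (subalgM sP).
      by rewrite exprS; ring.
  by have /(scaleP _ _ un0) := hsub n f (Of P cP); rewrite mulrC.
have -> : f = iota c *: (u ^+ n : K^o) by rewrite cE /GRing.scale/= divfK.
apply: (@subspaceZ _ _ iota K^o); first exact: (sec_power_subspace hC hw).
elim: (n) => [|m IH]; first by exists 1; rewrite ?rmorph1.
by rewrite exprS; apply: prodset_mem.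
Qed.

Lemma canonical_noether n : Om n.+1 `<=` sec_power iota S n.+1.
Proof.
have gw : good_sheaf C w by case: hw.
have [u Su u0] := sections_nonzero hC hw nHG.
have [d hd] := H0_finite hC gw.
have [g _ hS] := dim_le_dim_eq sS s0 hd.
case: g hS => [|[|g]] hS.
- have [e [_ _ se]] := hS; have [c] := se u Su; rewrite /lincomb big_ord0 subr0 => /eqP.
  by rewrite (negbTE u0).
- exact: (elliptic_sec_power hS Su u0).
have [[s [z [N [sn0 nz SE]]]]|h] := mult_all hC hw nHG hS.
  exact: (progression_sec_power sn0 nz SE).
exact: (mult_sec_power hC hw h).
Qed.

End Noether.

(** * Symmetric powers *)

Section Evaluation.
Variables (K : fieldType) (T : eqType) (phi : T -> K).

(* A relation rather than a function, because formal sums are just functions with unspecified finite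
   support. *)
Definition formal_value (g : T -> K^o) (x : K) : Prop :=
  exists m (a : 'I_m -> K) (t : 'I_m -> T),
    g = \sum_i a i *: (fun u => (u == t i)%:R : K^o) /\ x = \sum_i a i * phi (t i).

Lemma formal_value_gen t : formal_value (fun u => (u == t)%:R) (phi t).
Proof.
by exists 1%N, (fun=> 1), (fun=> t); rewrite !big_ord1 scale1r mul1r.
Qed.

Lemma formal_value0 : formal_value 0 0.
Proof.
have t : 'I_0 -> T by case.
by exists 0%N, (fun=> 0), t; rewrite !big_ord0.
Qed.

Lemma formal_valueD g h x y : formal_value g x -> formal_value h y -> formal_value (g + h) (x + y).
Proof.
move=> [m [a [t [-> ->]]]] [n [b [u [-> ->]]]].
exists (m + n)%N, (cat_fun a b), (cat_fun t u); rewrite !big_split_ord.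
by split; congr (_ + _); apply: eq_bigr => i _; rewrite ?cat_funl ?cat_funr.
Qed.

Lemma formal_valueZ c g x : formal_value g x -> formal_value (c *: g) (c * x).
Proof.
move=> [m [a [t [-> ->]]]]; exists m, (fun i => c * a i), t.
rewrite scaler_sumr mulr_sumr; split; apply: eq_bigr => i _; first by rewrite scalerA.
by rewrite mulrA.
Qed.

Lemma formal_valueB g h x y : formal_value g x -> formal_value h y -> formal_value (g - h) (x - y).
Proof.
move=> hg /(formal_valueZ (-1)) hh; rewrite -scaleN1r -[y]mul1r -mulNr; exact: formal_valueD.
Qed.

(** Regrouped by distinct symbols u, the sum has as coefficient of phi u the value at u of the
    formal sum, which is 0. *)
Lemma formal_value_uniq0 x : formal_value 0 x -> x = 0.
Proof.
move=> [m [a [t [g0 ->]]]]; pose s := undup (codom t).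
have tE i : a i * phi (t i) = \sum_(u <- s) a i * (u == t i)%:R * phi u.
  rewrite (bigD1_seq (t i)) ?undup_uniq ?mem_undup ?codom_f//= eqxx mulr1.
  by rewrite big1 ?addr0// => u /negbTE ->; rewrite mulr0 mul0r.
under eq_bigr => i _ do rewrite tE.
rewrite exchange_big big1// => u _; rewrite -mulr_suml.
have /(congr1 (fun f : T -> K^o => f u)) := g0; rewrite fct_sumE => h.
by rewrite [X in X * _](_ : _ = 0) ?mul0r.
Qed.

Lemma formal_value_uniq g x y : formal_value g x -> formal_value g y -> x = y.
Proof.
move=> hx hy; apply/eqP; rewrite -subr_eq0; apply/eqP/formal_value_uniq0.
by rewrite -(subrr g); apply: formal_valueB.
Qed.

Lemma formal_value_Rspan (R : set K) (G : set (T -> K^o)) (D : set K) : D 0 ->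
  (forall x y, D x -> D y -> D (x + y)) -> (forall a x, R a -> D x -> D (a * x)) ->
  (forall g, G g -> exists2 x, D x & formal_value g x) ->
  forall g, Rspan R G g -> exists2 x, D x & formal_value g x.
Proof.
move=> D0 DD DM hG; apply: Rspan_sub; last exact: hG.
- by exists 0 => //; apply: formal_value0.
- move=> g h [x Dx gx] [y Dy hy]; exists (x + y); [exact: DD|exact: formal_valueD].
- move=> a g Ra [x Dx gx]; exists (a * x); [exact: DM|exact: formal_valueZ].
Qed.

End Evaluation.

Section SymmetricPowers.
Variables (K : fieldType) (V : lmodType K) (c : V -> K).
Hypothesis cP : forall a u v, c (a *: u + v) = a * c u + c v.
Variable n : nat.
Notation T := {ffun 'I_n -> V}.

Definition tensor_value (t : T) : K := \prod_i c (t i).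

Notation value := (formal_value tensor_value).

Lemma tensor_value_upd t i a u v :
  tensor_value (upd t i (a *: u + v)) = a * tensor_value (upd t i u) + tensor_value (upd t i v).
Proof.
have E w : tensor_value (upd t i w) = c w * \prod_(j | j != i) c (t j).
  rewrite /tensor_value (bigD1 i)//= ffunE eqxx; congr (_ * _).
  by apply: eq_bigr => j /negbTE ji; rewrite ffunE ji.
by rewrite !E cP; ring.
Qed.

Lemma sym_rel_value R (M : set V) g : sym_rel R M g -> value g 0.
Proof.
move=> hg; suff [x -> //] : exists2 x, [set 0] x & value g x.
apply: (formal_value_Rspan _ _ _ _ hg) => //.
- by move=> _ _ -> ->; rewrite addr0.
- by move=> a _ _ ->; rewrite mulr0.
move=> h [[t [i [a [u [v [_ _ _ _ ->]]]]]]|[t [s [_ ->]]]]; exists 0 => //.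
  rewrite -(subrr (tensor_value (upd t i (a *: u + v)))) {2}tensor_value_upd.
  apply: formal_valueB; first exact: formal_value_gen.
  apply: formal_valueD; last exact: formal_value_gen.
  by apply: formal_valueZ; apply: formal_value_gen.
rewrite -(subrr (tensor_value t)); apply: formal_valueB; last exact: formal_value_gen.
have -> : tensor_value t = tensor_value [ffun j => t (s j)].
  rewrite /tensor_value (reindex_perm s)/=; by apply: eq_bigr => j _; rewrite ffunE.
exact: formal_value_gen.
Qed.

Lemma sym_free_value R (M : set V) g : sym_free R M g -> exists x, value g x.
Proof.
move=> hg; suff [x _ hx] : exists2 x, setT x & value g x by exists x.
apply: (formal_value_Rspan _ _ _ _ hg) => //.
by move=> _ [t _ ->]; exists (tensor_value t) => //; apply: formal_value_gen.
Qed.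

Lemma sym_torsion_value R (M : set V) g : sym_torsion R M g -> value g 0.
Proof.
move=> [/sym_free_value[x gx] [a [_ a0 /sym_rel_value h]]].
have /eqP := formal_value_uniq (formal_valueZ a gx) h.
by rewrite mulf_eq0 (negbTE a0)/= => /eqP x0; rewrite x0 in gx.
Qed.

Section Kernel.
Variables (R : set K) (M : set V) (m0 : V).
Hypotheses (R1 : R 1) (RB : forall a b, R a -> R b -> R (a - b))
  (RM : forall a b, R a -> R b -> R (a * b)).
Hypotheses (Mm : M m0) (cm : c m0 != 0).
Hypothesis frac : forall v, M v -> exists a b, [/\ R a, R b, a != 0 & a *: v = b *: m0].

Let R0 : R 0. Proof. by rewrite -(subrr 1); apply: RB. Qed.
Let RN a : R a -> R (- a). Proof. by move=> Ra; rewrite -sub0r; apply: RB. Qed.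
Let RD a b : R a -> R b -> R (a + b). Proof. by move=> Ra Rb; rewrite -[b]opprK; apply: RB => //; apply: RN. Qed.

Lemma sym_relD g h : sym_rel R M g -> sym_rel R M h -> @sym_rel _ _ R M n (g + h).
Proof. exact: RspanD. Qed.

Lemma sym_relZ a g : R a -> sym_rel R M g -> @sym_rel _ _ R M n (a *: g).
Proof.
move=> Ra [m [b [s [Rb Ss ->]]]]; exists m, (fun i => a * b i), s; split=> //.
  by move=> i; apply: RM.
by rewrite scaler_sumr; apply: eq_bigr => i _; rewrite scalerA.
Qed.

Let X0 : T := [ffun=> m0].

(** The slot containing a v + m0 = b m0 + m0 is expanded in two ways, and the two linearity
    relations are subtracted. *)
Lemma sym_rel_upd (t : T) i a b v : (forall j, M (t j)) -> R a -> R b -> M v ->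
  a *: v = b *: m0 -> sym_rel R M (a *: sym_gen (upd t i v) - b *: sym_gen (upd t i m0)).
Proof.
move=> Mt Ra Rb Mv avb.
have rel e u : R e -> M u -> sym_rel R M (sym_gen (upd t i (e *: u + m0)) -
    (e *: sym_gen (upd t i u) + sym_gen (upd t i m0))).
  move=> Re Mu; exists 1%N, (fun=> 1), (fun=> sym_gen (upd t i (e *: u + m0)) -
    (e *: sym_gen (upd t i u) + sym_gen (upd t i m0))); rewrite big_ord1 scale1r; split=> // _.
  by left; exists t, i, e, u, m0.
have -> : a *: sym_gen (upd t i v) - b *: sym_gen (upd t i m0) =
    (sym_gen (upd t i (b *: m0 + m0)) - (b *: sym_gen (upd t i m0) + sym_gen (upd t i m0))) +
    (-1) *: (sym_gen (upd t i (a *: v + m0)) - (a *: sym_gen (upd t i v) + sym_gen (upd t i m0))).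
  by rewrite avb scaleN1r opprB [RHS]addrC addrA subrK opprD addrACA subrr addr0.
apply: sym_relD; first exact: rel.
by apply: sym_relZ; [apply: RN|apply: rel].
Qed.

(** The entries of t are exchanged for m0 one at a time, each at the price of a factor from R. *)
Lemma sym_rel_gen (t : T) : (forall j, M (t j)) -> exists a b, [/\ R a, R b, a != 0 &
  sym_rel R M (a *: sym_gen t - b *: sym_gen X0)].
Proof.
move=> Mt; pose tj j : T := [ffun i : 'I_n => if (i < j)%N then m0 else t i].
have Mtj j i : M (tj j i) by rewrite ffunE; case: ifP.
suff h j : (j <= n)%N -> exists a b, [/\ R a, R b, a != 0 &
    sym_rel R M (a *: sym_gen t - b *: sym_gen (tj j))].
  have [a [b]] := h n (leqnn n); rewrite (_ : tj n = X0); first by exists a, b.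
  by apply/ffunP => i; rewrite !ffunE ltn_ord.
elim: j => [|j IH] jn.
  exists 1, 1; split=> //; first exact: oner_neq0.
  rewrite (_ : tj 0%N = t) ?subrr; first exact: Rspan0.
  by apply/ffunP => i; rewrite ffunE ltn0.
have [a [b [Ra Rb a0 hab]]] := IH (ltnW jn).
have [a' [b' [Ra' Rb' a'0 ab']]] := frac (Mt (Ordinal jn)).
exists (a' * a), (b * b'); split; [exact: RM|exact: RM|by rewrite mulf_neq0|].
have e1 : tj j = upd (tj j) (Ordinal jn) (t (Ordinal jn)).
  apply/ffunP => i; rewrite !ffunE; case: eqP => [->|//]; by rewrite /= ltnn.
have e2 : tj j.+1 = upd (tj j) (Ordinal jn) m0.
  apply/ffunP => i; rewrite !ffunE ltnS leq_eqVlt -val_eqE /=.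
  by case: eqP.
have := sym_rel_upd (Ordinal jn) (Mtj j) Ra' Rb' (Mt _) ab'.
rewrite -e1 -e2 => h.
have -> : (a' * a) *: sym_gen t - (b * b') *: sym_gen (tj j.+1) =
   a' *: (a *: sym_gen t - b *: sym_gen (tj j)) +
   b *: (a' *: sym_gen (tj j) - b' *: sym_gen (tj j.+1)).
  by rewrite !scalerBr !scalerA [b * a']mulrC addrA subrK.
by apply: sym_relD; apply: sym_relZ.
Qed.

(** Modulo relations, a nonzero multiple of g is b times the symbol (m0, ..., m0). Its value b
    c(m0)^n vanishes only for b = 0, so evaluation embeds Sym^n modulo torsion in K. *)
Lemma sym_torsion_kernel g : sym_free R M g -> value g 0 -> sym_torsion R M g.
Proof.
move=> fg g0; split=> //.
suff [a [b [Ra Rb a0 hab]]] : exists a b, [/\ R a, R b, a != 0 &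
    sym_rel R M (a *: g - b *: sym_gen X0)].
  exists a; split=> //; suff b0 : b = 0 by move: hab; rewrite b0 scale0r subr0.
  have h := formal_valueB (formal_valueZ a g0) (formal_valueZ b (formal_value_gen tensor_value X0)).
  have := formal_value_uniq h (sym_rel_value hab); rewrite mulr0 sub0r => /eqP.
  rewrite oppr_eq0 mulf_eq0 => /orP[/eqP //|/prodf_eq0[i _]].
  by rewrite ffunE (negbTE cm).
apply: (Rspan_sub _ _ _ _ fg (M := [set g | exists a b, [/\ R a, R b, a != 0 &
    sym_rel R M (a *: g - b *: sym_gen X0)]])) => /=.
- exists 1, 0; split=> //; first exact: oner_neq0.
  by rewrite scaler0 scale0r subrr; apply: Rspan0.
- move=> x y [a [b [Ra Rb a0 hx]]] [a' [b' [Ra' Rb' a'0 hy]]].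
  exists (a * a'), (a' * b + a * b'); split; [exact: RM|by apply: RD; apply: RM|by rewrite mulf_neq0|].
  have -> : (a * a') *: (x + y) - (a' * b + a * b') *: sym_gen X0 =
      a' *: (a *: x - b *: sym_gen X0) + a *: (a' *: y - b' *: sym_gen X0).
    by rewrite !scalerBr !scalerA scalerDr scalerDl opprD addrACA [a' * a]mulrC.
  by apply: sym_relD; apply: sym_relZ.
- move=> e x Re [a [b [Ra Rb a0 hx]]]; exists a, (e * b); split=> //; first exact: RM.
  have -> : a *: (e *: x) - (e * b) *: sym_gen X0 = e *: (a *: x - b *: sym_gen X0).
    by rewrite scalerBr !scalerA [a * e]mulrC.
  exact: sym_relZ.
- by move=> _ [t Mt ->]; apply: sym_rel_gen.
Qed.

End Kernel.
End SymmetricPowers.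

Section PowerOfSections.
Variables (k : closedFieldType) (K : fieldType) (iota : {rmorphism k -> K}).

Lemma sec_power_monomials (S : set K) n f : sec_power iota S n f ->
  exists m (a : 'I_m -> k) (s : 'I_m -> 'I_n -> K),
    (forall i j, S (s i j)) /\ f = \sum_i iota (a i) * \prod_j s i j.
Proof.
elim: n f => [|n IH] f.
  by move=> [a _ <-]; exists 1%N, (fun=> a), (fun _ _ => 0); split=> [_ []//|]; rewrite big_ord1 big_ord0 mulr1.
apply: (@prodset_sub _ _ _ [set f | exists m (a : 'I_m -> k) (s : 'I_m -> 'I_n.+1 -> K),
  (forall i j, S (s i j)) /\ f = \sum_i iota (a i) * \prod_j s i j]).
- have s : 'I_0 -> 'I_n.+1 -> K by case.
  by exists 0%N, (fun=> 0), s; split=> [[]|]//; rewrite big_ord0.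
- move=> _ _ [m [a [s [Ss ->]]]] [l [b [r [Sr ->]]]].
  exists (m + l)%N, (cat_fun a b), (cat_fun s r); split.
    by apply: (cat_fun_prop (P := fun s : 'I_n.+1 -> K => forall j, S (s j))).
  rewrite big_split_ord; congr (_ + _); apply: eq_bigr => i _; first by rewrite !cat_funl.
  by rewrite !cat_funr.
move=> x y Sx /IH[m [a [s [Ss ->]]]].
exists m, a, (fun i j => if unlift ord0 j is Some j' then s i j' else x); split.
  by move=> i j; case: unliftP.
rewrite mulr_sumr; apply: eq_bigr => i _; rewrite big_ord_recl unlift_none mulrCA.
by congr (_ * (_ * _)); apply: eq_bigr => j _; rewrite liftK.
Qed.

Lemma mod_power_prod P (w : set K -> set K) n (s : 'I_n -> K) : P 1 ->
  (forall j, w P (s j)) -> mod_power w n P (\prod_j s j).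
Proof.
move=> P1; elim: n s => [|n IH] s ws; first by rewrite big_ord0.
by rewrite big_ord_recl; apply: prodset_mem; [apply: ws|apply: IH].
Qed.

Variable C : set (set K).
Hypothesis hC : complete_curve iota C.
Notation cp := (closed_points C).

Lemma open_subset_meet U U' : open_subset C U -> open_subset C U' -> exists2 P, U P & U' P.
Proof.
move=> [_ fU] [_ fU']; apply: contrapT => h; apply: (cp_infinite hC).
apply: (@sub_finite_set _ _ ((cp `\` U) `|` (cp `\` U'))); last by rewrite finite_setU.
move=> P cP; have [UP|nU] := pselect (U P); last by left.
by right; split=> // U'P; apply: h; exists P.
Qed.

(** The values of the germs of g lie in the stalks of omega^(n+1) and are locally constant, so they
    are one section f. By [canonical_noether] f is a sum of products of sections; the corresponding
    symmetric tensor has the values of g, hence differs from it by torsion. *)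
Lemma sympow_surjective (V : vectType K) (omega : set K -> set V) (v0 : V) (t : (set K -> K^o) -> k) n :
  v0 != 0 -> (forall v, exists f, v = f *: v0) ->
  canonical_sheaf iota C (fun P => [set f | omega P (f *: v0)]) t ->
  ~ (hyperelliptic iota C /\ forall P, cp P -> exists e, [set f | omega P (f *: v0)] = scale e P) ->
  sympow_map_surjective iota C omega n.+1.
Proof.
move=> v00 /choice[c cE] hw nHG g hg; set w := (fun P : set K => _) in hw nHG.
have cZ f : c (f *: v0) = f.
  have /eqP := cE (f *: v0); rewrite -subr_eq0 -scalerBl scaler_eq0 (negbTE v00) orbF.
  by rewrite subr_eq0 => /eqP.
have cP a u v : c (a *: u + v) = a * c u + c v.
  by rewrite {1}(cE u) {1}(cE v) scalerA -scalerDl cZ.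
have wc P v : omega P v -> w P (c v) by rewrite {1}(cE v).
pose value := formal_value (@tensor_value _ _ c n.+1).
have [gw _ _ _] := hw; have [fw _] := gw.
have /choice[x hx] : forall P, exists x, cp P -> mod_power w n.+1 P x /\ value (g P) x.
  move=> P; have [cQ|] := pselect (cp P); last by exists 0.
  have [fgP _] := hg P cQ; have sP := cp_subalg hC cQ.
  suff [x wx gx] : exists2 x, mod_power w n.+1 P x & value (g P) x by exists x.
  apply: (formal_value_Rspan _ _ _ _ fgP).
  - exact: prodset0.
  - by move=> ? ?; apply: prodsetD.
  - move=> a y Pa; apply: prodset_mull => b; have [_ wZ _] := fw P cQ; exact: wZ.
  move=> _ [u Mu ->]; exists (tensor_value c u); last exact: formal_value_gen.
  by apply: mod_power_prod => [|j]; [apply: (subalg1 sP)|apply: wc].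
have hU P : cp P -> exists U, [/\ open_subset C U, U P & forall Q, U Q -> x Q = x P].
  move=> cQ; have [_ [U [s [oU UP fs hs]]]] := hg P cQ; exists U; split=> // Q UQ.
  have [y sy] := sym_free_value c fs.
  have xy Q' : U Q' -> x Q' = y.
    move=> UQ'; have cQ' : cp Q' by have [h _] := oU; apply: h.
    have [_ h1] := hx Q' cQ'; have h2 := sym_torsion_value cP (hs Q' UQ').
    apply/eqP; rewrite -subr_eq0; apply/eqP.
    exact: formal_value_uniq (formal_valueB h1 sy) h2.
  by rewrite !xy.
have [P0 cP0] := exists_cp hC; pose f := x P0.
(* Any two nonempty open subsets meet, so locally constant values are globally constant. *)
have xf P : cp P -> x P = f.
  move=> cQ; have [U [oU UP hUx]] := hU P cQ; have [U' [oU' _ hUx']] := hU P0 cP0.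
  have [Q UQ U'Q] := open_subset_meet oU oU'; by rewrite -(hUx Q UQ) hUx'.
have Of : global_sections C (mod_power w n.+1 : set K -> set K^o) f.
  by move=> P cQ; have [h _] := hx P cQ; rewrite -(xf P cQ).
have [m [a [sg [Ssg fE]]]] := sec_power_monomials (canonical_noether hC hw nHG Of).
pose s := \sum_i iota (a i) *: sym_gen [ffun j => sg i j *: v0].
have Ms i j : global_sections C omega ([ffun j => sg i j *: v0] j).
  by rewrite ffunE => P cQ; exact: Ssg.
have sv : value s f.
  rewrite fE; exists m, (fun i => iota (a i)), (fun i => [ffun j => sg i j *: v0]); split=> //.
  apply: eq_bigr => i _; congr (_ * _); apply: eq_bigr => j _; by rewrite ffunE cZ.
exists s.
  exists m, (fun i => iota (a i)), (fun i => sym_gen [ffun j => sg i j *: v0]); split=> //.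
  by move=> i; exists [ffun j => sg i j *: v0].
move=> P cQ; have sP := cp_subalg hC cQ; have [wD wZ [c0 [_ [c00 _ wc0 _]]]] := fw P cQ.
have [fgP _] := hg P cQ; have [_ gx] := hx P cQ.
have [R1 RB RM] : subring P by case: sP.
have oE v : omega P v <-> w P (c v) by rewrite {1}(cE v).
apply: (@sym_torsion_kernel _ _ c cP _ P (omega P) (c0 *: v0)) => //.
- by have := wc0 1 R1; rewrite mulr1.
- by rewrite cZ.
- move=> v _; have [b [d [Pb Pd d0 E]]] := cp_frac hC (c v / c0) cQ; exists d, b; split=> //.
  rewrite (cE v) !scalerA; congr (_ *: _); rewrite -(divfK c00 (c v)) E; by field.
- rewrite -scaleN1r; apply: RspanD => //.
  apply: (RspanZ sP); first by apply: (subalgN sP).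
  exists m, (fun i => iota (a i)), (fun i => sym_gen [ffun j => sg i j *: v0]); split=> //.
    by move=> i; apply: (subalg_const sP).
  by move=> i; exists [ffun j => sg i j *: v0] => // j; apply: Ms.
- by rewrite -(subrr f) -{1}(xf P cQ); apply: formal_valueB.
Qed.

(** This contradicts principal stalks in the nearly Gorenstein case, where the stalk at one point is
    not free. *)
Lemma free_stalk_gorenstein (V : vectType K) (omega : set K -> set V) (v0 : V) P e :
  v0 != 0 -> e != 0 -> (forall v, exists f, v = f *: v0) -> P 1 ->
  [set f | omega P (f *: v0)] = scale e P -> gorenstein_point omega P.
Proof.
move=> v00 e0 hv P1 wE; exists 1%N, (fun=> e *: v0); split=> [_|v ov].
  have : [set f | omega P (f *: v0)] e by rewrite wE; exists 1; rewrite ?mulr1.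
  by [].
have [f fE] := hv v; have : scale e P f by rewrite -wE /= -fE.
move=> [a Pa aE]; exists [ffun=> a]; split.
  split=> [i|]; first by rewrite ffunE.
  by rewrite big_ord1 ffunE scalerA mulrC aE.
move=> b [Pb]; rewrite big_ord1 fE -aE scalerA => /eqP.
rewrite -subr_eq0 -scalerBl scaler_eq0 (negbTE v00) orbF subr_eq0 [_ * e]mulrC => /eqP /(mulfI e0) ab.
by apply/ffunP => i; rewrite ffunE (ord1 i).
Qed.

End PowerOfSections.

Theorem theorem2p6 (k : closedFieldType) (K : fieldType)
    (iota : {rmorphism k -> K}) (C : set (set K))
    (V : vectType K) (omega : set K -> set V)
    (hC : complete_curve iota C)
    (homega : dualizing_sheaf iota C omega)
    (hG : (~ hyperelliptic iota C /\ gorenstein C omega)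
          \/ nearly_gorenstein iota C omega)
    (n : nat) (hn : (1 <= n)%N) :
  sympow_map_surjective iota C omega n.
Proof.
have [cohw [tr [trH dual]]] := homega.
have [v0 [v00 hv hw]] := canonical_exists hC cohw trH dual.
case: n hn => // n _; apply: (sympow_surjective hC v00 hv hw _) => -[hyp hfree].
case: hG => [[]//|[P [cP nP _ _]]]; apply: nP.
(* A principal stalk would be free at the non-Gorenstein point P; its generator e is nonzero because
   the stalk contains a nonzero element. *)
have [e wE] := hfree P cP; have sP := cp_subalg hC cP; have P1 := subalg1 sP.
apply: (free_stalk_gorenstein v00 _ hv P1 wE); apply/eqP => e0.
have [[fw _] _ _ _] := hw; have [_ _ [c [_ [c0 _ wc _]]]] := fw P cP.
have := wc 1 P1; rewrite mulr1 wE e0 => -[x _ /eqP].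
by rewrite mul0r eq_sym (negbTE c0).
Qed.
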